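(* Let $\phi,\widetilde{\phi}\in L^2(\mathbb{R})$ be such that $\{T_k\phi\}_{k\in\mathbb{Z}}$ and $\{T_k\widetilde{\phi}\}_{k\in\mathbb{Z}}$ are Bessel sequences. Let $\mathcal{W}=\overline{\mathrm{span}}\{T_k\phi\}_{k\in\mathbb{Z}}$ and $\mathcal{V}=\overline{\mathrm{span}}\{T_k\widetilde{\phi}\}_{k\in\mathbb{Z}}$. Then, given $\epsilon\ge0$, the following statements are equivalent: (i) $\big\|f-\sum_{k\in\mathbb{Z}}\langle f,T_k\widetilde{\phi}\rangle T_k\phi\big\|\le\epsilon\|f\|$ for $f\in\mathcal{W}$. (ii) $\big\|f-\sum_{k\in\mathbb{Z}}\langle f,T_kP_{\mathcal{W}}\widetilde{\phi}\rangle T_k\phi\big\|\le\epsilon\|f\|$ for $f\in\mathcal{W}$. (iii) $\big|[\widehat{\phi},\widehat{\widetilde{\phi}}](\gamma)-1\big|\le\epsilon$ for a.e. $\gamma\in N(\Phi)^{c}$. Moreover, if $\epsilon<1$, then statements (i) to (iii) are also equivalent to: (iv) $\{T_k\phi\}_{k\in\mathbb{Z}}$ and $\{T_kP_{\mathcal{W}}\widetilde{\phi}\}_{k\in\mathbb{Z}}$ are $\epsilon$-approximate dual frames in $\mathcal{W}$.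
   Context: $T_kf(x)=f(x-k)$ for $k\in\mathbb{Z}$. The Fourier transform is $\widehat{f}(\gamma)=\int_{\mathbb{R}}f(x)e^{-2\pi i x\gamma}\,dx$, extended to a unitary operator of $L^2(\mathbb{R})$. For $\phi,\psi\in L^2(\mathbb{R})$, the 1-periodic bracket is $[\widehat{\phi},\widehat{\psi}](\gamma)=\sum_{k\in\mathbb{Z}}\widehat{\phi}(\gamma+k)\overline{\widehat{\psi}(\gamma+k)}$ (a.e. defined, complex valued); $\Phi(\gamma)=\sum_{k\in\mathbb{Z}}|\widehat{\phi}(\gamma+k)|^2$ and $N(\Phi)=\{\gamma:\Phi(\gamma)=0\}$; $A^c$ is the complement of $A$ in $\mathbb{R}$. $P_{\mathcal{W}}$ is the orthogonal projection onto $\mathcal{W}$. A family $\{f_k\}\subset\mathcal{W}$ is a Bessel sequence for the closed subspace $\mathcal{W}$ if $\sum_k|\langle f,f_k\rangle|^2\le\beta\|f\|^2$ for all $f\in\mathcal{W}$ and some $\beta<\infty$, and a frame for $\mathcal{W}$ if moreover $\alpha\|f\|^2\le\sum_k|\langle f,f_k\rangle|^2$ for all $f\in\mathcal{W}$ and some $\alpha>0$. For a Bessel sequence $\mathcal{F}=\{f_k\}$, $T_{\mathcal{F}}\{c_k\}=\sum_kc_kf_k$ (synthesis operator on $\ell^2$) and $T_{\mathcal{F}}^{*}f=\{\langle f,f_k\rangle\}_k$. Frames $\mathcal{F}$ and $\mathcal{G}$ for $\mathcal{W}$ are $\epsilon$-approximate dual frames in $\mathcal{W}$ if $\|P_{\mathcal{W}}-T_{\mathcal{F}}T_{\mathcal{G}}^{*}\|\le\epsilon$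 or, equivalently, $\|P_{\mathcal{W}}-T_{\mathcal{G}}T_{\mathcal{F}}^{*}\|\le\epsilon$. *)

(* Defs.v *)
From HB Require Import structures.
From mathcomp Require Import all_boot all_order all_algebra finmap complex.
From mathcomp Require Import all_classical all_reals all_analysis.
From mathcomp Require Import showcase.summability.

Set Implicit Arguments.
Unset Strict Implicit.
Unset Printing Implicit Defensive.
Import Order.TTheory GRing.Theory Num.Theory.
Import numFieldNormedType.Exports.
Import ComplexField.Normc.

Local Open Scope classical_set_scope.
Local Open Scope ring_scope.
Local Open Scope complex_scope.

(** Complex-valued functions on the line.  Elements of L^2(R) are represented
    by functions; everything below depends on them only up to equality almost
    everywhere, and the operators [L2sum], [orthoproj] and [fourier] pick one
    representative of their value. *)
Section L2.
Variable R : realType.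
Notation mu := (@lebesgue_measure R).
Implicit Types (f g h s : R -> R[i]) (F G : int -> R -> R[i]).
Implicit Types (c : int -> R[i]) (W : set (R -> R[i])).

Definition measurableC f : Prop :=
  measurable_fun [set: R] (fun x => complex.Re (f x)) /\
  measurable_fun [set: R] (fun x => complex.Im (f x)).

Definition integralC f : R[i] :=
  Rintegral mu [set: R] (fun x => complex.Re (f x)) +i*
  Rintegral mu [set: R] (fun x => complex.Im (f x)).

(** The L^p norm of [f], possibly infinite. *)
Definition normLp (p : \bar R) f : \bar R :=
  Lnorm mu p (fun x => (normc (f x))%:E).

Notation norm2 := (normLp 2%:E).

Definition Lp (p : \bar R) : set (R -> R[i]) :=
  [set f | measurableC f /\ (normLp p f < +oo)%E].

Notation L2 := (Lp 2%:E).

(** Linear in the first argument. *)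
Definition inner f g : R[i] := integralC (fun x => f x * (g x)^*).

Definition translate (k : int) f : R -> R[i] := fun x => f (x - k%:~R).

Definition translates f : int -> R -> R[i] := fun k => translate k f.

(** Finite linear combinations of the [F k]. *)
Definition lspan F : set (R -> R[i]) :=
  [set f | exists (A : {fset int}) (c : int -> R[i]),
     f = partial_sum (fun k x => c k * F k x) A].

Definition closed_span F : set (R -> R[i]) :=
  [set f | L2 f /\
     forall e : R, 0 < e ->
       exists2 g, lspan F g & (norm2 (f - g)%R < e%:E)%E].

(** Sum over Z of a family of vectors of L^2(R): unconditional convergence in
    norm, i.e. along the finite subsets of Z ordered by inclusion. *)
Definition has_L2sum F s : Prop :=
  L2 s /\
  (fun A : {fset int} => norm2 (s - partial_sum F A)) @ totally --> 0%E.

Definition L2sum F : R -> R[i] := xget (fun=> 0) [set s | has_L2sum F s].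

(** [orthoproj W] is the orthogonal projection of L^2(R) onto the closed
    subspace [W]. *)
Definition orthoproj W f : R -> R[i] :=
  xget (fun=> 0) [set g | W g /\ forall h, W h -> inner (f - g) h = 0].

Definition expi (t : R) : R[i] := cos t +i* sin t.

Definition fourierL1 f : R -> R[i] :=
  fun gamma => integralC (fun x => f x * expi (- (2 * pi * x * gamma))).

(** The continuous extension of [fourierL1] from the intersection of L^1 and
    L^2 to L^2. *)
Definition fourier f : R -> R[i] :=
  xget (fun=> 0) [set g | L2 g /\
    exists u : nat -> R -> R[i],
      [/\ forall n, (Lp 1%:E `&` L2) (u n),
          (fun n => norm2 (f - u n)) @ \oo --> 0%E &
          (fun n => norm2 (g - fourierL1 (u n))) @ \oo --> 0%E]].

Definition bracket f g : R -> R[i] := fun gamma =>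
  sum ((fun k : int => f (gamma + k%:~R) * (g (gamma + k%:~R))^*)
    : int -> R[i]^o).

Definition periodization f : R -> \bar R := fun gamma =>
  \esum_(k in [set: int]) (normc (f (gamma + k%:~R)) ^+ 2)%:E.

Definition zero_set (p : R -> \bar R) : set R := [set gamma | p gamma = 0%E].

Definition coeff_energy F f : \bar R :=
  \esum_(k in [set: int]) (normc (inner f (F k)) ^+ 2)%:E.

Definition is_bessel W F : Prop :=
  (forall k, W (F k)) /\
  exists beta : R, forall f, W f ->
    (coeff_energy F f <= beta%:E * norm2 f ^+ 2)%E.

Definition is_frame W F : Prop :=
  is_bessel W F /\
  exists2 alpha : R, 0 < alpha & forall f, W f ->
    (alpha%:E * norm2 f ^+ 2 <= coeff_energy F f)%E.

Definition synthesis F c : R -> R[i] := L2sum (fun k x => c k * F k x).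

Definition analysis F f : int -> R[i] := fun k => inner f (F k).

Definition opnorm (S : (R -> R[i]) -> R -> R[i]) : \bar R :=
  ereal_sup [set norm2 (S f) | f in [set f | L2 f /\ (norm2 f <= 1)%E]].

Definition approx_dual_frames (eps : R) W F G : Prop :=
  [/\ is_frame W F, is_frame W G &
      (opnorm (fun f => orthoproj W f - synthesis F (analysis G f))%R
        <= eps%:E)%E].

End L2.

Notation norm2 := (normLp 2%:E).
Notation L2 := (Lp 2%:E).

(* Main.v *)
(* For a finite combination f = sum_k d_k T_k phi, the Fourier transform of f is
   q times that of phi, where q is a 1-periodic trigonometric polynomial, and the
   coefficients <f, T_k phit> are the Fourier coefficients of q B, where B is the
   bracket of the transforms of phi and phit.  Writing S f for the sum of the
   <f, T_k phit> T_k phi, this gives, with L^2 norms over one period,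
     |f| = |q sqrt(Phi)|   and   |f - S f| = |q (1 - B) sqrt(Phi)|.
   Hence (iii) gives (i) pointwise on the span, and by continuity of S on W.
   Conversely (i) says that the integral of |q|^2 (eps^2 - |1 - B|^2) Phi is
   nonnegative for all q, so that this weight is nonnegative almost everywhere.
   (i) and (ii) have the same coefficients since W is translation invariant.
   If eps < 1, then |f - S f| <= eps |f| on W bounds the coefficients of S f from
   below through the Bessel bound of the T_k phi, and <S f, f> from below, which
   yields the two lower frame bounds. *)

Require Import Defs.
From mathcomp Require Import all_boot all_order all_algebra finmap complex.
From mathcomp Require Import all_classical all_reals all_analysis.
From mathcomp Require Import showcase.summability.
From mathcomp Require Import measurable_realfun.
From mathcomp Require Import ring lra.
Import Order.TTheory GRing.Theory Num.Theory.
Import numFieldNormedType.Exports.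
Import ComplexField.Normc.
Local Open Scope classical_set_scope.
Local Open Scope ring_scope.
Set Implicit Arguments.
Unset Strict Implicit.
Unset Printing Implicit Defensive.

(** Vectors are functions, not classes, and [L2sum], [orthoproj] and [fourier] return an arbitrary
    representative. Equality of vectors is therefore [nrm (f - g) = 0], and the transform is handled
    as a relation, [is_fourier]. The formula for |f - S f| needs a limit, because S f has infinitely
    many coefficients: its partial sums correspond to trigonometric polynomials tending to q B in
    L^2 of a period, and the factor sqrt(Phi) preserves this convergence because Phi <= beta. Since
    the bounds on Phi and B hold only almost everywhere, both are truncated to be bounded
    everywhere. One test is used three times: an integrable h on a period whose integral against
    |p|^2 is nonnegative for all trigonometric polynomials p is nonnegative almost everywhere.
    Applied to the real and imaginary parts of a function and their opposites, it gives completeness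
    of the exponentials, hence Parseval on intervals and Plancherel on the line. Applied to beta -
    Phi, it turns the Bessel condition into Phi <= beta. Its third use is the passage from (i) to
    (iii). *)

Local Notation measurableC := Defs.measurableC.
Local Notation Re := complex.Re.
Local Notation Im := complex.Im.

(** * Complex-valued functions and their integrals *)

Section complex_values.
Variable R : realType.
Notation C := R[i].
Implicit Types z w : C.

Lemma complex_eq z w :
  Re z = Re w -> Im z = Im w -> z = w.
Proof. by case: z => a b; case: w => c d /= -> ->. Qed.

Lemma ReD z w : Re (z + w) = Re z + Re w.
Proof. by case: z; case: w. Qed.
Lemma ImD z w : Im (z + w) = Im z + Im w.
Proof. by case: z; case: w. Qed.
Lemma ReN z : Re (- z) = - Re z.
Proof. by case: z. Qed.
Lemma ImN z : Im (- z) = - Im z.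
Proof. by case: z. Qed.
Lemma ReM z w : Re (z * w) =
  Re z * Re w - Im z * Im w.
Proof. by case: z; case: w. Qed.
Lemma ImM z w : Im (z * w) =
  Re z * Im w + Im z * Re w.
Proof. by case: z; case: w. Qed.
Lemma Re_conj z : Re z^* = Re z.
Proof. by case: z. Qed.
Lemma Im_conj z : Im z^* = - Im z.
Proof. by case: z. Qed.

Lemma normc_ge0 z : 0 <= normc z.
Proof. by case: z => a b /=; exact: sqrtr_ge0. Qed.

Lemma normc_sqr z : normc z ^+ 2 = Re z ^+ 2 + Im z ^+ 2.
Proof. by case: z => a b /=; rewrite sqr_sqrtr// addr_ge0 ?sqr_ge0. Qed.

Lemma normc_conj z : normc z^* = normc z.
Proof. by case: z => a b /=; rewrite sqrrN. Qed.

Lemma normc_real (x : R) : normc (x%:C%C) = `|x|.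
Proof. by rewrite /= expr0n/= addr0 sqrtr_sqr. Qed.

Lemma normc_triangle z w : normc (z + w) <= normc z + normc w.
Proof. exact: (@le_normcD R z w). Qed.

Lemma normcNE z : normc (- z) = normc z.
Proof. by case: z => a b /=; rewrite !sqrrN. Qed.

Lemma normcBC z w : normc (z - w) = normc (w - z).
Proof. by rewrite -normcNE opprB. Qed.

Lemma abs_Re_le z : `|Re z| <= normc z.
Proof.
case: z => a b /=; rewrite -sqrtr_sqr; apply: ler_wsqrtr.
by rewrite lerDl sqr_ge0.
Qed.

Lemma abs_Im_le z : `|Im z| <= normc z.
Proof.
case: z => a b /=; rewrite -sqrtr_sqr; apply: ler_wsqrtr.
by rewrite lerDr sqr_ge0.
Qed.

Lemma normc_le z : normc z <= `|Re z| + `|Im z|.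
Proof.
rewrite -(@ler_pXn2r _ 2) ?nnegrE ?normc_ge0 ?addr_ge0//.
rewrite normc_sqr sqrrD !real_normK ?num_real//.
by rewrite -addrA addrCA lerDr mulrn_wge0// mulr_ge0.
Qed.

Lemma normc_sum (I : Type) (s : seq I) (P : pred I) (F : I -> C) :
  normc (\sum_(i <- s | P i) F i) <= \sum_(i <- s | P i) normc (F i).
Proof.
elim/big_ind2 : _ => [|x1 x2 y1 y2 h1 h2|//]; first by rewrite normc0.
by rewrite (le_trans (normc_triangle _ _))// lerD.
Qed.

Lemma mulc_conj z : z * z^* = (normc z ^+ 2)%:C%C.
Proof.
rewrite normc_sqr; apply: complex_eq; rewrite ?(ReM, ImM) Re_conj Im_conj/=.
  by ring.
by ring.
Qed.

Lemma Re_real (x : R) : Re (x%:C%C) = x. Proof. by []. Qed.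
Lemma realcD (x y : R) : ((x + y)%:C = x%:C + y%:C :> C)%C.
Proof. exact: (rmorphD (real_complex R)). Qed.
Lemma realcN (x : R) : ((- x)%:C = - x%:C :> C)%C.
Proof. exact: (rmorphN (real_complex R)). Qed.
Lemma realcM (x y : R) : ((x * y)%:C = x%:C * y%:C :> C)%C.
Proof. exact: (rmorphM (real_complex R)). Qed.
Lemma realc_conj (x : R) : (x%:C%C : C)^* = x%:C%C.
Proof. by apply: complex_eq; rewrite ?Re_conj ?Im_conj//= oppr0. Qed.

Lemma conjD z w : (z + w)^* = z^* + w^*. Proof. exact: rmorphD. Qed.
Lemma conjM z w : (z * w)^* = z^* * w^*. Proof. exact: rmorphM. Qed.

(** Rotating by the conjugate phase reduces bounds on a modulus to bounds on a real part. The phase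
    is undefined at 0, where [w = 1] serves. *)
Lemma phase_exists z : exists2 w : C, normc w = 1 & w * z = (normc z)%:C%C.
Proof.
have [->|z0] := eqVneq z 0.
  by exists 1; rewrite ?normc1// mulr0 normc0.
have n0 : normc z != 0 by apply: contra z0 => /eqP/eq0_normc ->.
exists (z^* * ((normc z)^-1)%:C%C).
  rewrite normcM normc_conj normc_real ger0_norm ?invr_ge0 ?normc_ge0//.
  by rewrite divff.
rewrite mulrAC [z^* * z]mulrC mulc_conj -realcM expr2 mulfK//.
Qed.

End complex_values.

Section complex_integral.
Variable R : realType.
Notation C := R[i].
Notation mu := (@lebesgue_measure R).
Implicit Types (f g h : R -> C).

Lemma measurableC_cst (c : C) : measurableC (fun=> c : C).
Proof. by split. Qed.

Lemma measurableCD f g : measurableC f -> measurableC g ->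
  measurableC (fun x => f x + g x).
Proof.
move=> [rf jf] [rg jg]; split.
  by under eq_fun do rewrite ReD; exact: measurable_funD.
by under eq_fun do rewrite ImD; exact: measurable_funD.
Qed.

Lemma measurableCN f : measurableC f -> measurableC (fun x => - f x).
Proof.
move=> [rf jf]; split.
  by under eq_fun do rewrite ReN; exact: measurableT_comp.
by under eq_fun do rewrite ImN; exact: measurableT_comp.
Qed.

Lemma measurableCB f g : measurableC f -> measurableC g ->
  measurableC (fun x => f x - g x).
Proof. by move=> mf mg; apply: measurableCD => //; exact: measurableCN. Qed.

Lemma measurableCM f g : measurableC f -> measurableC g ->
  measurableC (fun x => f x * g x).
Proof.
move=> [rf jf] [rg jg]; split.
  under eq_fun do rewrite ReM.
  by apply: measurable_funB; apply: measurable_funM.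
under eq_fun do rewrite ImM.
by apply: measurable_funD; apply: measurable_funM.
Qed.

Lemma measurableC_conj f : measurableC f -> measurableC (fun x => (f x)^*).
Proof.
move=> [rf jf]; split.
  by under eq_fun do rewrite Re_conj.
by under eq_fun do rewrite Im_conj; exact: measurableT_comp.
Qed.

Lemma measurableC_sum (I : Type) (s : seq I) (F : I -> R -> C) :
  (forall i, measurableC (F i)) -> measurableC (fun x => \sum_(i <- s) F i x).
Proof.
move=> mF; elim: s => [|i s ih].
  by under eq_fun do rewrite big_nil; exact: measurableC_cst.
by under eq_fun do rewrite big_cons; exact: measurableCD.
Qed.

Lemma measurableC_real (u : R -> R) : measurable_fun setT u ->
  measurableC (fun x => (u x)%:C%C).
Proof. by move=> mu_; split. Qed.

Lemma measurableC_comp f (u : R -> R) : measurable_fun setT u ->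
  measurableC f -> measurableC (fun x => f (u x)).
Proof.
by move=> mu_ [rf jf]; split; [exact: (measurableT_comp rf)|exact: (measurableT_comp jf)].
Qed.

Lemma measurable_sqr_normc f : measurableC f ->
  measurable_fun setT (fun x => normc (f x) ^+ 2).
Proof.
move=> [rf jf]; under eq_fun do rewrite normc_sqr.
by apply: measurable_funD; exact: measurable_funX.
Qed.

Lemma measurable_normc f : measurableC f ->
  measurable_fun setT (fun x => normc (f x)).
Proof.
move=> mf; rewrite (_ : (fun x => _) = (fun x => Num.sqrt (normc (f x) ^+ 2))).
  apply: (measurableT_comp _ (measurable_sqr_normc mf)).
  by apply: continuous_measurable_fun; exact: sqrt_continuous.
by apply/funext => x; rewrite sqrtr_sqr ger0_norm ?normc_ge0.
Qed.

(** Measurability is a clause of its own: integrability of the modulus does not imply it. *)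
Definition integrableC h := measurableC h /\
  mu.-integrable setT (EFin \o (fun x => normc (h x))).

Lemma integrableC_dom h (g : R -> R) : measurableC h ->
  mu.-integrable setT (EFin \o g) -> (forall x, normc (h x) <= g x) ->
  integrableC h.
Proof.
move=> mh ig hg; split=> //.
apply: le_integrable ig => //.
  by apply/measurable_EFinP; exact: measurable_normc.
move=> x _ /=; rewrite lee_fin ger0_norm ?normc_ge0//.
by rewrite (le_trans (hg x))// ler_norm.
Qed.

Lemma integrable_Re h : integrableC h ->
  mu.-integrable setT (EFin \o (fun x => Re (h x))).
Proof.
move=> [[rh jh] ih]; apply: le_integrable ih => //; first exact/measurable_EFinP.
move=> x _ /=; rewrite lee_fin [leRHS]ger0_norm ?normc_ge0//; exact: abs_Re_le.
Qed.

Lemma integrable_Im h : integrableC h ->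
  mu.-integrable setT (EFin \o (fun x => Im (h x))).
Proof.
move=> [[rh jh] ih]; apply: le_integrable ih => //; first exact/measurable_EFinP.
move=> x _ /=; rewrite lee_fin [leRHS]ger0_norm ?normc_ge0//; exact: abs_Im_le.
Qed.

Lemma integrableCD f g : integrableC f -> integrableC g ->
  integrableC (fun x => f x + g x).
Proof.
move=> [mf hf] [mg hg].
apply: (@integrableC_dom _ (fun x => normc (f x) + normc (g x))).
- exact: measurableCD.
- have := integrableD (@measurableT _ _) hf hg.
  by apply: eq_integrable.
- by move=> x; exact: normc_triangle.
Qed.

Lemma integrableCZ (c : C) f : integrableC f -> integrableC (fun x => c * f x).
Proof.
move=> [mf hf].
apply: (@integrableC_dom _ (fun x => normc c * normc (f x))).
- by apply: measurableCM => //; exact: measurableC_cst.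
- have := integrableZl (@measurableT _ _) (normc c) hf.
  by apply: eq_integrable.
- by move=> x; rewrite normcM.
Qed.

Lemma integrableCN f : integrableC f -> integrableC (fun x => - f x).
Proof.
move=> hf; have := integrableCZ (-1) hf.
by under eq_fun do rewrite mulN1r.
Qed.

Lemma integralCD f g : integrableC f -> integrableC g ->
  integralC (fun x => f x + g x) = integralC f + integralC g.
Proof.
move=> hf hg; apply: complex_eq; rewrite ?(ReD, ImD)/=.
  under eq_Rintegral do rewrite ReD.
  by rewrite RintegralD//; exact: integrable_Re.
under eq_Rintegral do rewrite ImD.
by rewrite RintegralD//; exact: integrable_Im.
Qed.

Lemma integrableZR (k : R) (u : R -> R) : mu.-integrable setT (EFin \o u) ->
  mu.-integrable setT (EFin \o (fun x => k * u x)).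
Proof. by move=> iu; have := integrableZl (@measurableT _ _) k iu; apply: eq_integrable. Qed.

Lemma integralCZ (c : C) f : integrableC f ->
  integralC (fun x => c * f x) = c * integralC f.
Proof.
move=> hf; have hr := integrable_Re hf; have hi := integrable_Im hf.
apply: complex_eq; rewrite ?(ReM, ImM)/=.
  under eq_Rintegral do rewrite ReM.
  rewrite RintegralB ?RintegralZl//; exact: integrableZR.
under eq_Rintegral do rewrite ImM.
by rewrite RintegralD ?RintegralZl//; exact: integrableZR.
Qed.

Lemma integralCN f : integrableC f -> integralC (fun x => - f x) = - integralC f.
Proof.
move=> hf; rewrite -mulN1r -integralCZ//.
by congr integralC; apply/funext => x; rewrite mulN1r.
Qed.

Lemma integralC_conj f : integrableC f ->
  integralC (fun x => (f x)^*) = (integralC f)^*.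
Proof.
move=> hf; have hr := integrable_Re hf; have hi := integrable_Im hf.
apply: complex_eq; rewrite ?(Re_conj, Im_conj)/=.
  by under eq_Rintegral do rewrite Re_conj.
under eq_Rintegral do rewrite Im_conj -mulN1r.
by rewrite RintegralZl// mulN1r.
Qed.

Lemma integralC_sum (I : Type) (s : seq I) (F : I -> R -> C) :
  (forall i, integrableC (F i)) ->
  integrableC (fun x => \sum_(i <- s) F i x) /\
  integralC (fun x => \sum_(i <- s) F i x) = \sum_(i <- s) integralC (F i).
Proof.
move=> hF; elim: s => [|i s [ih1 ih2]].
  have i0 : integrableC (fun=> 0 : C).
    apply: (@integrableC_dom _ (fun=> 0)); first exact: measurableC_cst.
      by have := integrable0 mu setT; apply: eq_integrable.
    by move=> x; rewrite normc0.
  rewrite big_nil (_ : (fun x => _) = fun=> 0); last first.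
    by apply/funext => x; rewrite big_nil.
  split=> //; apply: complex_eq => /=.
    by rewrite Rintegral_cst// mul0r.
  by rewrite Rintegral_cst// mul0r.
rewrite big_cons (_ : (fun x => _) = fun x => F i x + \sum_(i <- s) F i x); last first.
  by apply/funext => x; rewrite big_cons.
by split; [exact: integrableCD|rewrite integralCD// ih2].
Qed.

(** A unimodular constant, moved inside the integral, turns its modulus into the integral of a real
    part, where monotonicity applies. *)
Lemma normc_integralC f : integrableC f ->
  normc (integralC f) <= Rintegral mu setT (fun x => normc (f x)).
Proof.
move=> hf; have [w w1 wE] := phase_exists (integralC f).
have hwf := integrableCZ w hf.
have -> : normc (integralC f) = Re (integralC (fun x => w * f x)).
  by rewrite integralCZ// wE.
apply: le_Rintegral => //; [exact: integrable_Re|by case: hf|].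
move=> x _; rewrite (le_trans (ler_norm _))// (le_trans (abs_Re_le _))//.
by rewrite normcM w1 mul1r.
Qed.

End complex_integral.

Section almost_everywhere_lebesgue.
Variable R : realType.
Notation mu := (@lebesgue_measure R).
Implicit Types P Q : R -> Prop.

Lemma ae_impl P Q : (forall x, P x -> Q x) ->
  {ae mu, forall x, P x} -> {ae mu, forall x, Q x}.
Proof. by apply: filterS; exact: (ae_filter_ringOfSetsType mu). Qed.

Lemma ae_and P Q : {ae mu, forall x, P x} -> {ae mu, forall x, Q x} ->
  {ae mu, forall x, P x /\ Q x}.
Proof.
move=> hP hQ; have := @filterI _ _ (ae_filter_ringOfSetsType mu) _ _ hP hQ.
exact: ae_impl.
Qed.

End almost_everywhere_lebesgue.

(** * The space of square integrable functions *)

Section square_integrable.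
Variable R : realType.
Notation C := R[i].
Notation mu := (@lebesgue_measure R).
Implicit Types (f g h : R -> C) (c : C).

Definition sqn f : \bar R := (\int[mu]_x (normc (f x) ^+ 2)%:E)%E.

(** Real-valued, for ordered field arithmetic. It is 0 where the norm is infinite, whence the [L2]
    hypotheses that follow. *)
Definition nrm f : R := fine (norm2 f).

Lemma sqn_ge0 f : (0 <= sqn f)%E.
Proof. by apply: integral_ge0 => x _; rewrite lee_fin sqr_ge0. Qed.

Lemma norm2_sqn f : norm2 f = sqrte (sqn f).
Proof.
rewrite /normLp unlock poweR12_sqrt; last first.
  by apply: integral_ge0 => x _; exact: poweR_ge0.
congr sqrte; apply: eq_integral => x _.
rewrite /= powR_mulrn ?normr_ge0// ger0_norm ?normc_ge0//.
Qed.

Lemma norm2_ge0 f : (0 <= norm2 f)%E.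
Proof. by rewrite norm2_sqn sqrte_ge0. Qed.

Lemma sqr_norm2 f : (norm2 f ^+ 2 = sqn f)%E.
Proof. by rewrite norm2_sqn sqr_sqrte// sqn_ge0. Qed.

Lemma nrm_ge0 f : 0 <= nrm f.
Proof. by rewrite fine_ge0// norm2_ge0. Qed.

Lemma L2P f : L2 f <-> measurableC f /\ (sqn f < +oo)%E.
Proof.
suff -> : L2 f = (measurableC f /\ (sqn f < +oo)%E) by [].
rewrite /Lp /= norm2_sqn; congr and.
rewrite -!ge0_fin_numE ?sqn_ge0 ?sqrte_ge0//.
by rewrite sqrte_fin_num ?sqn_ge0.
Qed.

Lemma norm2E f : L2 f -> norm2 f = (nrm f)%:E.
Proof. by move=> [_ hf]; rewrite fineK// ge0_fin_numE// norm2_ge0. Qed.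

Lemma sqnE f : L2 f -> sqn f = (nrm f ^+ 2)%:E.
Proof. by move=> hf; rewrite -sqr_norm2 norm2E// EFin_expe. Qed.

Lemma L2_measurable f : L2 f -> measurableC f. Proof. by case. Qed.

Lemma integrable_sqr f : L2 f ->
  mu.-integrable setT (EFin \o (fun x => normc (f x) ^+ 2)).
Proof.
move=> /L2P[mf hf]; apply/integrableP; split.
  by apply/measurable_EFinP; exact: measurable_sqr_normc.
by under eq_integral do rewrite /= ger0_norm ?sqr_ge0//.
Qed.

Lemma L2_dom f (g : R -> R) : measurableC f -> mu.-integrable setT (EFin \o g) ->
  (forall x, normc (f x) ^+ 2 <= g x) -> L2 f.
Proof.
move=> mf ig fg; apply/L2P; split=> //.
have : mu.-integrable setT (EFin \o (fun x => normc (f x) ^+ 2)).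
  apply: le_integrable ig => //.
    by apply/measurable_EFinP; exact: measurable_sqr_normc.
  by move=> x _ /=; rewrite lee_fin ger0_norm ?sqr_ge0// (le_trans (fg x))// ler_norm.
move=> /integrableP[_]; congr (_ < _)%E.
by apply: eq_integral => x _ /=; rewrite ger0_norm ?sqr_ge0.
Qed.

Lemma L20 : L2 (0 : R -> C).
Proof.
apply: (@L2_dom _ (fun=> 0)); first exact: measurableC_cst.
  by have := integrable0 mu setT; apply: eq_integrable.
by move=> x; rewrite normc0 expr0n.
Qed.

Lemma integrable_sqrD f g : L2 f -> L2 g ->
  mu.-integrable setT (EFin \o (fun x => 2 * (normc (f x) ^+ 2 + normc (g x) ^+ 2))).
Proof.
move=> hf hg; apply: integrableZR.
have := integrableD (@measurableT _ _) (integrable_sqr hf) (integrable_sqr hg).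
by apply: eq_integrable.
Qed.

Lemma L2D f g : L2 f -> L2 g -> L2 (f + g).
Proof.
move=> hf hg; apply: (L2_dom _ (integrable_sqrD hf hg)).
  by apply: measurableCD; exact: L2_measurable.
move=> x; apply: (@le_trans _ _ ((normc (f x) + normc (g x)) ^+ 2)).
  by rewrite ler_pXn2r ?nnegrE ?addr_ge0 ?normc_ge0//; exact: normc_triangle.
by have := sqr_ge0 (normc (f x) - normc (g x)); rewrite sqrrB sqrrD; lra.
Qed.

Lemma L2Z c f : L2 f -> L2 (c *: f).
Proof.
move=> hf; apply: (L2_dom _ (integrableZR (normc c ^+ 2) (integrable_sqr hf))).
  by apply: measurableCM; [exact: measurableC_cst|exact: L2_measurable].
by move=> x; rewrite [(c *: f) x]/(c * f x) normcM exprMn.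
Qed.

Lemma L2N f : L2 f -> L2 (- f).
Proof. by move=> hf; rewrite -scaleN1r; exact: L2Z. Qed.

Lemma L2B f g : L2 f -> L2 g -> L2 (f - g).
Proof. by move=> hf hg; apply: L2D => //; exact: L2N. Qed.

Lemma L2_sum (I : Type) (s : seq I) (P : pred I) (F : I -> R -> C) :
  (forall i, P i -> L2 (F i)) -> L2 (\sum_(i <- s | P i) F i).
Proof. by move=> hF; elim/big_ind: _ => //; [exact: L20|exact: L2D]. Qed.

Lemma integrable_inner f g : L2 f -> L2 g ->
  integrableC (fun x => f x * (g x)^*).
Proof.
move=> hf hg; apply: (integrableC_dom _ (integrable_sqrD hf hg)).
  by apply: measurableCM; [|apply: measurableC_conj]; exact: L2_measurable.
move=> x; rewrite normcM normc_conj.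
have := sqr_ge0 (normc (f x) - normc (g x)); rewrite sqrrB.
have := sqr_ge0 (normc (f x)); have := sqr_ge0 (normc (g x)); lra.
Qed.

Lemma innerDl f g h : L2 f -> L2 g -> L2 h ->
  inner (f + g) h = inner f h + inner g h.
Proof.
move=> hf hg hh; rewrite /inner -integralCD; try exact: integrable_inner.
by congr integralC; apply/funext => x; rewrite mulrDl.
Qed.

Lemma innerZl c f g : L2 f -> L2 g -> inner (c *: f) g = c * inner f g.
Proof.
move=> hf hg; rewrite /inner -integralCZ; last exact: integrable_inner.
by congr integralC; apply/funext => x; rewrite mulrA.
Qed.

Lemma inner_conj f g : L2 f -> L2 g -> (inner f g)^* = inner g f.
Proof.
move=> hf hg; rewrite /inner -integralC_conj; last exact: integrable_inner.
by congr integralC; apply/funext => x; rewrite conjM conjCK mulrC.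
Qed.

Lemma innerDr f g h : L2 f -> L2 g -> L2 h ->
  inner f (g + h) = inner f g + inner f h.
Proof.
move=> hf hg hh; rewrite -inner_conj ?innerDl//; last exact: L2D.
by rewrite conjD !inner_conj.
Qed.

Lemma innerZr c f g : L2 f -> L2 g -> inner f (c *: g) = c^* * inner f g.
Proof.
move=> hf hg; rewrite -inner_conj//; last exact: L2Z.
by rewrite innerZl// conjM !inner_conj.
Qed.

Lemma innerNl f g : L2 f -> L2 g -> inner (- f) g = - inner f g.
Proof. by move=> hf hg; rewrite -scaleN1r innerZl// mulN1r. Qed.

Lemma innerNr f g : L2 f -> L2 g -> inner f (- g) = - inner f g.
Proof. by move=> hf hg; rewrite -scaleN1r innerZr// rmorphN rmorph1 mulN1r. Qed.

Lemma innerBl f g h : L2 f -> L2 g -> L2 h ->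
  inner (f - g) h = inner f h - inner g h.
Proof. by move=> hf hg hh; rewrite innerDl ?innerNl//; exact: L2N. Qed.

Lemma innerBr f g h : L2 f -> L2 g -> L2 h ->
  inner f (g - h) = inner f g - inner f h.
Proof. by move=> hf hg hh; rewrite innerDr ?innerNr//; exact: L2N. Qed.

Lemma inner0l f : L2 f -> inner 0 f = 0.
Proof. by move=> hf; rewrite -(scale0r f) innerZl// mul0r. Qed.

Lemma inner_suml (I : Type) (s : seq I) (P : pred I) (F : I -> R -> C) g :
  (forall i, P i -> L2 (F i)) -> L2 g ->
  inner (\sum_(i <- s | P i) F i) g = \sum_(i <- s | P i) inner (F i) g.
Proof.
move=> hF hg; suff [] : L2 (\sum_(i <- s | P i) F i) /\
  inner (\sum_(i <- s | P i) F i) g = \sum_(i <- s | P i) inner (F i) g by [].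
elim/big_ind2 : _ => [|f1 z1 f2 z2 [h1 e1] [h2 e2]|i Pi].
- by split; [exact: L20|exact: inner0l].
- by split; [exact: L2D|rewrite innerDl// e1 e2].
- by split=> //; exact: hF.
Qed.

Lemma inner_sumr (I : Type) (s : seq I) (P : pred I) (F : I -> R -> C) g :
  (forall i, P i -> L2 (F i)) -> L2 g ->
  inner g (\sum_(i <- s | P i) F i) = \sum_(i <- s | P i) inner g (F i).
Proof.
move=> hF hg; rewrite -inner_conj//; last exact: L2_sum.
rewrite inner_suml// rmorph_sum; apply: eq_bigr => i Pi.
by rewrite /= inner_conj//; exact: hF.
Qed.

Lemma inner_self f : L2 f -> inner f f = ((nrm f ^+ 2)%:C)%C.
Proof.
move=> hf; apply: complex_eq; rewrite /inner/=; last first.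
  under eq_Rintegral do rewrite mulc_conj.
  by rewrite Rintegral_cst// mul0r.
under eq_Rintegral do rewrite mulc_conj.
by rewrite /= /Rintegral -/(sqn f) sqnE.
Qed.

Lemma Re_inner_sym f g : L2 f -> L2 g ->
  Re (inner g f) = Re (inner f g).
Proof. by move=> hf hg; rewrite -inner_conj// Re_conj. Qed.

Lemma nrm_sqrD f g : L2 f -> L2 g -> nrm (f + g) ^+ 2 =
  nrm f ^+ 2 + nrm g ^+ 2 + 2 * Re (inner f g).
Proof.
move=> hf hg; have hfg := L2D hf hg.
have := inner_self hfg; rewrite innerDl// !innerDr// !inner_self//.
move=> /(congr1 (@Re R)); rewrite !ReD.
rewrite (Re_real (nrm f ^+ 2)) (Re_real (nrm g ^+ 2)) (Re_real (nrm (f + g) ^+ 2)) => <-.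
rewrite (Re_inner_sym hf hg); ring.
Qed.

Lemma nrmZ c f : L2 f -> nrm (c *: f) = normc c * nrm f.
Proof.
move=> hf; apply/eqP; rewrite -(@eqrXn2 _ 2) ?mulr_ge0 ?nrm_ge0 ?normc_ge0//.
have := inner_self (L2Z c hf); rewrite innerZl ?innerZr//; last exact: L2Z.
rewrite mulrA mulc_conj inner_self// -realcM => /(congr1 (@Re R)).
by rewrite !Re_real exprMn => ->.
Qed.

Lemma nrmN f : L2 f -> nrm (- f) = nrm f.
Proof. by move=> hf; rewrite -scaleN1r nrmZ// normcNE normc1 mul1r. Qed.

Lemma nrmBC f g : L2 f -> L2 g -> nrm (f - g) = nrm (g - f).
Proof. by move=> hf hg; rewrite -nrmN ?opprB//; exact: L2B. Qed.

Lemma nrm0 : nrm 0 = 0.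
Proof. by rewrite -(scale0r (0 : R -> C)) nrmZ ?normc0 ?mul0r//; exact: L20. Qed.

Lemma nrm_sqrB f g : L2 f -> L2 g -> nrm (f - g) ^+ 2 =
  nrm f ^+ 2 + nrm g ^+ 2 - 2 * Re (inner f g).
Proof.
move=> hf hg; rewrite nrm_sqrD//; last exact: L2N.
by rewrite nrmN// innerNr// ReN mulrN.
Qed.

Lemma cauchy_schwarz f g : L2 f -> L2 g -> normc (inner f g) <= nrm f * nrm g.
Proof.
move=> hf hg; have [w w1 wE] := phase_exists (inner f g).
set a := normc (inner f g) in wE *.
have hwf := L2Z w hf.
(* The rotation by [w] makes the inner product the real number [a], so the squared distance is a
   real quadratic in [t]. *)
have key t : 0 <= nrm f ^+ 2 + t ^+ 2 * nrm g ^+ 2 - 2 * (t * a).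
  have := sqr_ge0 (nrm (w *: f - t%:C%C *: g)).
  rewrite nrm_sqrB//; last exact: L2Z.
  rewrite !nrmZ// w1 mul1r normc_real exprMn real_normK ?num_real//.
  by rewrite innerZr// innerZl// wE realc_conj -realcM Re_real.
have a0 : 0 <= a := normc_ge0 _.
have [g0|g0] := eqVneq (nrm g) 0.
  rewrite g0 mulr0 leNgt; apply/negP => a_gt0.
  (* If [g] has norm 0 the quadratic is affine in [t], and this [t] gives it the value -1. *)
  have := key ((nrm f ^+ 2 + 1) / (2 * a)).
  rewrite g0 expr0n mulr0 addr0 (_ : 2 * _ = nrm f ^+ 2 + 1); first lra.
  by field; rewrite gt_eqF.
have G0 : 0 < nrm g by rewrite lt_def g0 nrm_ge0.
(* This [t] makes both squares equal to |f|^2, so that a factor splits off, positive when |f| is. If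
   |f| = 0, the minimizer [a / |g|^2] of the quadratic forces [a = 0]. *)
have := key (nrm f / nrm g); rewrite (_ : _ - _ = 2 * nrm f / nrm g * (nrm f * nrm g - a)); last first.
  by field.
have [f0|f0] := eqVneq (nrm f) 0.
  rewrite f0 mul0r => _.
  have := key (a / nrm g ^+ 2); rewrite f0 expr0n add0r.
  rewrite (_ : _ - _ = - (a / nrm g) ^+ 2); last by field.
  rewrite oppr_ge0 => h.
  have : (a / nrm g) ^+ 2 = 0 by apply/eqP; rewrite eq_le h sqr_ge0.
  move=> /eqP; rewrite sqrf_eq0 mulf_eq0 invr_eq0 (negbTE g0) orbF => /eqP ->.
  by [].
have F0 : 0 < nrm f by rewrite lt_def f0 nrm_ge0.
by rewrite pmulr_rge0 ?subr_ge0// divr_gt0// mulr_gt0.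
Qed.

Lemma nrm_triangle f g : L2 f -> L2 g -> nrm (f + g) <= nrm f + nrm g.
Proof.
move=> hf hg; rewrite -(@ler_pXn2r _ 2) ?nnegrE ?addr_ge0 ?nrm_ge0//.
rewrite nrm_sqrD// sqrrD.
have := le_trans (ler_norm _) (le_trans (abs_Re_le _) (cauchy_schwarz hf hg)).
lra.
Qed.

Lemma nrm_triangleB f g h : L2 f -> L2 g -> L2 h ->
  nrm (f - h) <= nrm (f - g) + nrm (g - h).
Proof.
move=> hf hg hh; have -> : f - h = (f - g) + (g - h) by rewrite addrA subrK.
by apply: nrm_triangle; exact: L2B.
Qed.

Lemma nrm_lipschitz f g : L2 f -> L2 g -> `|nrm f - nrm g| <= nrm (f - g).
Proof.
move=> hf hg; rewrite ler_norml; apply/andP; split.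
  have := nrm_triangleB L20 hf hg; rewrite !sub0r !nrmN// => h.
  have : nrm (0 - g) <= nrm (0 - f) + nrm (f - g) := nrm_triangleB L20 hf hg.
  by rewrite !sub0r !nrmN// => h'; lra.
have : nrm (f - 0) <= nrm (f - g) + nrm (g - 0) := nrm_triangleB hf hg L20.
by rewrite !subr0; lra.
Qed.

Lemma parallelogram f g : L2 f -> L2 g ->
  nrm (f + g) ^+ 2 + nrm (f - g) ^+ 2 = 2 * (nrm f ^+ 2 + nrm g ^+ 2).
Proof. by move=> hf hg; rewrite nrm_sqrD// nrm_sqrB//; ring. Qed.

Lemma sqn_ae f g : measurableC f -> measurableC g ->
  {ae mu, forall x, normc (f x) = normc (g x)} -> sqn f = sqn g.
Proof.
move=> mf mg fg; apply: ge0_ae_eq_integral => //.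
- by apply/measurable_EFinP; exact: measurable_sqr_normc.
- by apply/measurable_EFinP; exact: measurable_sqr_normc.
- by move=> x _; rewrite lee_fin sqr_ge0.
- by move=> x _; rewrite lee_fin sqr_ge0.
- by move: fg; apply: ae_impl => x e _ /=; rewrite e.
Qed.

Lemma L2_ae f g : L2 f -> measurableC g -> {ae mu, forall x, f x = g x} ->
  L2 g /\ nrm (f - g) = 0.
Proof.
move=> hf mg fg; have mf := L2_measurable hf.
have sfg : sqn f = sqn g by apply: sqn_ae => //; move: fg; apply: ae_impl => x ->.
have hg : L2 g by apply/L2P; rewrite -sfg; split=> //; have /L2P[] := hf.
split=> //; have : sqn (f - g) = sqn (0 : R -> C).
  apply: sqn_ae; [exact: measurableCB|exact: measurableC_cst|].
  by move: fg; apply: ae_impl => x fgx; rewrite !fctE fgx; congr normc; exact: subrr.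
rewrite (sqnE (L2B hf hg)) (sqnE L20) nrm0 expr0n/= => -[] /eqP.
by rewrite sqrf_eq0 => /eqP.
Qed.

Lemma nrm_congr f g : L2 f -> L2 g -> nrm (f - g) = 0 -> nrm f = nrm g.
Proof.
move=> hf hg h; have := nrm_lipschitz hf hg; rewrite h normr_le0 subr_eq0.
by move=> /eqP.
Qed.

Lemma inner_congr f g h : L2 f -> L2 g -> L2 h -> nrm (f - g) = 0 ->
  inner f h = inner g h.
Proof.
move=> hf hg hh e; have := cauchy_schwarz (L2B hf hg) hh.
rewrite e mul0r innerBl// => h1.
have : normc (inner f h - inner g h) = 0 by apply/eqP; rewrite eq_le h1 normc_ge0.
by move=> /eq0_normc /eqP; rewrite subr_eq0 => /eqP.
Qed.

End square_integrable.

(** * Completeness of L^2 *)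

Section completeness.
Variable R : realType.
Notation C := R[i].
Notation mu := (@lebesgue_measure R).
Implicit Types (f g h : R -> C).

Lemma fatou_bound (g : nat -> R -> \bar R) (B : \bar R) :
  (forall n, measurable_fun setT (g n)) -> (forall n x, (0 <= g n x)%E) ->
  (forall n, (\int[mu]_x g n x <= B)%E) ->
  (\int[mu]_x limn_einf (g^~ x) <= B)%E.
Proof.
move=> mg g0 gB; apply: (le_trans (fatou _ _ _ _)) => //.
rewrite limn_einf_lim; apply: lime_le; first exact: is_cvg_einfs.
apply: nearW => n; apply: le_trans (gB n).
by apply: ereal_inf_lbound; exists n => /=.
Qed.

Definition cvgC (w : nat -> R -> C) f := forall x,
  (fun n => Re (w n x)) @ \oo --> Re (f x) /\
  (fun n => Im (w n x)) @ \oo --> Im (f x).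

Lemma cvgC_measurable (w : nat -> R -> C) f :
  (forall n, measurableC (w n)) -> cvgC w f -> measurableC f.
Proof.
move=> mw wf; split.
  apply: (@measurable_fun_cvg _ _ _ _ (fun n x => Re (w n x))).
    by move=> n; case: (mw n).
  by move=> x _; case: (wf x).
apply: (@measurable_fun_cvg _ _ _ _ (fun n x => Im (w n x))).
  by move=> n; case: (mw n).
by move=> x _; case: (wf x).
Qed.

Lemma cvgC_sqr_normc (w : nat -> R -> C) f x : cvgC w f ->
  (fun n => normc (w n x) ^+ 2) @ \oo --> normc (f x) ^+ 2.
Proof.
move=> /(_ x)[hr hi]; rewrite normc_sqr.
under eq_fun do rewrite normc_sqr.
by apply: cvgD; rewrite !expr2; under eq_fun do rewrite expr2; exact: cvgM.
Qed.

Lemma fatou_sqn (w : nat -> R -> C) f (B : \bar R) :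
  (forall n, measurableC (w n)) -> cvgC w f ->
  (exists N, forall n, (N <= n)%N -> (sqn (w n) <= B)%E) -> (sqn f <= B)%E.
Proof.
move=> mw wf [N hN].
(* The bound holds only from [N] on, so Fatou is applied to the shifted sequence. *)
have := @fatou_bound (fun n x => (normc (w (n + N)%N x) ^+ 2)%:E) B.
rewrite (_ : (\int[mu]_x limn_einf _ = sqn f)%E).
  apply.
  - by move=> n; apply/measurable_EFinP; exact: measurable_sqr_normc.
  - by move=> n x; rewrite lee_fin sqr_ge0.
  - by move=> n; exact: hN (leq_addl _ _).
apply: eq_integral => x _.
have h : (fun n => (normc (w (n + N)%N x) ^+ 2)%:E) @ \oo --> (normc (f x) ^+ 2)%:E.
  apply: cvg_EFin; first exact: nearW.
  have := @cvgC_sqr_normc _ _ x wf.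
  by rewrite -(cvg_shiftn N).
by rewrite (cvg_limn_einf_sup h).1.
Qed.

Lemma nrm_sum_le (d : nat -> R -> C) (n : nat) : (forall k, L2 (d k)) ->
  nrm (\sum_(k < n) d k) <= \sum_(k < n) nrm (d k).
Proof.
move=> hd; elim: n => [|n ih]; first by rewrite !big_ord0 nrm0.
rewrite !big_ord_recr/= (le_trans (nrm_triangle _ _))//.
  by apply: L2_sum => i _; exact: hd.
by rewrite lerD.
Qed.

Lemma L2_normc f : L2 f -> L2 (fun x => (normc (f x))%:C%C).
Proof.
move=> hf; apply: (L2_dom _ (integrable_sqr hf)).
  by apply: measurableC_real; apply: measurable_normc; exact: L2_measurable.
by move=> x; rewrite normc_real ger0_norm ?normc_ge0.
Qed.

Lemma nrm_normc f : nrm (fun x => (normc (f x))%:C%C) = nrm f.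
Proof.
rewrite /nrm !norm2_sqn; congr (fine (sqrte _)); apply: eq_integral => x _.
by rewrite normc_real ger0_norm ?normc_ge0.
Qed.

Lemma half_sum_le (n : nat) : \sum_(k < n) (2^-1 : R) ^+ k <= 2.
Proof.
suff : \sum_(k < n) (2^-1 : R) ^+ k = 2 - 2 * 2^-1 ^+ n.
  by move=> ->; have := @exprn_ge0 R n 2^-1; rewrite invr_ge0 => /(_ (ler0n _ _)); lra.
elim: n => [|n ih]; first by rewrite big_ord0 expr0; ring.
rewrite big_ord_recr/= ih exprS.
by field.
Qed.

(* The increments of a rapidly Cauchy sequence are almost everywhere absolutely
   summable; the exceptional null set is removed from all terms at once. *)
Lemma fast_cauchy_cvg (v : nat -> R -> C) : (forall n, L2 (v n)) ->
  (forall n, nrm (v n.+1 - v n) <= 2^-1 ^+ n) ->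
  exists w f, (forall n, L2 (w n) /\ nrm (v n - w n) = 0) /\ cvgC w f.
Proof.
move=> hv hd.
pose d n := v n.+1 - v n.
have Ld n : L2 (d n) by exact: L2B.
pose H n x := \sum_(k < n) normc (d k x).
(* The moduli are regarded as complex functions: the triangle inequality of [nrm] then gives
   [nrm (G n) <= 2], that is, an integral of [H n ^+ 2] of at most 4. *)
pose G n : R -> C := \sum_(k < n) (fun x => (normc (d k x))%:C%C).
have GE n x : normc (G n x) = H n x.
  rewrite /G fct_sumE -(raddf_sum (real_complex R)) normc_real ger0_norm//.
  by apply: sumr_ge0 => i _; exact: normc_ge0.
have LG n : L2 (G n) by apply: L2_sum => i _; exact: L2_normc.
have nG n : nrm (G n) <= 2.
  apply: (le_trans (nrm_sum_le n (fun k => L2_normc (Ld k)))).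
  apply: le_trans (half_sum_le n); apply: ler_sum => k _.
  by rewrite nrm_normc; exact: hd.
have H0 n x : 0 <= H n x by apply: sumr_ge0 => i _; exact: normc_ge0.
pose Hs n x := ((H n x) ^+ 2)%:E.
have mHs n : measurable_fun setT (Hs n).
  apply/measurable_EFinP.
  by under eq_fun do rewrite -GE; apply: measurable_sqr_normc; exact: L2_measurable.
have Hmono x : {homo H^~ x : n m / (n <= m)%N >-> n <= m}.
  move=> n m nm; rewrite /H -!(big_mkord xpredT (fun k => normc (d k x))).
  rewrite (big_cat_nat (leq0n n) nm)//= lerDl; apply: sumr_ge0 => i _; exact: normc_ge0.
have Hsmono x : {homo Hs^~ x : n m / (n <= m)%N >-> (n <= m)%E}.
  move=> n m nm; rewrite lee_fin ler_pXn2r ?nnegrE//; exact: Hmono.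
have Hscvg x := ereal_nondecreasing_is_cvgn (Hsmono x).
pose L x := limn (Hs^~ x).
have mL : measurable_fun setT L.
  by apply: (@emeasurable_fun_cvg _ _ _ setT Hs L mHs) => x _; exact: Hscvg.
have L0 x : (0 <= L x)%E.
  by apply: lime_ge => //; apply: nearW => n; rewrite lee_fin sqr_ge0.
have intL : (\int[mu]_x L x <= 4%:E)%E.
  rewrite (_ : (\int[mu]_x L x = \int[mu]_x limn_einf (Hs^~ x))%E); last first.
    by apply: eq_integral => x _; rewrite is_cvg_limn_einfE.
  apply: fatou_bound => // [n x|n]; first by rewrite lee_fin sqr_ge0.
  rewrite (_ : (\int[mu]_x _ = sqn (G n))%E); last first.
    by apply: eq_integral => x _; rewrite GE.
  rewrite sqnE// lee_fin (_ : 4 = 2 ^+ 2)//; last by rewrite -natrX.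
  by rewrite ler_pXn2r ?nnegrE ?nrm_ge0.
pose A := [set x | (L x < +oo)%E].
have mA : measurable A.
  by rewrite -[A]setTI; exact: emeasurable_fun_infty_o.
have aeA : {ae mu, forall x, A x}.
  have iL : mu.-integrable setT L.
    apply/integrableP; split=> //.
    under eq_integral do rewrite gee0_abs//.
    exact: le_lt_trans intL (ltry _).
  have := integrable_ae measurableT iL.
  by apply: ae_impl => x /(_ I); rewrite ge0_fin_numE.
pose w n x := (\1_A x)%:C%C * v n x.
have wA n x : A x -> w n x = v n x.
  by move=> Ax; rewrite /w indicE mem_set// mul1r.
have wNA n x : ~ A x -> w n x = 0.
  by move=> Ax; rewrite /w indicE memNset// mul0r.
have mw n : measurableC (w n).
  apply: measurableCM; last exact: L2_measurable.
  by apply: measurableC_real; exact: measurable_indic.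
have cv x : cvgn (fun n => Re (w n x)) /\ cvgn (fun n => Im (w n x)).
  have [Ax|Ax] := pselect (A x); last first.
    split; [rewrite (_ : (fun n => _) = fun=> 0)|rewrite (_ : (fun n => _) = fun=> 0)].
    - exact: is_cvg_cst.
    - by apply/funext => n; rewrite wNA.
    - exact: is_cvg_cst.
    - by apply/funext => n; rewrite wNA.
  have [M HM] : exists M : R, forall n, H n x <= M.
    have Lf : L x \is a fin_num by rewrite ge0_fin_numE.
    exists (fine (L x) + 1) => n.
    have h : H n x ^+ 2 <= fine (L x).
      rewrite -lee_fin fineK//; apply: lime_ge => //.
      by exists n => // m /= nm; exact: Hsmono.
    by have := sqr_ge0 (H n x - 1); rewrite sqrrB expr1n; have := H0 n x; nra.
  (* A sequence is the telescoping sum of its increments, here dominated by the terms of a series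
     bounded by [M]. *)
  have ab (u : nat -> R) : (forall n, `|u n.+1 - u n| <= normc (d n x)) -> cvgn u.
    move=> hu; suff : cvgn (series (telescope u)).
      rewrite telescopeK => h.
      rewrite (_ : u = (fun n => (u n - u 0%N) + u 0%N)); last first.
        by apply/funext => n; rewrite subrK.
      by apply: is_cvgD => //; exact: is_cvg_cst.
    have E k : [normed series (telescope u)] k =
      \sum_(0 <= i < k) `|telescope u i| by [].
    apply: normed_cvg; apply: nondecreasing_is_cvgn.
      move=> n m nm; rewrite !E (big_cat_nat (leq0n n) nm)//= lerDl.
      by apply: sumr_ge0.
    exists M => _ [n _ <-]; apply: le_trans (HM n).
    rewrite E /H big_mkord; apply: ler_sum => i _; exact: hu.
  split; apply: ab => n; rewrite !wA//.
    by rewrite -ReN -ReD; exact: (abs_Re_le (d n x)).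
  by rewrite -ImN -ImD; exact: (abs_Im_le (d n x)).
exists w, (fun x => (limn (fun n => Re (w n x)) +i* limn (fun n => Im (w n x)))%C).
split=> // n.
apply: L2_ae => //.
by apply: ae_impl aeA => x Ax; rewrite wA.
Qed.

(** A rapidly Cauchy subsequence has a pointwise limit up to null sets; Fatou makes it a limit in
    norm, and the Cauchy condition brings along the whole sequence. *)
Lemma L2_complete (u : nat -> R -> C) : (forall n, L2 (u n)) ->
  (forall e, 0 < e -> exists N, forall m n, (N <= m)%N -> (N <= n)%N ->
     nrm (u m - u n) <= e) ->
  exists2 f, L2 f & forall e, 0 < e -> exists N, forall n, (N <= n)%N ->
     nrm (u n - f) <= e.
Proof.
move=> hu cu.
have e2 k : 0 < (2^-1 : R) ^+ k by rewrite exprn_gt0// invr_gt0.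
have [N hN] := choice (fun k => cu _ (e2 k)).
(* Partial sums of [N] dominate [N] and are in addition nondecreasing. *)
pose M k := (\sum_(i < k.+1) N i)%N.
have NM k : (N k <= M k)%N by rewrite /M big_ord_recr/= leq_addl.
have MS k : (M k <= M k.+1)%N by rewrite /M [leqRHS]big_ord_recr/= leq_addr.
have Mmono : {homo M : n m / (n <= m)%N}.
  by apply: homo_leq => // ? ? ?; exact: leq_trans.
have [||w [f [hw wf]]] := @fast_cauchy_cvg (fun k => u (M k)).
- by move=> n.
- by move=> n; apply: hN => //; exact: leq_trans (MS n).
have Lw n : L2 (w n) by case: (hw n).
(* Fatou for [w n - w k] as [n] grows, with [k] fixed: the Cauchy estimate passes to the pointwise
   limit. *)
have bnd k : (sqn (f - w k)%R <= ((2^-1 ^+ k) ^+ 2)%:E)%E.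
  apply: (@fatou_sqn (fun n => w n - w k)).
  - by move=> n; exact: measurableCB (L2_measurable _) (L2_measurable _).
  - move=> x; have [hr hi] := wf x.
    have eR (a b : C) : Re (a - b) = Re a - Re b by rewrite ReD ReN.
    have eI (a b : C) : Im (a - b) = Im a - Im b by rewrite ImD ImN.
    rewrite !fctE eR eI; split.
      under eq_fun do rewrite fctE eR.
      by apply: cvgB => //; exact: cvg_cst.
    under eq_fun do rewrite fctE eI.
    by apply: cvgB => //; exact: cvg_cst.
  - exists k => n kn; rewrite sqnE; last exact: L2B.
    rewrite lee_fin ler_pXn2r ?nnegrE ?nrm_ge0//.
    have [_ h1] := hw k; have [_ h2] := hw n.
    apply: le_trans (nrm_triangleB (Lw n) (hu (M n)) (Lw k)) _.
    rewrite nrmBC// h2 add0r.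
    apply: le_trans (nrm_triangleB (hu (M n)) (hu (M k)) (Lw k)) _.
    rewrite h1 addr0; apply: hN => //.
    by rewrite (leq_trans (NM k))// Mmono.
have mf : measurableC f by apply: cvgC_measurable wf => n; exact: L2_measurable.
have Lfw k : L2 (f - w k).
  apply/L2P; split; first exact: measurableCB mf (L2_measurable _).
  exact: le_lt_trans (bnd k) (ltry _).
have Lf : L2 f by rewrite -(subrK (w 0%N) f); exact: L2D.
have nb k : nrm (f - w k) <= 2^-1 ^+ k.
  have := bnd k; rewrite sqnE// lee_fin ler_pXn2r ?nnegrE ?nrm_ge0//.

exists f => // e e0.
have [k hk] : exists k, 2 * (2^-1 : R) ^+ k <= e.
  have : (fun k => 2 * (2^-1 : R) ^+ k) @ \oo --> (2 * 0 : R).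
    apply: cvgM; first exact: cvg_cst.
    apply: cvg_expr; rewrite ger0_norm ?invr_ge0//; lra.
  rewrite mulr0 => /cvgrPdist_le /(_ e e0)[k _ /(_ k (leqnn k))].
  rewrite sub0r normrN ger0_norm; first by move=> h; exists k.
  by rewrite mulr_ge0// ltW.
exists (M k) => n Mn; apply: le_trans hk.
apply: le_trans (nrm_triangleB (hu n) (hu (M k)) Lf) _.
have h1 : nrm (u n - u (M k)) <= 2^-1 ^+ k.
  by apply: hN => //; exact: leq_trans (NM k) Mn.
have h2 : nrm (u (M k) - f) <= 2^-1 ^+ k.
  apply: le_trans (nrm_triangleB (hu (M k)) (Lw k) Lf) _.
  have [_ ->] := hw k; rewrite add0r nrmBC//.
by rewrite mulr_natl mulr2n; exact: lerD.
Qed.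

End completeness.

(** * Closed spans, Bessel sequences and orthonormal families *)

Section extended_sums.
Variables (R : realType) (T : choiceType) (a : T -> \bar R).
Hypothesis a0 : forall k, (0 <= a k)%E.

Lemma fset_le_esum (A : {fset T}) :
  (\sum_(k <- A) a k <= \esum_(k in [set: T]) a k)%E.
Proof.
apply: esum_ge; exists [set` A]; first by split.
by rewrite fsbig_finite//= set_fsetK.
Qed.

Lemma esum_le_fset (B : \bar R) : (forall A : {fset T}, (\sum_(k <- A) a k <= B)%E) ->
  (\esum_(k in [set: T]) a k <= B)%E.
Proof.
move=> h; apply: ge_ereal_sup => _ [X [fX _] <-].
by rewrite fsbig_finite//; exact: h.
Qed.

End extended_sums.

Section hilbert.
Variable R : realType.
Notation C := R[i].
Notation mu := (@lebesgue_measure R).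
Implicit Types (f g h s : R -> C) (F : int -> R -> C) (c d : int -> C) (A B : {fset int}).

Definition comb F c A : R -> C := \sum_(k <- A) c k *: F k.

Lemma partial_sumE F c A : partial_sum (fun k x => c k * F k x) A = comb F c A.
Proof. by rewrite /partial_sum /comb [RHS]big_seq_fsetE. Qed.

Lemma combE F c A x : comb F c A x = \sum_(k <- A) c k * F k x.
Proof. by rewrite /comb fct_sumE. Qed.

(** Padding with zero coefficients brings two combinations to a common index set. *)
Lemma comb_extend F c A B : (A `<=` B)%fset ->
  comb F c A = comb F (fun k => if k \in A then c k else 0) B.
Proof.
move=> AB; rewrite /comb -(big_fset_incl _ AB)/=; last first.
  by move=> k _ /negbTE ->; rewrite scale0r.
by rewrite big_seq [RHS]big_seq; apply: eq_bigr => k ->.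
Qed.

Lemma combD F c d A : comb F (fun k => c k + d k) A = comb F c A + comb F d A.
Proof. by rewrite /comb -big_split/=; apply: eq_bigr => k _; rewrite scalerDl. Qed.

Lemma combZ F c (z : C) A : comb F (fun k => z * c k) A = z *: comb F c A.
Proof. by rewrite /comb scaler_sumr; apply: eq_bigr => k _; rewrite scalerA. Qed.

Lemma comb_subset F c A B : (A `<=` B)%fset ->
  comb F c B = comb F c A + comb F c (B `\` A)%fset.
Proof.
move=> AB; rewrite /comb (big_fsetID _ (mem A))/=; congr (_ + _).
  apply: eq_fbigl => k; rewrite !inE/= andbC.
  by case: (boolP (k \in A)) => //= kA; rewrite (fsubsetP AB).
by apply: eq_fbigl => k; rewrite !inE/= andbC.
Qed.

Lemma energy_subset c A B : (A `<=` B)%fset ->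
  \sum_(k <- B) normc (c k) ^+ 2 =
  \sum_(k <- A) normc (c k) ^+ 2 + \sum_(k <- (B `\` A)%fset) normc (c k) ^+ 2.
Proof.
move=> AB; rewrite (big_fsetID _ (mem A))/=; congr (_ + _).
  apply: eq_fbigl => k; rewrite !inE/= andbC.
  by case: (boolP (k \in A)) => //= kA; rewrite (fsubsetP AB).
by apply: eq_fbigl => k; rewrite !inE/= andbC.
Qed.

Lemma lspanP F f : lspan F f <-> exists c A, f = comb F c A.
Proof.
split=> [[A [c ->]]|[c [A ->]]]; first by exists c, A; rewrite partial_sumE.
by exists A, c; rewrite partial_sumE.
Qed.

Section span.
Variable F : int -> R -> C.
Hypothesis hF : forall k, L2 (F k).

Lemma L2_comb c A : L2 (comb F c A).
Proof. by apply: L2_sum => k _; exact: L2Z. Qed.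

Lemma lspan_L2 f : lspan F f -> L2 f.
Proof. by move=> /lspanP[c [A ->]]; exact: L2_comb. Qed.

Lemma lspan0 : lspan F 0.
Proof. by apply/lspanP; exists (fun=> 0), fset0; rewrite /comb big_seq_fset0. Qed.

Lemma lspanD f g : lspan F f -> lspan F g -> lspan F (f + g).
Proof.
move=> /lspanP[c [A ->]] /lspanP[d [B ->]].
rewrite (comb_extend F c (fsubsetUl A B)) (comb_extend F d (fsubsetUr A B)).
by rewrite -combD; apply/lspanP; do 2 eexists.
Qed.

Lemma lspanZ (z : C) f : lspan F f -> lspan F (z *: f).
Proof. by move=> /lspanP[c [A ->]]; rewrite -combZ; apply/lspanP; do 2 eexists. Qed.

Lemma lspan_mem k : lspan F (F k).
Proof.
by apply/lspanP; exists (fun=> 1), [fset k]%fset; rewrite /comb big_seq_fset1 scale1r.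
Qed.

Notation W := (closed_span F).

Lemma closed_spanP f : W f <-> L2 f /\
  forall e, 0 < e -> exists2 g, lspan F g & nrm (f - g) < e.
Proof.
split=> -[hf h]; split=> // e /h[g gF fg]; exists g => //.
  by move: fg; rewrite norm2E ?lte_fin//; apply: L2B => //; exact: lspan_L2.
by rewrite norm2E ?lte_fin//; apply: L2B => //; exact: lspan_L2.
Qed.

Lemma closed_span_L2 f : W f -> L2 f. Proof. by case. Qed.

Lemma lspan_sub f : lspan F f -> W f.
Proof.
move=> Ff; apply/closed_spanP; split; first exact: lspan_L2.
by move=> e e0; exists f => //; rewrite subrr nrm0.
Qed.

Lemma closed_spanD f g : W f -> W g -> W (f + g).
Proof.
move=> /closed_spanP[Lf hf] /closed_spanP[Lg hg].
apply/closed_spanP; split; first exact: L2D.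
move=> e e0; have e20 : 0 < e / 2 by rewrite divr_gt0.
have [f' Ff' ff'] := hf _ e20; have [g' Fg' gg'] := hg _ e20.
have Lf' := lspan_L2 Ff'; have Lg' := lspan_L2 Fg'.
exists (f' + g'); first exact: lspanD.
rewrite opprD addrACA (le_lt_trans (nrm_triangle _ _)) //; try exact: L2B.
by rewrite [ltRHS]splitr ltrD.
Qed.

Lemma closed_spanZ (z : C) f : W f -> W (z *: f).
Proof.
move=> /closed_spanP[Lf hf]; apply/closed_spanP; split; first exact: L2Z.
(* The [+ 1] avoids a division by zero; the same device recurs in later estimates. *)
move=> e e0; have z0 : 0 < normc z + 1 by have := normc_ge0 z; lra.
have [f' Ff' ff'] := hf _ (divr_gt0 e0 z0).
have Lf' := lspan_L2 Ff'.
exists (z *: f'); first exact: lspanZ.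
rewrite -scalerBr nrmZ; last exact: L2B.
move: ff'; rewrite ltr_pdivlMr//.
have := nrm_ge0 (f - f'); have := normc_ge0 z; nra.
Qed.

Lemma closed_spanB f g : W f -> W g -> W (f - g).
Proof. by move=> Wf Wg; rewrite -scaleN1r; apply: closed_spanD => //; exact: closed_spanZ. Qed.

Lemma closed_span_closed f : L2 f ->
  (forall e, 0 < e -> exists2 g, W g & nrm (f - g) <= e) -> W f.
Proof.
move=> Lf h; apply/closed_spanP; split=> // e e0.
have e20 : 0 < e / 2 by rewrite divr_gt0.
have [g /closed_spanP[Lg hg] fg] := h _ e20.
have [g' Fg' gg'] := hg _ e20.
exists g' => //.
apply: le_lt_trans (nrm_triangleB Lf Lg (lspan_L2 Fg')) _.
by rewrite [ltRHS]splitr ler_ltD.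
Qed.

Lemma closed_span_inner0 f : L2 f -> (forall k, inner f (F k) = 0) ->
  forall g, W g -> inner f g = 0.
Proof.
move=> Lf f0 g /closed_spanP[Lg hg]; apply/eqP/contraT => /eqP n0.
have n1 : 0 < normc (inner f g).
  by rewrite lt_def normc_ge0 andbT; apply/eqP => /eq0_normc.
have f1 : 0 < nrm f + 1 by have := nrm_ge0 f; lra.
have [g' /lspanP[c [A g'E]] gg'] := hg _ (divr_gt0 n1 f1).
have Lg' : L2 g' by rewrite g'E; exact: L2_comb.
have g'0 : inner f g' = 0.
  rewrite g'E inner_sumr//; last by move=> k _; exact: L2Z.
  by rewrite big1// => k _; rewrite innerZr// f0 mulr0.
have := cauchy_schwarz Lf (L2B Lg Lg').
rewrite innerBr// g'0 subr0.
move: gg'; rewrite ltr_pdivlMr//.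
have := nrm_ge0 (g - g'); have := nrm_ge0 f; nra.
Qed.

Lemma minimal_orthogonal (f g h : R -> C) : L2 f -> L2 g -> L2 h ->
  (forall z : C, nrm (f - g) <= nrm (f - g - z *: h)) -> inner (f - g) h = 0.
Proof.
move=> Lf Lg Lh hmin.
have Lfg := L2B Lf Lg.
have [w w1 wE] := phase_exists (inner (f - g) h).
set a := normc _ in wE.
have key t : 0 <= t ^+ 2 * nrm h ^+ 2 - 2 * (t * a).
  have := hmin (w^* * t%:C%C); have Lwh := L2Z (w^* * t%:C%C) Lh.
  rewrite -(@ler_pXn2r _ 2) ?nnegrE ?nrm_ge0// (nrm_sqrB Lfg Lwh).
  rewrite nrmZ// (innerZr _ Lfg Lh) normcM normc_conj w1 mul1r normc_real.
  rewrite conjM conjCK realc_conj -mulrA mulrCA wE -realcM.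
  rewrite exprMn real_normK ?num_real//= /a; lra.
have a0 : 0 <= a := normc_ge0 _.
apply: eq0_normc; rewrite -/a; apply/eqP; rewrite eq_le a0 andbT leNgt.
apply/negP => a_gt0.
have G1 : 0 < nrm h ^+ 2 + 1 by have := sqr_ge0 (nrm h); lra.
(* Close to the minimizer [a / |h|^2] of the quadratic, but defined also when [h] has norm 0; the
   value is negative as soon as [a] is positive. *)
have := key (a / (nrm h ^+ 2 + 1)).
rewrite (_ : _ - _ = - (a ^+ 2 * (nrm h ^+ 2 + 2) / (nrm h ^+ 2 + 1) ^+ 2)); last first.
  by field; rewrite gt_eqF.
rewrite oppr_ge0 leNgt => /negP; apply.
rewrite divr_gt0// ?exprn_gt0// mulr_gt0 ?exprn_gt0//; lra.
Qed.

(* A minimizing sequence is Cauchy by the parallelogram identity. *)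
Lemma proj_exists f : L2 f ->
  exists g, W g /\ forall h, W h -> inner (f - g) h = 0.
Proof.
move=> Lf.
(* The infimum is taken over the span, not its closure: the limit of a minimizing sequence lies in
   the closure anyway. *)
pose D := [set nrm (f - g) | g in lspan F].
have D0 : D !=set0 by exists (nrm (f - 0)), 0 => //; exact: lspan0.
have Dlb : lbound D 0 by move=> _ [g _ <-]; exact: nrm_ge0.
have Dinf : has_inf D by split=> //; exists 0.
pose d := inf D.
have d0 : 0 <= d by apply: lb_le_inf.
have dmin g : lspan F g -> d <= nrm (f - g).
  by move=> Fg; apply: ge_inf; [exists 0|exists g].
have dmin2 g h : lspan F g -> lspan F h -> 2 * d <= nrm ((f - g) + (f - h)).
  move=> Fg Fh; have := dmin (2^-1%:C%C *: (g + h)) (lspanZ _ (lspanD Fg Fh)).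
  have Lg := lspan_L2 Fg; have Lh := lspan_L2 Fh.
  have L := L2D (L2B Lf Lg) (L2B Lf Lh).
  have -> : f - 2^-1%:C%C *: (g + h) = 2^-1%:C%C *: ((f - g) + (f - h)).
    apply/funext => x; rewrite !fctE.
    change (f x - 2^-1%:C%C * (g x + h x) = 2^-1%:C%C * (f x - g x + (f x - h x))).
    by apply: complex_eq; rewrite !(ReD, ReN, ReM, ImD, ImN, ImM)/=; field.
  by rewrite nrmZ// normc_real ger0_norm ?invr_ge0// ler_pdivlMl.
have ex n : exists g, lspan F g /\ nrm (f - g) < d + 2^-1 ^+ n.
  have e0 : 0 < (2^-1 : R) ^+ n by rewrite exprn_gt0// invr_gt0.
  by have [_ [g Fg <-] hg] := inf_adherent e0 Dinf; exists g.
have [u hu] := choice ex.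
have Fu n : lspan F (u n) by case: (hu n).
have Lu n : L2 (u n) by exact: lspan_L2.
have half_small e : 0 < e -> exists N, forall n, (N <= n)%N -> (2^-1 : R) ^+ n < e.
  move=> e0.
  have : (fun k => (2^-1 : R) ^+ k) @ \oo --> (0 : R).
    by apply: cvg_expr; rewrite ger0_norm ?invr_ge0//; lra.
  move=> /cvgrPdist_lt /(_ e e0)[k _ hk]; exists k => n kn.
  have := hk n kn; rewrite sub0r normrN ger0_norm// exprn_ge0// invr_ge0.
have [g Lg ug] : exists2 g, L2 g & forall e, 0 < e -> exists N, forall n, (N <= n)%N ->
     nrm (u n - g) <= e.
  apply: L2_complete => // e e0.
  (* If [f] is within [d + t] of both terms, the parallelogram identity bounds the square of their
     distance by 4 (d + t)^2 - 4 d^2, which is at most 4 t (2 d + 1) because t <= 1. *)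
  pose t := Num.min 1 (e ^+ 2 / (4 * (2 * d + 1))).
  have d1 : 0 < 2 * d + 1 by lra.
  have t0 : 0 < t by rewrite lt_min ltr01 divr_gt0 ?exprn_gt0// mulr_gt0.
  have t1 : t <= 1 by rewrite ge_min lexx.
  have te : 4 * (t * (2 * d + 1)) <= e ^+ 2.
    have : t <= e ^+ 2 / (4 * (2 * d + 1)) by rewrite ge_min lexx orbT.
    rewrite ler_pdivlMr ?mulr_gt0//; lra.
  have [N hN] := half_small t t0; exists N => m n Nm Nn.
  have am : nrm (f - u m) < d + t.
    by have [_ h] := hu m; apply: (lt_trans h); rewrite ltrD2l hN.
  have an : nrm (f - u n) < d + t.
    by have [_ h] := hu n; apply: (lt_trans h); rewrite ltrD2l hN.
  have := parallelogram (L2B Lf (Lu m)) (L2B Lf (Lu n)).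
  have -> : f - u m - (f - u n) = u n - u m.
    by rewrite opprB addrC subrKA.
  rewrite nrmBC//.
  have h1 := dmin2 _ _ (Fu m) (Fu n).
  have h2 : (2 * d) ^+ 2 <= nrm (f - u m + (f - u n)) ^+ 2.
    by rewrite ler_pXn2r ?nnegrE ?nrm_ge0//; lra.
  have h3 : nrm (f - u m) ^+ 2 <= (d + t) ^+ 2.
    by rewrite ler_pXn2r ?nnegrE ?nrm_ge0//; lra.
  have h4 : nrm (f - u n) ^+ 2 <= (d + t) ^+ 2.
    by rewrite ler_pXn2r ?nnegrE ?nrm_ge0//; lra.
  move=> h5; rewrite -(@ler_pXn2r _ 2) ?nnegrE ?nrm_ge0 ?(ltW e0)//.
  apply: (le_trans _ te).
  have h6 : (d + t) ^+ 2 - d ^+ 2 <= t * (2 * d + 1).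
    rewrite (_ : _ - _ = t * (2 * d + t)); last by ring.
    by apply: (ler_wpM2l (ltW t0)); lra.
  lra.
have Wg : W g.
  apply: closed_span_closed => // e /ug[N hN]; exists (u N).
    exact: lspan_sub.
  by rewrite nrmBC//; exact: hN.
have gd : nrm (f - g) <= d.
  apply/ler_addgt0Pr => e e0.
  have e20 : 0 < e / 2 by rewrite divr_gt0.
  have [N1 hN1] := half_small _ e20; have [N2 hN2] := ug _ e20.
  pose n := maxn N1 N2.
  apply: le_trans (nrm_triangleB Lf (Lu n) Lg) _.
  have := hN1 n (leq_maxl _ _); have := hN2 n (leq_maxr _ _).
  by have [_ ] := hu n; lra.
exists g; split=> // h.
apply: closed_span_inner0; first exact: L2B.
move=> k; apply: minimal_orthogonal => // z.
apply: (le_trans gd); apply/ler_addgt0Pr => e e0.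
have [N hN] := ug _ e0.
have L1 := L2Z z (hF k).
(* The competitor is built on [u N], since [g] itself need not lie in the span. *)
have : d <= nrm (f - (u N + z *: F k)).
  by apply: dmin; apply: lspanD => //; apply: lspanZ; exact: lspan_mem.
move=> /le_trans; apply.
have -> : f - (u N + z *: F k) = (f - g - z *: F k) + (g - u N).
  by rewrite opprD [LHS]addrA [RHS]addrAC subrKA.
apply: le_trans (nrm_triangle _ _) _; [by apply: L2B => //; exact: L2B|exact: L2B|].
by rewrite lerD2l nrmBC//; exact: hN.
Qed.

Lemma orthoprojP f : L2 f ->
  W (orthoproj W f) /\ forall h, W h -> inner (f - orthoproj W f) h = 0.
Proof. by move=> /proj_exists; exact: xgetPex. Qed.

Lemma orthoproj_L2 f : L2 f -> L2 (orthoproj W f).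
Proof. by move=> /orthoprojP[/closed_span_L2]. Qed.

Lemma inner_orthoproj f h : L2 f -> W h -> inner (orthoproj W f) h = inner f h.
Proof.
move=> Lf Wh; have [_ /(_ _ Wh)] := orthoprojP Lf.
rewrite innerBl//; [|exact: orthoproj_L2|exact: closed_span_L2].
by move=> /eqP; rewrite subr_eq0 => /eqP.
Qed.

Lemma nrm_orthoproj f : L2 f -> nrm (orthoproj W f) <= nrm f.
Proof.
move=> Lf; have [Wp hp] := orthoprojP Lf; have Lp := orthoproj_L2 Lf.
rewrite -(@ler_pXn2r _ 2) ?nnegrE ?nrm_ge0//.
have := nrm_sqrD (L2B Lf Lp) Lp; rewrite subrK hp//= mulr0 addr0 => ->.
by rewrite lerDr sqr_ge0.
Qed.

Lemma orthoproj_id f : W f -> nrm (f - orthoproj W f) = 0.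
Proof.
move=> Wf; have Lf := closed_span_L2 Wf.
have [Wp hp] := orthoprojP Lf.
have := inner_self (L2B Lf (orthoproj_L2 Lf)).
rewrite hp; last exact: closed_spanB.
by move=> /(congr1 (@Re R))/= /esym /eqP; rewrite sqrf_eq0 => /eqP.
Qed.

End span.

End hilbert.

#[global] Arguments normc : simpl never.
#[global] Arguments inner : simpl never.
#[global] Arguments integralC : simpl never.

(** Finite real sums keep the estimates inside [R]; extended sums appear only where [coeff_energy]
    is concerned. *)
Local Notation bessel_bound F beta := (forall f (A : {fset int}), L2 f ->
  \sum_(k <- A) normc (inner f (F k)) ^+ 2 <= beta * nrm f ^+ 2).

(** * Unconditional sums with square summable coefficients *)

Section square_summable_sums.
Variable R : realType.
Notation C := R[i].
Implicit Types (f g h s : R -> C) (c d : int -> C) (A B : {fset int}).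

Lemma energyE (F : int -> R -> C) f A :
  (\sum_(k <- A) ((normc (inner f (F k))) ^+ 2)%:E)%E =
  (\sum_(k <- A) (normc (inner f (F k))) ^+ 2)%:E.
Proof. by rewrite sumEFin. Qed.

Section family.
Variable F : int -> R -> C.
Hypothesis hF : forall k, L2 (F k).

Lemma has_L2sumP c s : has_L2sum (fun k x => c k * F k x) s <->
  L2 s /\ forall e, 0 < e -> exists A, forall B, (A `<=` B)%fset ->
    nrm (s - comb F c B) <= e.
Proof.
have LS s' B : L2 s' -> L2 (s' - comb F c B).
  by move=> h; apply: L2B => //; exact: L2_comb.
have E s' : L2 s' -> (fun A : {fset int} =>
    norm2 (s' - partial_sum (fun k x => c k * F k x) A)) =
    EFin \o (fun A => nrm (s' - comb F c A)).
  move=> Ls'; apply/funext => A /=; rewrite partial_sumE norm2E//; exact: LS.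
rewrite /has_L2sum; split=> -[Ls h]; split=> //.
  have h1 : (fun A : {fset int} => nrm (s - comb F c A)) @ totally --> (0 : R).
    move: h; rewrite E// => h; exact: (@fine_cvg R _ totally totally_filter _ 0 h).
  move=> e e0; have [A _ hA] :=
    (@cvgrPdist_le _ _ _ totally totally_filter _ _).1 h1 e e0.
  exists A => B /hA /=; rewrite sub0r normrN ger0_norm//; exact: nrm_ge0.
rewrite E//; apply: (@cvg_EFin R _ totally totally_filter); first by exists fset0.
apply/(@cvgrPdist_le _ _ _ totally totally_filter) => e /h[A hA]; exists A => // B /hA.
by rewrite /= sub0r normrN ger0_norm//; exact: nrm_ge0.
Qed.

Lemma has_L2sum_unique c s s' : has_L2sum (fun k x => c k * F k x) s ->
  has_L2sum (fun k x => c k * F k x) s' -> nrm (s - s') = 0.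
Proof.
move=> /has_L2sumP[Ls hs] /has_L2sumP[Ls' hs'].
apply/eqP; rewrite eq_le nrm_ge0 andbT; apply/ler_addgt0Pr => e e0.
have e20 : 0 < e / 2 by rewrite divr_gt0.
have [A hA] := hs _ e20; have [B hB] := hs' _ e20.
have LC := L2_comb hF c (A `|` B)%fset.
rewrite add0r; apply: le_trans (nrm_triangleB Ls LC Ls') _.
rewrite (nrmBC LC Ls') [leRHS]splitr; apply: lerD.
  by apply: hA; exact: fsubsetUl.
by apply: hB; exact: fsubsetUr.
Qed.

Lemma L2sumP c : (exists s, has_L2sum (fun k x => c k * F k x) s) ->
  has_L2sum (fun k x => c k * F k x) (L2sum (fun k x => c k * F k x)).
Proof. exact: xgetPex. Qed.

Lemma has_L2sum_lin (z : C) c d s s' : has_L2sum (fun k x => c k * F k x) s ->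
  has_L2sum (fun k x => d k * F k x) s' ->
  has_L2sum (fun k x => (c k + z * d k) * F k x) (s + z *: s').
Proof.
move=> /has_L2sumP[Ls hs] /has_L2sumP[Ls' hs']; apply/has_L2sumP.
split; first by apply: L2D => //; exact: L2Z.
move=> e e0; have e20 : 0 < e / 2 by rewrite divr_gt0.
have z0 : 0 < normc z + 1 by have := normc_ge0 z; lra.
have [A hA] := hs _ e20; have [B hB] := hs' _ (divr_gt0 e20 z0).
exists (A `|` B)%fset => D; rewrite fsubUset => /andP[AD BD].
have L1 := L2_comb hF c D; have L2' := L2_comb hF d D.
rewrite combD combZ opprD addrACA -scalerBr.
apply: le_trans (nrm_triangle _ _) _; [exact: L2B|by apply: L2Z; exact: L2B|].
rewrite [leRHS]splitr; apply: lerD; first exact: hA.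
rewrite nrmZ; last exact: L2B.
have := hB D BD; rewrite ler_pdivlMr//.
have := nrm_ge0 (s' - comb F d D); have := normc_ge0 z; nra.
Qed.

Section bessel.
Variable beta : R.
Hypothesis beta_gt0 : 0 < beta.
Hypothesis bessel : bessel_bound F beta.

(* [|s|^2 = sum c_k <F_k, s>], and each term is at most
   [beta |c_k|^2 / 2 + |<s, F_k>|^2 / (2 beta)]. *)
Lemma bessel_synthesis c A :
  nrm (comb F c A) ^+ 2 <= beta * \sum_(k <- A) normc (c k) ^+ 2.
Proof.
set s := comb F c A; have Ls : L2 s := L2_comb hF c A.
have h1 : nrm s ^+ 2 <= \sum_(k <- A) normc (c k) * normc (inner s (F k)).
  have -> : nrm s ^+ 2 = Re (inner s s) by rewrite inner_self.
  rewrite {1}/s inner_suml//; last by move=> k _; exact: L2Z.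
  apply: le_trans (le_trans (ler_norm _) (abs_Re_le _)) _.
  apply: le_trans (normc_sum _ _ _) _; apply: ler_sum => k _.
  by rewrite innerZl// normcM -(inner_conj Ls (hF k)) normc_conj.
have h2 : \sum_(k <- A) normc (c k) * normc (inner s (F k)) <=
    beta / 2 * \sum_(k <- A) normc (c k) ^+ 2 +
    (2 * beta)^-1 * \sum_(k <- A) normc (inner s (F k)) ^+ 2.
  rewrite !mulr_sumr -big_split/=; apply: ler_sum => k _.
  set x := normc (c k); set y := normc (inner s (F k)).
  rewrite -subr_ge0 (_ : _ - _ = (2 * beta)^-1 * (beta * x - y) ^+ 2).
    apply: mulr_ge0; last exact: sqr_ge0.
    by rewrite invr_ge0 mulr_ge0// ltW.
  by field; rewrite gt_eqF.
have h3 : (2 * beta)^-1 * \sum_(k <- A) normc (inner s (F k)) ^+ 2 <= nrm s ^+ 2 / 2.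
  rewrite ler_pdivrMl ?mulr_gt0//.
  apply: (le_trans (bessel A Ls)).
  by have -> : 2 * beta * (nrm s ^+ 2 / 2) = beta * nrm s ^+ 2 by field.
lra.
Qed.

Section coefficients.
Variables (c : int -> C) (E : R).
Hypothesis hE : forall A, \sum_(k <- A) normc (c k) ^+ 2 <= E.

(** A finite set whose energy is within [e] of the supremum leaves at most [e] outside. *)
Lemma energy_tail (e : R) : 0 < e -> exists A, forall B, (A `<=` B)%fset ->
  \sum_(k <- (B `\` A)%fset) normc (c k) ^+ 2 <= e.
Proof.
move=> e0.
pose D := range (fun A => \sum_(k <- A) normc (c k) ^+ 2).
have Dsup : has_sup D.
  split; first by exists (\sum_(k <- fset0) normc (c k) ^+ 2), fset0.
  by exists E => _ [A _ <-].
have [_ [A _ <-] hA] := sup_adherent e0 Dsup.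
exists A => B AB.
have : \sum_(k <- B) normc (c k) ^+ 2 <= sup D.
  by apply: ub_le_sup; [case: Dsup|exists B].
rewrite (energy_subset c AB); lra.
Qed.

(** The tail of the energy makes the net of partial sums Cauchy. Completeness is about sequences, so
    sets [A n] with tails at most 1/(n+1) are chosen and compared with each other through their
    unions. *)
Lemma bessel_has_L2sum : exists s, has_L2sum (fun k x => c k * F k x) s.
Proof.
have tail e : 0 < e -> exists A, forall B, (A `<=` B)%fset ->
    nrm (comb F c B - comb F c A) <= e.
  move=> e0.
  have [A hA] := energy_tail (divr_gt0 (exprn_gt0 2 e0) beta_gt0).
  exists A => B AB; rewrite (comb_subset F c AB) addrAC subrr add0r.
  rewrite -(@ler_pXn2r _ 2) ?nnegrE ?nrm_ge0 ?(ltW e0)//.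
  apply: le_trans (bessel_synthesis _ _) _.
  by have := hA B AB; rewrite ler_pdivlMr// mulrC.
have e_gt0 n : 0 < (n.+1%:R^-1 : R) by rewrite invr_gt0 ltr0n.
have [A hA] := choice (fun n => tail _ (e_gt0 n)).
have LC B := L2_comb hF c B.
have small e : 0 < e -> exists N, forall n, (N <= n)%N -> (n.+1%:R^-1 : R) <= e.
  move=> e0; have /cvgrPdist_le /(_ e e0)[N _ hN] := @cvg_harmonic R.
  exists N => n Nn; have := hN n Nn; rewrite /= sub0r normrN ger0_norm//.
have key n m B : (A n `<=` B)%fset -> (A m `<=` B)%fset ->
    nrm (comb F c (A n) - comb F c (A m)) <= n.+1%:R^-1 + m.+1%:R^-1.
  move=> nB mB; apply: le_trans (nrm_triangleB (LC _) (LC B) (LC _)) _.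
  by rewrite nrmBC// lerD// hA.
have [s Ls hs] : exists2 f, L2 f & forall e, 0 < e -> exists N, forall n, (N <= n)%N ->
     nrm (comb F c (A n) - f) <= e.
  apply: L2_complete => // e e0.
  have [N hN] := small _ (divr_gt0 e0 (ltr0Sn R 1)).
  exists N => m n Nm Nn.
  apply: (le_trans (@key m n (A m `|` A n)%fset (fsubsetUl _ _) (fsubsetUr _ _))).
  by rewrite [leRHS]splitr lerD// hN.
exists s; apply/has_L2sumP; split=> // e e0.
have e20 := divr_gt0 e0 (ltr0Sn R 1).
have [N hN] := small _ e20; have [N' hN'] := hs _ e20.
pose n := maxn N N'.
exists (A n) => B nB.
apply: le_trans (nrm_triangleB Ls (LC (A n)) (LC B)) _.
rewrite (nrmBC Ls (LC _)) (nrmBC (LC (A n)) (LC B)) [leRHS]splitr; apply: lerD.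
  by apply: hN'; exact: leq_maxr.
by apply: (le_trans (hA n B nB)); apply: hN; exact: leq_maxl.
Qed.

Lemma has_L2sum_bound s : has_L2sum (fun k x => c k * F k x) s ->
  nrm s ^+ 2 <= beta * E.
Proof.
move=> /has_L2sumP[Ls hs].
have E0 : 0 <= E by apply: le_trans (hE fset0); rewrite big_seq_fset0.
have bE0 : 0 <= beta * E by rewrite mulr_ge0// ltW.
rewrite -[leRHS]sqr_sqrtr// ler_pXn2r ?nnegrE ?nrm_ge0 ?sqrtr_ge0//.
apply/ler_addgt0Pr => e /hs[A hA].
have LC := L2_comb hF c A.
have := hA A (fsubset_refl A); have := nrm_triangleB Ls LC (L20 R).
rewrite !subr0 => h1 h2.
suff : nrm (comb F c A) <= Num.sqrt (beta * E) by lra.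
rewrite -(@ler_pXn2r _ 2) ?nnegrE ?nrm_ge0 ?sqrtr_ge0// sqr_sqrtr//.
apply: le_trans (bessel_synthesis _ _) _.
by rewrite ler_pM2l.
Qed.

End coefficients.
End bessel.

Lemma has_L2sum_inner c s g : L2 g -> has_L2sum (fun k x => c k * F k x) s ->
  forall e, 0 < e -> exists A,
    normc (inner s g - \sum_(k <- A) c k * inner (F k) g) <= e.
Proof.
move=> Lg /has_L2sumP[Ls hs] e e0.
have g0 : 0 < nrm g + 1 by have := nrm_ge0 g; lra.
have [A hA] := hs _ (divr_gt0 e0 g0).
exists A; have LC := L2_comb hF c A.
have := hA A (fsubset_refl A); rewrite ler_pdivlMr// => h.
have := cauchy_schwarz (L2B Ls LC) Lg; rewrite innerBl//.
rewrite {2}/comb inner_suml//; last by move=> k _; exact: L2Z.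
under eq_bigr do rewrite innerZl//.
have := nrm_ge0 (s - comb F c A); have := nrm_ge0 g; nra.
Qed.

Section orthonormal.
Hypothesis on : forall j k, inner (F j) (F k) = (j == k)%:R.

Lemma on_sqr_comb d A : nrm (comb F d A) ^+ 2 = \sum_(k <- A) normc (d k) ^+ 2.
Proof.
have LC := L2_comb hF d A.
have -> : nrm (comb F d A) ^+ 2 = Re (inner (comb F d A) (comb F d A)).
  by rewrite inner_self.
have E k : k \in A -> inner (F k) (comb F d A) = (d k)^*.
  move=> kA; rewrite inner_sumr//; last by move=> j _; exact: L2Z.
  rewrite (big_fsetD1 k)//= innerZr// on eqxx mulr1 big_seq big1 ?addr0// => j.
  by rewrite !inE => /andP[/negbTE jk _]; rewrite innerZr// on eq_sym jk mulr0.
rewrite {1}/comb inner_suml//; last by move=> k _; exact: L2Z.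
rewrite (_ : \sum_(k <- A) _ = \sum_(k <- A) ((normc (d k) ^+ 2)%:C)%C).
  by rewrite -(raddf_sum (real_complex R)).
by rewrite big_seq [RHS]big_seq; apply: eq_bigr => k kA; rewrite innerZl// E// mulc_conj.
Qed.

(** Completing the square shows that the coefficients [inner f (F k)] are the best ones on every
    finite set. Bessel's inequality, the expansion and Parseval's identity are all read off from
    it. *)
Lemma on_approx f d A : L2 f ->
  nrm (f - comb F d A) ^+ 2 = nrm f ^+ 2
    - \sum_(k <- A) normc (inner f (F k)) ^+ 2
    + \sum_(k <- A) normc (inner f (F k) - d k) ^+ 2.
Proof.
move=> Lf; have LC := L2_comb hF d A.
rewrite nrm_sqrB// on_sqr_comb -!addrA; congr (_ + _).
rewrite inner_sumr//; last by move=> k _; exact: L2Z.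
rewrite (big_morph (@Re R) (@ReD R) (erefl _)) mulr_sumr -!sumrN -!big_split.
apply: eq_bigr => k _; rewrite innerZr// !normc_sqr ReM ReD ImD !ReN !ImN Re_conj Im_conj.
rewrite -[LHS]/(_ + _) -[RHS]/(_ + _); ring.
Qed.

(** On any set containing [A], the coefficients of [f] do at least as well as an approximating
    combination over [A] padded with zeros. *)
Lemma on_expansion f : closed_span F f ->
  has_L2sum (fun k x => inner f (F k) * F k x) f.
Proof.
move=> /closed_spanP -/(_ hF)[Lf hf]; apply/has_L2sumP; split=> // e /hf[_ /lspanP[d [A ->]] fe].
exists A => B AB; apply: le_trans (ltW fe).
rewrite (comb_extend F d AB) -(@ler_pXn2r _ 2) ?nnegrE ?nrm_ge0//.
rewrite !on_approx// lerD2l; apply: ler_sum => k _.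
by rewrite subrr normc0 expr0n/= sqr_ge0.
Qed.

Lemma on_bessel f A : L2 f ->
  \sum_(k <- A) normc (inner f (F k)) ^+ 2 <= nrm f ^+ 2.
Proof.
move=> Lf; have := on_approx (fun k => inner f (F k)) A Lf.
rewrite [X in _ = _ + X]big1 ?addr0; last by move=> k _; rewrite subrr normc0 expr0n.
have := sqr_ge0 (nrm (f - comb F (fun k => inner f (F k)) A)); lra.
Qed.

Lemma on_parseval f : closed_span F f -> coeff_energy F f = (nrm f ^+ 2)%:E.
Proof.
move=> Wf; have Lf := closed_span_L2 Wf; apply/eqP; rewrite eq_le; apply/andP; split.
  by apply: esum_le_fset => A; rewrite energyE lee_fin; exact: on_bessel.
apply/lee_addgt0Pr => e e0.
have se : 0 < Num.sqrt e by rewrite sqrtr_gt0.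
have /has_L2sumP[_ /(_ _ se)[A /(_ A (fsubset_refl A))]] := on_expansion Wf.
rewrite -(@ler_pXn2r _ 2) ?nnegrE ?nrm_ge0 ?sqrtr_ge0// on_approx//.
rewrite [X in _ + X <= _]big1 ?addr0; last by move=> k _; rewrite subrr normc0 expr0n.
rewrite sqr_sqrtr ?(ltW e0)// => h.
apply: (@le_trans _ _ (\sum_(k <- A) normc (inner f (F k)) ^+ 2 + e)%:E).
  by rewrite lee_fin; lra.
rewrite EFinD leeD2r// -energyE.
by apply: (@fset_le_esum _ _ (fun k => (normc (inner f (F k)) ^+ 2)%:E)) => k; rewrite lee_fin sqr_ge0.
Qed.

End orthonormal.
End family.
End square_summable_sums.

(** * Trigonometric polynomials *)

Section trigonometric_polynomials.
Variable R : realType.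
Notation C := R[i].

Lemma expiD (a b : R) : expi (a + b) = expi a * expi b.
Proof. by apply: complex_eq; rewrite ?(ReM, ImM)/= ?cosD ?sinD//; ring. Qed.

Lemma expi0 : expi 0 = 1 :> C.
Proof. by rewrite /expi cos0 sin0. Qed.

Lemma normc_expi (a : R) : normc (expi a) = 1.
Proof.
apply/eqP; rewrite -(@eqrXn2 _ 2) ?normc_ge0// normc_sqr/= cos2Dsin2 expr1n//.
Qed.

Lemma conj_expi (a : R) : (expi a)^* = expi (- a).
Proof. by apply: complex_eq; rewrite ?(Re_conj, Im_conj)/= ?cosN ?sinN. Qed.

Definition ex (t : R) : C := expi (2 * pi * t).

Lemma exD (a b : R) : ex (a + b) = ex a * ex b.
Proof. by rewrite /ex mulrDr expiD. Qed.

Lemma ex0 : ex 0 = 1. Proof. by rewrite /ex mulr0 expi0. Qed.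

Lemma normc_ex t : normc (ex t) = 1. Proof. exact: normc_expi. Qed.

Lemma conj_ex t : (ex t)^* = ex (- t).
Proof. by rewrite /ex conj_expi mulrN. Qed.

Lemma exN t : ex (- t) * ex t = 1.
Proof. by rewrite -exD addNr ex0. Qed.

Lemma ex_nat (n : nat) t : ex (n%:R * t) = ex t ^+ n.
Proof.
elim: n => [|n ih]; first by rewrite mul0r ex0.
by rewrite -natr1 mulrDl mul1r exD ih exprSr.
Qed.

Lemma ex1 : ex 1 = 1.
Proof.
rewrite /ex mulr1 /expi (_ : 2 * pi = pi *+ 2); last by rewrite mulr_natl.
by rewrite cos2pi sin2pi.
Qed.

Lemma ex_int (k : int) : ex k%:~R = 1.
Proof.
case: (intP k) => [|n|n]; first by rewrite ex0.
  by rewrite -[_%:~R]mulr1 (ex_nat n.+1) ex1 expr1n.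
have := exN n.+1%:R; rewrite rmorphN/= => h.
rewrite -[LHS]mulr1 -[X in _ * X](_ : ex n.+1%:R = 1) ?exN//.
by rewrite -[n.+1%:R]mulr1 ex_nat ex1 expr1n.
Qed.

(** The real part of [ex t] is 1 - 2 sin^2 (pi t), and the sine is positive between 0 and pi. *)
Lemma ex_eq1 t : 0 < t -> t < 1 -> ex t != 1.
Proof.
move=> t0 t1; apply/eqP => /(congr1 (@Re R)) /=.
have -> : 2 * pi * t = (pi * t) *+ 2 by ring.
rewrite cos_mulr2n cos2sin2 => h.
have : 0 < sin (pi * t).
  by apply: sin_gt0_pi; rewrite mulr_gt0 ?pi_gt0//= gtr_pMr// pi_gt0.
move=> s0; have : 0 < sin (pi * t) ^+ 2 by rewrite exprn_gt0.
by move: h; rewrite mulr2n; lra.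
Qed.

Definition chr (k : int) (u : R) : C := ex (k%:~R * u).

Notation trig := (lspan chr).

Lemma measurable_ex : measurableC (fun t : R => ex t).
Proof.
split; apply: (measurableT_comp (f := _)) => //=.
- by apply: continuous_measurable_fun; exact: continuous_cos.
- by apply: continuous_measurable_fun; exact: continuous_sin.
Qed.

Lemma trig_measurable p : trig p -> measurableC p.
Proof.
move=> /lspanP[c [A ->]].
rewrite (_ : comb chr c A = fun x => \sum_(k <- A) c k * chr k x); last first.
  by apply/funext => x; exact: combE.
apply: measurableC_sum => k; apply: measurableCM; first exact: measurableC_cst.
apply: (@measurableC_comp _ (fun t => ex t) (fun u : R => k%:~R * u)).
  exact: mulrl_measurable.
exact: measurable_ex.
Qed.

Lemma trig_bounded p : trig p -> exists M, forall u, normc (p u) <= M.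
Proof.
move=> /lspanP[c [A ->]]; exists (\sum_(k <- A) normc (c k)) => u.
rewrite combE (le_trans (normc_sum _ _ _))//; apply: ler_sum => k _.
by rewrite normcM normc_ex mulr1.
Qed.

Lemma trig_sum (I : Type) (s : seq I) (G : I -> R -> C) : (forall i, trig (G i)) ->
  trig (\sum_(i <- s) G i).
Proof.
move=> hG; elim: s => [|i s ih]; first by rewrite big_nil; exact: lspan0.
by rewrite big_cons; apply: lspanD.
Qed.

(** * Discrete Fejer interpolation *)

Section fejer.
Variable n : nat.
Notation N := (n.+1%:R : R).

Let D (t : R) : C := \sum_(m < n.+1) ex (m%:R * t).

(** The Fejer kernel, as a squared Dirichlet kernel, centred at the node [j / N]; the factor
    [N ^+ 2] is the sum of the squares over the [N] nodes. *)
Let w (j : nat) (u : R) : R := normc (D (u - j%:R / N)) ^+ 2 / N ^+ 2.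

Let D_sqr t : D t * (D t)^* =
  \sum_(m < n.+1) \sum_(m' < n.+1) ex ((m%:R - m'%:R) * t).
Proof.
rewrite /D rmorph_sum mulr_suml; apply: eq_bigr => m _.
rewrite mulr_sumr; apply: eq_bigr => m' _.
by rewrite -[X in _ * X]/((ex _)^*) conj_ex -exD mulrBl.
Qed.

(** Off the diagonal the terms are the powers of an [N]-th root of unity different from 1, because
    |m - m'| < N, and their geometric sum vanishes. *)
Let sum_roots (m m' : 'I_n.+1) :
  \sum_(j < n.+1) ex ((m%:R - m'%:R) * (- (j%:R / N))) = ((m == m')%:R * N)%:C%C.
Proof.
have N0 : N != 0 by rewrite pnatr_eq0.
have [->|mm] := eqVneq m m'.
  under eq_bigr do rewrite subrr mul0r ex0.
  rewrite sumr_const card_ord mul1r -[RHS]/((real_complex R) N).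
  by rewrite rmorph_nat.
pose z := ex ((m'%:R - m%:R) / N).
rewrite (eq_bigr (fun j : 'I_n.+1 => z ^+ j)); last first.
  move=> j _; rewrite -ex_nat; congr ex.
  by rewrite mulrN -mulNr opprB mulrCA.
have z1 : z != 1.
  rewrite /z; case: (ltngtP m m') => [lt|lt|/val_inj e]; last by rewrite e eqxx in mm.
    apply: ex_eq1.
      by rewrite divr_gt0 ?ltr0n// subr_gt0 ltr_nat.
    rewrite ltr_pdivrMr ?ltr0n// mul1r ltrBlDr.
    rewrite -natrD ltr_nat (leq_trans (ltn_ord m'))// leq_addr//.
  rewrite -(conjCK (ex _)) fmorph_eq1 conj_ex -mulNr opprB.
  apply: ex_eq1.
    by rewrite divr_gt0 ?ltr0n// subr_gt0 ltr_nat.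
  rewrite ltr_pdivrMr ?ltr0n// mul1r ltrBlDr.
  by rewrite -natrD ltr_nat (leq_trans (ltn_ord m))// leq_addr.
have zN : z ^+ n.+1 = 1.
  rewrite /z -ex_nat mulrC divfK// -(ex_int (m'%:Z - m%:Z)); congr ex.
  by rewrite rmorphB.
have /eqP := subrX1 z n.+1; rewrite zN subrr eq_sym mulf_eq0 subr_eq0 (negbTE z1)/=.
by move=> /eqP ->; rewrite mul0r.
Qed.

Let w_sum u : \sum_(j < n.+1) w j u = 1.
Proof.
have N0 : N != 0 by rewrite pnatr_eq0.
apply: (@complexI R); rewrite /w -mulr_suml realcM raddf_sum/=.
rewrite (eq_bigr (fun j : 'I_n.+1 => \sum_(m < n.+1) \sum_(m' < n.+1)
  ex ((m%:R - m'%:R) * u) * ex ((m%:R - m'%:R) * - (j%:R / N)))); last first.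
  move=> j _; rewrite -mulc_conj D_sqr; apply: eq_bigr => m _; apply: eq_bigr => m' _.
  by rewrite -exD mulrDr.
rewrite exchange_big/= (eq_bigr (fun=> N%:C%C)); last first.
  move=> m _; rewrite exchange_big/= (bigD1 m)//= -mulr_sumr sum_roots eqxx mul1r.
  rewrite subrr mul0r ex0 mul1r big1 ?addr0// => m' mm'.
  by rewrite -mulr_sumr sum_roots eq_sym (negbTE mm') mul0r mulr0.
rewrite sumr_const card_ord -(raddfMn (real_complex R)) -realcM.
by congr (real_complex R _); rewrite -[N *+ _]mulr_natr -expr2 mulfV// expf_neq0.
Qed.

Let w_ge0 j u : 0 <= w j u.
Proof. by rewrite /w divr_ge0// sqr_ge0. Qed.

Let chord u v : normc (ex (u - v) - 1) = normc (ex u - ex v).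
Proof.
rewrite -[LHS]mul1r -(normc_ex v) -normcM mulrBr mulr1 -exD; congr (normc (ex _ - _)).
by rewrite addrC subrK.
Qed.

(** Multiplication by [ex t - 1] collapses the geometric sum [D t] to [ex t ^+ N - 1], of modulus at
    most 2; hence the constant 4. *)
Let w_chord j u : w j u * normc (ex u - ex (j%:R / N)) ^+ 2 <= 4 / N ^+ 2.
Proof.
rewrite -chord /w mulrAC -exprMn -normcM.
rewrite ler_pM2r ?invr_gt0 ?exprn_gt0 ?ltr0n//.
set t := u - _.
have -> : D t * (ex t - 1) = ex t ^+ n.+1 - 1.
  by rewrite subrX1 mulrC /D; congr (_ * _); apply: eq_bigr => m _; rewrite ex_nat.
have : normc (ex t ^+ n.+1 - 1) <= 2.
  rewrite (le_trans (normc_triangle _ _))// normcNE normc1 -ex_nat normc_ex//.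
by have := normc_ge0 (ex t ^+ n.+1 - 1); nra.
Qed.

Let w_trig j : trig (fun u => (w j u)%:C%C).
Proof.
have N0 : N != 0 by rewrite pnatr_eq0.
rewrite (_ : (fun u => _) = (N ^- 2)%:C%C *: \sum_(m < n.+1) \sum_(m' < n.+1)
    (ex ((m%:R - m'%:R) * - (j%:R / N)) *: chr (m%:Z - m'%:Z))).
  apply: lspanZ; apply: trig_sum => m; apply: trig_sum => m'.
  by apply: lspanZ; exact: lspan_mem.
apply/funext => u; rewrite /w mulrC realcM -mulc_conj D_sqr.
rewrite [RHS]/(_ * (\sum_(m < n.+1) _) u); congr (_ * _).
rewrite fct_sumE; apply: eq_bigr => m _; rewrite fct_sumE; apply: eq_bigr => m' _.
rewrite mulrDr exD mulrC [RHS]/(_ * chr _ u) /chr; congr (_ * ex (_ * _)).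
by rewrite rmorphB.
Qed.

(* Jackson's discrete Fejer interpolation: the weights [w j u] are nonnegative,
   sum to 1 and are concentrated near [j / N = u]. *)
Lemma jackson (f : R -> R) (L d : R) : 0 < d -> 0 <= L ->
  (forall u v, `|f u - f v| <= L * normc (ex u - ex v)) ->
  exists2 p, trig p & forall u, normc (p u - (f u)%:C%C) <= L * (d + 4 / (N * d)).
Proof.
move=> d0 L0 hf; have N0 : 0 < N by rewrite ltr0n.
exists (\sum_(j < n.+1) (f (j%:R / N))%:C%C *: (fun u => (w j u)%:C%C)).
  by apply: trig_sum => j; apply: lspanZ.
move=> u; rewrite fct_sumE.
have -> : \sum_(j < n.+1) ((f (j%:R / N))%:C%C *: (fun u => (w j u)%:C%C)) u - (f u)%:C%C
    = \sum_(j < n.+1) ((f (j%:R / N) - f u) * w j u)%:C%C.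
  have -> : (f u)%:C%C = \sum_(j < n.+1) ((f u * w j u)%:C)%C :> C.
    by rewrite -[f u in LHS]mulr1 -(w_sum u) mulr_sumr (raddf_sum (real_complex R)).
  rewrite -sumrB; apply: eq_bigr => j _.
  rewrite -[X in X - _]/((f (j%:R / N))%:C%C * (w j u)%:C%C).
  by rewrite -realcM -realcN -realcD mulrBl.
apply: le_trans (normc_sum _ _ _) _.
apply: (@le_trans _ _ (\sum_(j < n.+1) L * (d * w j u + 4 / (N ^+ 2 * d)))); last first.
  rewrite -mulr_sumr big_split/= -mulr_sumr w_sum mulr1 sumr_const card_ord.
  rewrite -[_ *+ n.+1]mulr_natr (_ : _ / _ * N = 4 / (N * d))//.
  move: (n.+1%:R : R) N0 => M M0.
  by field; rewrite !gt_eqF.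
apply: ler_sum => j _; rewrite normc_real normrM (ger0_norm (w_ge0 _ _)).
have h1 := hf (j%:R / N) u; rewrite normcBC in h1.
set r := normc _ in h1; have r0 : 0 <= r := normc_ge0 _.
have h2 := w_chord j u; rewrite -/r in h2.
have w0 := w_ge0 j u.
apply: (@le_trans _ _ (L * (w j u * r))).
  by apply: (le_trans (ler_wpM2r w0 h1)); rewrite -mulrA [r * _]mulrC.
rewrite ler_wpM2l//.
have e0 : 0 <= 4 / (N ^+ 2 * d) by rewrite divr_ge0// mulr_ge0 ?exprn_ge0 ?ltW.
(* Near nodes contribute at most [d * w]. For far ones r > d, so w r <= w r^2 / d, which the chord
   estimate bounds by 4 / (N^2 d). *)
have [rd|dr] := leP r d; first by rewrite ler_wpDr// mulrC ler_wpM2r.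
apply: (@le_trans _ _ (4 / (N ^+ 2 * d))); last by rewrite lerDr mulr_ge0// ltW.
have -> : 4 / (N ^+ 2 * d) = 4 / N ^+ 2 / d by rewrite invfM mulrA.
rewrite ler_pdivlMr//; apply: le_trans h2.
rewrite [r ^+ 2]expr2 mulrA; apply: ler_wpM2l; first by rewrite mulr_ge0.
exact: ltW.
Qed.

End fejer.

(** The Lipschitz condition in the chord [normc (ex u - ex v)] expresses continuity and
    1-periodicity together. *)
Lemma trig_dense (f : R -> R) (L : R) : 0 <= L ->
  (forall u v, `|f u - f v| <= L * normc (ex u - ex v)) ->
  forall e, 0 < e -> exists2 p, trig p & forall u, normc (p u - (f u)%:C%C) <= e.
Proof.
move=> L0 hf e e0.
have L1 : 0 < L + 1 by lra.
(* With [n] so large that 4 / (N d) <= d, the interpolation error is at most 2 L d, below [e]. *)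
pose d := e / (2 * (L + 1)).
have d0 : 0 < d by rewrite divr_gt0// mulr_gt0.
have [n hn] : exists n : nat, 4 / (n.+1%:R * d) <= d.
  have x0 : 0 <= 4 / (d * d) by rewrite divr_ge0// mulr_ge0// ltW.
  set t := 4 / (d * d) in x0; exists (Num.truncn t).
  have t0 : 0 < (Num.truncn t).+1%:R * d :> R by rewrite mulr_gt0 ?ltr0n.
  have ht : 4 / (d * d) < (Num.truncn t).+1%:R := truncnS_gt _.
  have dd0 : 0 < d * d by rewrite mulr_gt0.
  move: ht; rewrite (ltr_pdivrMr _ _ dd0) (ler_pdivrMr _ _ t0) => /ltW.
  by rewrite [d * (_%:R * _)]mulrCA.
have [p tp hp] := jackson n d0 L0 hf.
exists p => // u; apply: (le_trans (hp u)).
have -> : e = 2 * d * (L + 1) by rewrite /d; field; rewrite gt_eqF.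
apply: (@le_trans _ _ (L * (d + d))); first by rewrite ler_wpM2l// lerD2l.
by move: (d) d0 => d' d0'; nra.
Qed.

End trigonometric_polynomials.

Notation trig := (lspan (@chr _)).

(** * Positivity tested on squared moduli of trigonometric polynomials *)

Section positivity_test.
Variable R : realType.
Notation C := R[i].
Notation mu := (@lebesgue_measure R).

Lemma integrable_bounded_mul (u h : R -> R) (M : R) : measurable_fun setT u ->
  (forall x, `|u x| <= M) -> mu.-integrable setT (EFin \o h) ->
  mu.-integrable setT (EFin \o (fun x => u x * h x)).
Proof.
move=> mu_ hu ih; have ia := integrable_norm ih.
have := integrableZR M ia; apply: le_integrable => //.
  apply/measurable_EFinP; apply: measurable_funM => //.
  by have /integrableP[/measurable_EFinP] := ih.
move=> x _ /=; rewrite lee_fin normrM [leRHS]normrM normr_id ler_wpM2r//.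
by rewrite (le_trans (hu x))// ler_norm.
Qed.

Lemma min1_lip (a b : R) : `|Num.min 1 a - Num.min 1 b| <= `|a - b|.
Proof.
have h1 := ler_norm (a - b); have h2 := ler_norm (b - a); rewrite distrC in h2.
by rewrite ler_norml; case: (leP 1 a) => ?; case: (leP 1 b) => ?; lra.
Qed.

Lemma max0_lip (a b : R) : `|Num.max 0 a - Num.max 0 b| <= `|a - b|.
Proof.
have h1 := ler_norm (a - b); have h2 := ler_norm (b - a); rewrite distrC in h2.
by rewrite ler_norml; case: (leP 0 a) => ?; case: (leP 0 b) => ?; lra.
Qed.

Section period.
Variables (N c0 : R) (h : R -> R).
Hypothesis N0 : 0 < N.
Hypothesis ih : mu.-integrable setT (EFin \o h).
Hypothesis hI : forall x, ~ (c0 <= x < c0 + N) -> h x = 0.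
Hypothesis test : forall p, trig p ->
  0 <= Rintegral mu setT (fun x => normc (p (x / N)) ^+ 2 * h x).

Let test_lipschitz (f : R -> R) (L : R) : 0 <= L -> measurable_fun setT f ->
  (forall u v, `|f u - f v| <= L * normc (ex u - ex v)) ->
  (forall u, 0 <= f u <= 1) ->
  0 <= Rintegral mu setT (fun x => f (x / N) ^+ 2 * h x).
Proof.
move=> L0 mf lf f01.
have mN : measurable_fun setT (fun x : R => x / N) by exact: mulrr_measurable.
have ia := integrable_norm ih.
set K := Rintegral mu setT (fun x => `|h x|).
have K0 : 0 <= K by apply: Rintegral_ge0.
have i1 : mu.-integrable setT (EFin \o (fun x => f (x / N) ^+ 2 * h x)).
  apply: (@integrable_bounded_mul _ _ 1) => //.
    by apply: measurable_funX; exact: (measurableT_comp mf mN).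
  move=> x; have /andP[a b] := f01 (x / N).
  by rewrite ger0_norm ?sqr_ge0// expr_le1.
apply/ler_addgt0Pr => e e0.
have K1 : 0 < 3 * (K + 1) by rewrite mulr_gt0// ltr_wpDl.
(* Since [d <= 1], the approximant has modulus at most 2, so its squared modulus differs from f^2 by
   at most 3 d; the second bound gives 3 d K <= e. *)
pose d := Num.min 1 (e / (3 * (K + 1))).
have d0 : 0 < d by rewrite lt_min ltr01 divr_gt0.
have d1 : d <= 1 by rewrite ge_min lexx.
have de : 3 * d * K <= e.
  have : d <= e / (3 * (K + 1)) by rewrite ge_min lexx orbT.
  rewrite ler_pdivlMr// => hd; apply: le_trans hd.
  have := ltW d0; nra.
have [p tp hp] := trig_dense L0 lf d0.
apply: le_trans (test tp) _.
have i3 : mu.-integrable setT (EFin \o (fun x => 3 * d * `|h x|)) by exact: integrableZR.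
have -> : Rintegral mu setT (fun x => f (x / N) ^+ 2 * h x) + e =
          Rintegral mu setT (fun x => f (x / N) ^+ 2 * h x) + 3 * d * K + (e - 3 * d * K) by ring.
rewrite ler_wpDr ?subr_ge0// -RintegralZl// -RintegralD//.
have [M hM] := trig_bounded tp.
apply: le_Rintegral => //.
- apply: (@integrable_bounded_mul _ _ (M ^+ 2)) => //.
    apply: (@measurable_sqr_normc _ (fun x => p (x / N))).
    exact: measurableC_comp (trig_measurable tp).
  move=> x; rewrite ger0_norm ?sqr_ge0// ler_pXn2r ?nnegrE ?normc_ge0//.
  exact: le_trans (normc_ge0 (p 0)) (hM 0).
- by have := integrableD (@measurableT _ _) i1 i3; apply: eq_integrable.
move=> x _.
set u := x / N; have /andP[a b] := f01 u.
have q0 := normc_ge0 (p u).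
have k1 : `|normc (p u) - f u| <= d.
  apply: le_trans (hp u); rewrite ler_norml; apply/andP; split.
    have := normc_triangle (p u) ((f u)%:C%C - p u).
    rewrite addrC subrK normc_real (ger0_norm a) normcBC; lra.
  have := normc_triangle (p u - (f u)%:C%C) ((f u)%:C%C).
  rewrite subrK normc_real (ger0_norm a); lra.
have k2 : `|normc (p u) ^+ 2 - f u ^+ 2| <= 3 * d.
  rewrite subr_sqr normrM mulrC; apply: ler_pM => //.
  move: k1; rewrite ler_norml => /andP[k1 k1'].
  by rewrite ger0_norm; lra.
have : (normc (p u) ^+ 2 - f u ^+ 2) * h x <= 3 * d * `|h x|.
  by rewrite (le_trans (ler_norm _))// normrM ler_wpM2r.
by rewrite mulrBl lerBlDl.
Qed.

(** For 0 <= w <= 1/2 this is positive exactly on the arc of half-length [w] about [a] modulo 1.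
    Being a real part of [ex] up to constants, it is Lipschitz in the chord. *)
Let g (a w u : R) := cos (2 * pi * (u - a)) - cos (2 * pi * w).

Let gE a w u : g a w u = Re (ex (u - a)) - cos (2 * pi * w).
Proof. by []. Qed.

Let fM (a w : R) (n : nat) (u : R) := Num.min 1 (n%:R * Num.max 0 (g a w u)).

Let measurable_g a w : measurable_fun setT (g a w).
Proof.
have [m _] := @measurable_ex R.
apply: measurable_funB => //; under eq_fun do rewrite -[cos _]/(Re (ex _)).
apply: (measurableT_comp m); exact: measurable_funB.
Qed.

Let measurable_fM a w n : measurable_fun setT (fM a w n).
Proof.
apply: measurable_minr => //; apply: measurable_funM => //.
by apply: measurable_maxr => //; exact: measurable_g.
Qed.

Let fM_lip a w n u v : `|fM a w n u - fM a w n v| <= n%:R * normc (ex u - ex v).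
Proof.
apply: le_trans (min1_lip _ _) _.
rewrite -mulrBr normrM ger0_norm// ler_wpM2l//.
apply: le_trans (max0_lip _ _) _.
rewrite !gE opprB addrA subrK -ReN -ReD.
apply: le_trans (abs_Re_le _) _.
by rewrite !exD -mulrBl normcM normc_ex mulr1.
Qed.

Let fM01 a w n u : 0 <= fM a w n u <= 1.
Proof.
rewrite /fM ge_min lexx/= andbT le_min ler01 mulr_ge0//.
by rewrite le_max lexx.
Qed.

(* The [fM a w n] increase to the indicator of an arc of the circle. *)
Let test_arc a w :
  0 <= Rintegral mu setT (fun x => if 0 < g a w (x / N) then h x else 0).
Proof.
have /integrableP[/measurable_EFinP mh _] := ih.
have mN : measurable_fun setT (fun x : R => x / N) by exact: mulrr_measurable.
pose F n x := (fM a w n (x / N) ^+ 2 * h x)%:E.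
have cvF x : (fun n => F n x) @ \oo --> (if 0 < g a w (x / N) then h x else 0)%:E.
  apply: cvg_EFin; first exact: nearW.
  case: ifPn => [g0|g0].
    apply: cvg_near_cst; exists (Num.truncn (g a w (x / N))^-1).+1 => // n /= hn.
    rewrite /fM max_r ?ltW// min_l ?expr1n ?mul1r//.
    rewrite -ler_pdivrMr// mul1r ltW// (lt_le_trans (truncnS_gt _))//.
    by rewrite ler_nat.
  apply: cvg_near_cst.
  apply: nearW => n /=; rewrite -leNgt in g0.
  rewrite /fM max_l// mulr0 min_r ?ler01//.
  by rewrite expr0n mul0r.
have mF n : measurable_fun setT (F n).
  apply/measurable_EFinP; apply: measurable_funM => //; apply: measurable_funX.
  exact: (measurableT_comp (measurable_fM a w n) mN).
have [||||_ _ hc] := @dominated_convergence _ _ R mu setT measurableT F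
  (fun x => (if 0 < g a w (x / N) then h x else 0)%:E) (fun x => `|h x|%:E) mF.
- by apply: (@emeasurable_fun_cvg _ _ _ setT F _ mF) => x _; exact: cvF.
- by apply: aeW => x _; exact: cvF.
- exact: integrable_norm.
- apply: aeW => x n _; rewrite lee_fin normrM ler_piMl//.
  have /andP[a0 a1] := fM01 a w n (x / N).
  by rewrite ger0_norm ?sqr_ge0// expr_le1.
rewrite fine_ge0// -(cvg_lim _ hc)//.
apply: lime_ge; first by apply/cvg_ex; eexists; exact: hc.
apply: nearW => n /=.
have iF : mu.-integrable setT (F n).
  apply: (@integrable_bounded_mul _ _ 1) => //.
    by apply: measurable_funX; exact: (measurableT_comp (measurable_fM a w n) mN).
  move=> x; have /andP[a0 a1] := fM01 a w n (x / N).
  by rewrite ger0_norm ?sqr_ge0// expr_le1.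
have := @test_lipschitz (fM a w n) n%:R (ler0n _ _) (measurable_fM a w n)
  (@fM_lip a w n) (@fM01 a w n).
by rewrite /Rintegral -lee_fin fineK//; exact: integrable_fin_num.
Qed.

(** Within the period, such a ball is the preimage under [x / N] of the arc of half-length [r / N]
    about [y / N]; the other preimages lie where [h] vanishes. *)
Let test_ball y r : c0 <= y - r -> y + r <= c0 + N -> 0 < r ->
  0 <= Rintegral mu (ball y r) h.
Proof.
move=> yr1 yr2 r0; rewrite Rintegral_mkcond.
have := test_arc (y / N) (r / N); congr (0 <= Rintegral _ _ _).
apply/funext => x; rewrite patchE.
have rN : 0 < r / N by rewrite divr_gt0.
have rN2 : r / N <= 2^-1 by rewrite ler_pdivrMr//; lra.
have gEx : g (y / N) (r / N) (x / N) = cos (2 * pi * (`|x - y| / N)) - cos (2 * pi * (r / N)).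
  rewrite /g -mulrBl; congr (_ - _); have [xy|xy] := ger0P (x - y) => //.
  by rewrite -cosN; congr cos; ring.
have pi2 : 0 < 2 * pi :> R by rewrite mulr_gt0// pi_gt0.
have in0pi (t : R) : 0 <= t -> t <= 2^-1 -> (2 * pi * t) \in `[0, pi].
  move=> t0 t1; rewrite in_itv/= (mulr_ge0 (ltW pi2) t0)/=.
  by rewrite mulrAC ger_pMl ?pi_gt0//; lra.
have [xI|xI] := pselect (c0 <= x < c0 + N); last first.
  by rewrite (hI xI); case: ifP => // _; case: ifP.
have xyN : `|x - y| <= N - r by rewrite ler_norml; lra.
have -> : (x \in (ball y r : set R)) = (`|x - y| < r).
  by apply/idP/idP; rewrite inE /ball/= distrC.
rewrite gEx subr_gt0.
set t := `|x - y| / N.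
have t0 : 0 <= t by rewrite divr_ge0// ltW.
have -> : (`|x - y| < r) = (t < r / N) by rewrite ltr_pM2r ?invr_gt0.
have t1 : t <= 1 - r / N by rewrite /t ler_pdivrMr// mulrBl divfK ?gt_eqF// mul1r.
congr (if _ then _ else _).
have [tr|rt] := ltP t (r / N).
  rewrite ltr_cos//; [|by apply: in0pi; lra|by apply: in0pi; lra].
  by rewrite ltr_pM2l.
apply/negbTE.
have [th|th] := leP t 2^-1.
  rewrite ltr_cos//; [|by apply: in0pi; lra|by apply: in0pi; lra].
  by rewrite -leNgt ler_pM2l.
(* Beyond half a period the distance on the circle is [1 - t], still at least [r / N] because the
   ball stays inside the period. *)
have -> : cos (2 * pi * t) = cos (2 * pi * (1 - t)).
  rewrite -[RHS]cosN (_ : - _ = 2 * pi * t - pi *+ 2); last by ring.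
  by rewrite -[RHS]cosD2pi subrK.
rewrite ltr_cos//; [|by apply: in0pi; lra|by apply: in0pi; lra].
by rewrite -leNgt ler_pM2l//; lra.
Qed.

Let lochi : locally_integrable setT h.
Proof.
have /integrableP[/measurable_EFinP mh _] := ih.
split=> //; first exact: openT.
move=> K _ cK.
have mK : measurable (K : set (measurableTypeR R)) by exact: compact_measurable.
by have /integrableP[] := integrableS measurableT mK (@subsetT _ K) ih.
Qed.

(** Squared trigonometric polynomials approximate squares of Lipschitz cutoffs, which tend to
    indicators of arcs. Hence [h] has nonnegative integral over every ball in the period, and
    Lebesgue's differentiation theorem localizes this. *)
Lemma positive_of_trig_test : {ae mu, forall x, 0 <= h x}.
Proof.
have ldt := lebesgue_differentiation lochi.
(* No ball about [c0] lies in the half-open period, so this single point is discarded. *)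
have c0ae : {ae mu, forall x, x != c0}.
  exists [set c0]; split => //; first exact: lebesgue_measure_set1.
  by move=> x /= /negP; rewrite negbK => /eqP.
apply: ae_impl (ae_and ldt c0ae) => y [ly yc].
rewrite leNgt; apply/negP => hy.
have [/andP[y1 y2]|yI] := pselect (c0 <= y < c0 + N); last first.
  by rewrite hI// ltxx in hy.
have y1' : c0 < y by rewrite lt_neqAle eq_sym yc.
pose rho := Num.min (y - c0) (c0 + N - y).
have rho0 : 0 < rho by rewrite lt_min !subr_gt0 y1' y2.
(* At a Lebesgue point the mean of |h - h y| over small balls tends to 0, while it is at least the
   mean of h - h y, hence at least - h y. *)
have : ((- h y)%:E <= 0)%E.
  rewrite -(cvg_lim _ ly)//.
  apply: lime_ge; first by apply/cvg_ex; eexists; exact: ly.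
  near=> r.
  have r0 : 0 < r by near: r; exact: nbhs_right_gt.
  have rr : r <= rho by near: r; exact: nbhs_right_le.
  have ry1 : c0 <= y - r.
    have : r <= y - c0 by rewrite (le_trans rr)// ge_min lexx.
    lra.
  have ry2 : y + r <= c0 + N.
    have : r <= c0 + N - y by rewrite (le_trans rr)// ge_min lexx orbT.
    lra.
  have mB : measurable (ball y r : set (measurableTypeR R)) by exact: measurable_ball.
  have muB : mu (ball y r) = (r *+ 2)%:E by rewrite lebesgue_measure_ball// ltW.
  have iB : mu.-integrable (ball y r) (EFin \o h).
    exact: (integrableS measurableT mB (@subsetT _ _) ih).
  have ic : mu.-integrable (ball y r) (EFin \o (fun=> h y)).
    apply/integrableP; split; first exact: measurable_cst.
    rewrite /= integral_cst//.
    rewrite [X in (_ * X)%E](_ : _ = (r *+ 2)%:E); last exact: muB.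
    by rewrite -EFinM ltry.
  rewrite /davg /iavg muB inver gt_eqF ?mulrn_wgt0//.
  rewrite -lee_pdivrMl ?invr_gt0 ?mulrn_wgt0// invrK -EFinM.
  have iBc : mu.-integrable (ball y r) (EFin \o (fun z => h z - h y)).
    by have := integrableB mB iB ic; apply: eq_integrable.
  apply: (@le_trans _ _ (\int[mu]_(z in ball y r) (h z - h y)%:E)%E).
    rewrite integralB_EFin// integral_cst//.
    rewrite [X in (_ * X)%E](_ : _ = (r *+ 2)%:E); last exact: muB.
    have := test_ball ry1 ry2 r0; rewrite /Rintegral -lee_fin fineK.
      move=> t0; rewrite -EFinM -EFinN.
      rewrite -[leLHS]add0e; apply: leeD => //.
      by rewrite lee_fin mulrN [X in - X]mulrC.
    exact: integrable_fin_num.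
  apply: le_integral => //.
    exact: integrable_norm.
  by move=> z _; rewrite lee_fin ler_norm.
by rewrite lee_fin oppr_le0 leNgt hy.
Unshelve. all: by end_near.
Qed.

End period.
End positivity_test.

(** * Exponentials as an orthonormal basis of a period *)

Section circle.
Variable R : realType.
Notation C := R[i].
Notation mu := (@lebesgue_measure R).

Lemma measurable_scaled (a N : R) : measurable_fun setT (fun x : R => a * (x / N)).
Proof.
rewrite (_ : (fun x => _) = (fun x => x * (N^-1 * a))); first exact: mulrr_measurable.
by apply/funext => x; ring.
Qed.

Lemma FTC_everywhere (f F : R -> R) (a b : R) : a < b -> continuous f ->
  (forall x, is_derive x (1 : R) F (f x)) ->
  (\int[mu]_(x in `[a, b]) (f x)%:E = (F b - F a)%:E)%E.
Proof.
move=> ab cf dF.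
have cF x : {for x, continuous F}.
  apply: differentiable_continuous; apply/derivable1_diffP.
  by have [] := dF x.
rewrite (@continuous_FTC2 _ f F)//.
- exact: continuous_subspaceT.
- split.
  + by move=> x _; have [] := dF x.
  + exact/cvg_at_right_filter/cF.
  + exact/cvg_at_left_filter/cF.
- by move=> x _; rewrite derive1E; exact: derive_val.
Qed.

Lemma integral_cos_scaled (w a b : R) : w != 0 -> a < b ->
  (\int[mu]_(x in `[a, b]) (cos (w * x))%:E = ((sin (w * b) - sin (w * a)) / w)%:E)%E.
Proof.
move=> w0 ab.
have dF (x : R) : is_derive x (1 : R) (fun x => w^-1 * sin (w * x)) (cos (w * x)).
  by apply: is_derive_eq; rewrite /GRing.scale/=; field.
have cf : continuous (fun x : R => cos (w * x)).
  move=> x; apply: continuous_comp; last exact: continuous_cos.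
  exact: mulrl_continuous.
by rewrite (FTC_everywhere ab cf dF); congr EFin; field.
Qed.

Lemma integral_sin_scaled (w a b : R) : w != 0 -> a < b ->
  (\int[mu]_(x in `[a, b]) (sin (w * x))%:E = ((cos (w * a) - cos (w * b)) / w)%:E)%E.
Proof.
move=> w0 ab.
have dF (x : R) : is_derive x (1 : R) (fun x => - (w^-1 * cos (w * x))) (sin (w * x)).
  by apply: is_derive_eq; rewrite /GRing.scale/=; field.
have cf : continuous (fun x : R => sin (w * x)).
  move=> x; apply: continuous_comp; last exact: continuous_sin.
  exact: mulrl_continuous.
by rewrite (FTC_everywhere ab cf dF); congr EFin; field.
Qed.

Section period.
Variables (N c0 : R).
Hypothesis N0 : 0 < N.

Let I : set R := `[c0, c0 + N[%classic.

(** The interval is half-open so that its translates by multiples of [N] tile the line. *)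
Definition ind (x : R) : C := (\1_I x)%:C%C.

Let mI : measurable (I : set (measurableTypeR R)).
Proof. exact: measurable_itv. Qed.

Lemma indE x : ind x = if c0 <= x < c0 + N then 1 else 0.
Proof.
rewrite /ind indicE; case: ifP => h.
  by rewrite mem_set// /I /= in_itv/= h.
by rewrite memNset// /I /= in_itv/= h.
Qed.

Lemma measurable_ind : measurableC ind.
Proof. by apply: measurableC_real; exact: measurable_indic. Qed.

Let muI : mu I = N%:E.
Proof. by rewrite lebesgue_measure_itv/= lte_fin ltrDl N0 -EFinD addrAC subrr add0r. Qed.

Lemma integrable_real_ind : mu.-integrable setT (EFin \o (\1_I : R -> R)).
Proof. exact: integrable_indic_itv. Qed.

Let wave (m : int) (x : R) : C := ind x * ex (m%:~R * (x / N)).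

Let measurable_wave m : measurableC (wave m).
Proof.
apply: measurableCM; first exact: measurable_ind.
apply: (@measurableC_comp _ (fun t => ex t) (fun x : R => m%:~R * (x / N))).
  exact: measurable_scaled.
exact: measurable_ex.
Qed.

Let normc_wave m x : normc (wave m x) = \1_I x.
Proof. by rewrite /wave normcM normc_ex mulr1 normc_real ger0_norm. Qed.

Let integrable_wave m : integrableC (wave m).
Proof.
apply: (integrableC_dom (measurable_wave m) integrable_real_ind) => x.
by rewrite normc_wave.
Qed.

Let Rint_ind (u : R -> R) : mu.-integrable setT (EFin \o (fun x => \1_I x * u x)) ->
  Rintegral mu setT (fun x => \1_I x * u x) =
  fine (\int[mu]_(x in `[c0, (c0 + N)%R]) (u x)%:E)%E.
Proof.
move=> iu.
have E : (fun x => \1_I x * u x) = (u \_ I).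
  by apply/funext => x; rewrite patchE indicE; case: ifP => _; rewrite ?mul1r ?mul0r.
rewrite E -Rintegral_mkcond Rintegral_itv_bndo_bndc//.
by move: iu; rewrite E -restrict_EFin -integrable_mkcond.
Qed.

(** For [m != 0] the antiderivative takes the same value at the two ends of the period. *)
Lemma wave_orthogonal m : integralC (wave m) = ((m == 0)%:R * N)%:C%C.
Proof.
have iR := integrable_Re (integrable_wave m).
have iI := integrable_Im (integrable_wave m).
have [m0|m0] := eqVneq m 0.
  have E : wave m = ind.
    by apply/funext => x; rewrite /wave m0 mul0r ex0 mulr1.
  rewrite E mul1r; apply: complex_eq; rewrite /integralC/=.
    rewrite /Rintegral [X in fine X](_ : _ = N%:E)//.
    rewrite -[LHS]/(\int[mu]_x (\1_I x)%:E)%E integral_indic// setIT; exact: muI.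
  by rewrite Rintegral_cst// mul0r.
rewrite mul0r.
pose w := 2 * pi * m%:~R / N : R.
have w0 : w != 0.
  by rewrite !mulf_neq0// ?invr_eq0 ?intr_eq0 ?(gt_eqF N0)// gt_eqF// pi_gt0.
have eE x : ex (m%:~R * (x / N)) = expi (w * x) by congr expi; rewrite /w; ring.
have per : ex (m%:~R * ((c0 + N) / N)) = ex (m%:~R * (c0 / N)).
  rewrite mulrDl divff ?gt_eqF// mulrDr mulr1 exD.
  by rewrite ex_int mulr1.
rewrite !eE in per.
have cN : c0 < c0 + N by rewrite ltrDl.
apply: complex_eq.
  rewrite -[LHS]/(Rintegral mu setT (fun x => Re (wave m x))).
  under eq_Rintegral do rewrite /wave eE ReM/= mul0r subr0.
  rewrite Rint_ind.
    rewrite integral_cos_scaled//=.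
    by have := congr1 (@Im R) per; rewrite /= => ->; rewrite subrr mul0r.
  by apply: eq_integrable iR => // x _;
    rewrite -[LHS]/((Re (wave m x))%:E) /wave eE ReM/= mul0r subr0.
rewrite -[LHS]/(Rintegral mu setT (fun x => Im (wave m x))).
under eq_Rintegral do rewrite /wave eE ImM/= mul0r addr0.
rewrite Rint_ind.
  rewrite integral_sin_scaled//=.
  by have := congr1 (@Re R) per; rewrite /= => ->; rewrite subrr mul0r.
by apply: eq_integrable iI => // x _;
  rewrite -[LHS]/((Im (wave m x))%:E) /wave eE ImM/= mul0r addr0.
Qed.

(** Expanding |p|^2 into exponentials shows that its integral against [h] vanishes. The positivity
    test then applies to the real and imaginary parts of [h] and to their opposites. *)
Lemma fourier_unique (h : R -> C) : integrableC h ->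
  (forall x, ~ (c0 <= x < c0 + N) -> h x = 0) ->
  (forall k : int, integralC (fun x => h x * ex (k%:~R * (x / N))) = 0) ->
  {ae mu, forall x, h x = 0}.
Proof.
move=> ih hI h0.
have ichr k : integrableC (fun x => h x * ex (k%:~R * (x / N))).
  have [mh ah] := ih.
  apply: (@integrableC_dom _ _ (fun x => normc (h x))) => //.
    apply: measurableCM => //.
    apply: (@measurableC_comp _ (fun t => ex t) (fun x : R => k%:~R * (x / N))).
      exact: measurable_scaled.
    exact: measurable_ex.
  by move=> x; rewrite normcM normc_ex mulr1.
have test p : trig p -> integrableC (fun x => (normc (p (x / N)) ^+ 2)%:C%C * h x) /\
    integralC (fun x => (normc (p (x / N)) ^+ 2)%:C%C * h x) = 0.
  move=> /lspanP[c [A ->]].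
  have -> : (fun x => (normc (comb (@chr R) c A (x / N)) ^+ 2)%:C%C * h x) =
    (fun x => \sum_(j <- A) \sum_(k <- A) (c j * (c k)^*) *
       (h x * ex ((j - k)%:~R * (x / N)))).
    apply/funext => x; rewrite -mulc_conj combE rmorph_sum mulr_suml mulr_suml.
    apply: eq_bigr => j _; rewrite mulr_sumr mulr_suml; apply: eq_bigr => k _.
    rewrite -[X in _ * _ * X * _]/((c k * ex (k%:~R * (x / N)))^*) conjM conj_ex /chr.
    by rewrite rmorphB mulrBl exD -mulNr; ring.
  have hk j k := integrableCZ (c j * (c k)^*) (ichr (j - k)).
  have [i1 e1] := integralC_sum A (fun j => (integralC_sum A (hk j)).1).
  split=> //; rewrite e1 big1// => j _.
  have [_ ->] := integralC_sum A (hk j); rewrite big1// => k _.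
  by rewrite integralCZ// h0 mulr0.
have iRe := integrable_Re ih; have iIm := integrable_Im ih.
have iNRe : mu.-integrable setT (EFin \o (fun x => - Re (h x))).
  by have := integrable_Re (integrableCN ih); under eq_fun do rewrite ReN.
have iNIm : mu.-integrable setT (EFin \o (fun x => - Im (h x))).
  by have := integrable_Im (integrableCN ih); under eq_fun do rewrite ImN.
have tRe p : trig p -> Rintegral mu setT (fun x => normc (p (x / N)) ^+ 2 * Re (h x)) = 0.
  move=> /test[i e]; have := congr1 (@Re R) e; rewrite [RHS]/= => <-.
  by apply: eq_Rintegral => x _; rewrite ReM/= mul0r subr0.
have tIm p : trig p -> Rintegral mu setT (fun x => normc (p (x / N)) ^+ 2 * Im (h x)) = 0.
  move=> /test[i e]; have := congr1 (@Im R) e; rewrite [RHS]/= => <-.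
  by apply: eq_Rintegral => x _; rewrite ImM/= mul0r addr0.
have tNRe p : trig p -> 0 <= Rintegral mu setT (fun x => normc (p (x / N)) ^+ 2 * - Re (h x)).
  move=> tp; have [i _] := test _ tp.
  have e : Rintegral mu setT (fun x => normc (p (x / N)) ^+ 2 * - Re (h x)) =
      -1 * Rintegral mu setT (fun x => normc (p (x / N)) ^+ 2 * Re (h x)).
    rewrite -RintegralZl//; first by apply: eq_Rintegral => x _; ring.
    apply: eq_integrable (integrable_Re i) => // x _.
    rewrite -[LHS]/((Re ((normc (p (x / N)) ^+ 2)%:C%C * h x))%:E).
    by rewrite ReM/= mul0r subr0.
  by rewrite e tRe// mulr0.
have tNIm p : trig p -> 0 <= Rintegral mu setT (fun x => normc (p (x / N)) ^+ 2 * - Im (h x)).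
  move=> tp; have [i _] := test _ tp.
  have e : Rintegral mu setT (fun x => normc (p (x / N)) ^+ 2 * - Im (h x)) =
      -1 * Rintegral mu setT (fun x => normc (p (x / N)) ^+ 2 * Im (h x)).
    rewrite -RintegralZl//; first by apply: eq_Rintegral => x _; ring.
    apply: eq_integrable (integrable_Im i) => // x _.
    rewrite -[LHS]/((Im ((normc (p (x / N)) ^+ 2)%:C%C * h x))%:E).
    by rewrite ImM/= mul0r addr0.
  by rewrite e tIm// mulr0.
have p1 : {ae mu, forall x, 0 <= Re (h x)}.
  apply: (positive_of_trig_test N0 iRe) => [x /hI ->//|p /tRe ->//].
have p2 : {ae mu, forall x, 0 <= - Re (h x)}.
  by apply: (positive_of_trig_test N0 iNRe _ tNRe) => x /hI ->; rewrite oppr0.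
have p3 : {ae mu, forall x, 0 <= Im (h x)}.
  apply: (positive_of_trig_test N0 iIm) => [x /hI ->//|p /tIm ->//].
have p4 : {ae mu, forall x, 0 <= - Im (h x)}.
  by apply: (positive_of_trig_test N0 iNIm _ tNIm) => x /hI ->; rewrite oppr0.
apply: ae_impl (ae_and (ae_and p1 p2) (ae_and p3 p4)) => x [[a b] [c d]].
by apply: complex_eq => /=; lra.
Qed.

Definition fbase (k : int) : R -> C :=
  fun x => ((Num.sqrt N)^-1)%:C%C * (ind x * ex (k%:~R * (x / N))).

Let sN0 : 0 < Num.sqrt N. Proof. by rewrite sqrtr_gt0. Qed.

Lemma fbase_L2 k : L2 (fbase k).
Proof.
apply: (L2Z ((Num.sqrt N)^-1)%:C%C (f := wave k)).
apply: (L2_dom (measurable_wave k) integrable_real_ind) => x.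
by rewrite normc_wave indicE; case: (_ \in _); rewrite ?expr1n ?expr0n.
Qed.

Lemma fbase_orthonormal j k : inner (fbase j) (fbase k) = (j == k)%:R.
Proof.
have -> : inner (fbase j) (fbase k) = integralC (fun x => (N^-1)%:C%C * wave (j - k) x).
  congr integralC; apply/funext => x; rewrite /fbase /wave.
  rewrite !conjM conj_ex realc_conj rmorphB mulrBl exD -mulNr.
  have -> : (ind x)^* = ind x by rewrite /ind realc_conj.
  have iE : ind x * ind x = ind x by rewrite indE; case: ifP; rewrite ?mulr1 ?mulr0.
  have -> : (N^-1)%:C%C = ((Num.sqrt N)^-1)%:C%C * ((Num.sqrt N)^-1)%:C%C :> C.
    by rewrite -realcM -invfM -expr2 sqr_sqrtr// ltW.
  rewrite -[in RHS]iE; ring.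
rewrite integralCZ// wave_orthogonal subr_eq0 -realcM.
have -> : N^-1 * ((j == k)%:R * N) = (j == k)%:R by field; rewrite gt_eqF.
by case: (j == k).
Qed.

(** The residual of the projection, cut off to the period, has zero Fourier coefficients and so
    vanishes almost everywhere. *)
Lemma fbase_complete f : L2 f -> (forall x, ~ (c0 <= x < c0 + N) -> f x = 0) ->
  closed_span fbase f.
Proof.
move=> Lf fI; have [Wp hp] := orthoprojP fbase_L2 Lf.
set p := orthoproj _ f in Wp hp; have Lp := closed_span_L2 Wp.
have Lr := L2B Lf Lp.
pose r x := ind x * (f - p) x.
have Lind : L2 ind.
  apply: (L2_dom measurable_ind integrable_real_ind) => x.
  by rewrite normc_real indicE; case: (_ \in _); rewrite ?normr1 ?normr0 ?expr1n ?expr0n.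
have ir : integrableC r.
  have := integrable_inner Lr Lind; congr integrableC.
  by apply/funext => x; rewrite /r mulrC; congr (_ * _); rewrite /ind realc_conj.
have r0 : {ae mu, forall x, r x = 0}.
  apply: fourier_unique => // [x xI|k].
    by rewrite /r indE; case: ifP => // _; rewrite mul0r.
  (* [inner] conjugates its second argument: the coefficient against [ex (k x / N)] is a pairing
     with [fbase (- k)]. *)
  have := hp (fbase (- k)) (lspan_sub fbase_L2 (lspan_mem _ _)).
  move=> /(congr1 (fun z => (Num.sqrt N)%:C%C * z)); rewrite mulr0 => <-.
  rewrite /inner -integralCZ; last exact: (integrable_inner Lr (fbase_L2 (- k))).
  congr integralC; apply/funext => x.
  rewrite /r /fbase !conjM conj_ex realc_conj.
  have -> : (ind x)^* = ind x by rewrite /ind realc_conj.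
  have ss : (Num.sqrt N)%:C%C * ((Num.sqrt N)^-1)%:C%C = 1 :> C.
    by rewrite -realcM mulfV ?gt_eqF.
  rewrite rmorphN mulNr opprK -[LHS]mul1r -ss; ring.
apply: (closed_span_closed fbase_L2 Lf) => e e0; exists p => //.
suff -> : nrm (f - p) = 0 by exact: ltW.
(* Pairing with [f], which vanishes off the period, avoids the values of the chosen representative
   [p] there; |f - p|^2 is then <f - p, f> - <f - p, p> = 0. *)
have h1 : inner (f - p) f = 0.
  have L0 := L20 R.
  rewrite -(inner0l Lf).
  have Lr' : L2 r.
    apply: (L2_dom _ (integrable_sqr Lr)); first by case: ir.
    move=> x; rewrite /r normcM exprMn ler_piMl ?sqr_ge0// indE.
    by case: ifP; rewrite ?normc1 ?normc0 ?expr1n// expr0n.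
  have -> : inner (f - p) f = inner r f.
    congr integralC; apply/funext => x; rewrite /r indE.
    case: ifP => xI; first by rewrite mul1r.
    by rewrite (fI x) ?xI// rmorph0 !mulr0.
  apply: inner_congr => //.
  by have [] := @L2_ae _ r 0 Lr' (L2_measurable L0) r0.
have := inner_self Lr; rewrite innerBr// h1 hp// subr0.
by move=> /(congr1 (@Re R))/= /esym /eqP; rewrite sqrf_eq0 => /eqP.
Qed.

End period.
End circle.

(** * The Fourier transform *)

Section shift.
Variable R : realType.
Notation C := R[i].
Notation mu := (@lebesgue_measure R).

Lemma measurable_shift (a : R) :
  measurable_fun setT (fun x : R => x + a).
Proof. by apply: measurable_funD. Qed.

Lemma lebesgue_measure_shift (a : R) (A : set R) : measurable A ->
  pushforward mu ((fun x => x + a) : R -> measurableTypeR R) A = mu A.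
Proof.
move=> mA; have mf : measurable_fun setT ((fun x => x + a) : R -> measurableTypeR R).
  exact: measurable_shift.
apply/esym/lebesgue_measure_unique => //= _ [[x y]] _ <-.
rewrite /pushforward.
rewrite (_ : _ @^-1` _ = [set` `](x - a), (y - a)]]); last first.
  by apply/seteqP; split => z /=; rewrite !in_itv/= ltrBlDr lerBrDr.
rewrite !lebesgue_measure_itv/= !lte_fin ltrD2r.
by case: ifP => // _; rewrite -!EFinD; congr EFin; ring.
Qed.

Lemma ge0_integral_shift (a : R) (f : R -> \bar R) : measurable_fun setT f ->
  (forall x, (0 <= f x)%E) -> (\int[mu]_x f (x + a)%R = \int[mu]_x f x)%E.
Proof.
move=> mf f0.
have ms : measurable_fun setT ((fun x => x + a) : R -> measurableTypeR R).
  exact: measurable_shift.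
rewrite -[LHS]/(\int[mu]_(x in ((fun x => (x + a)%R) : R -> measurableTypeR R) @^-1` setT)
  (f \o ((fun x => (x + a)%R) : R -> measurableTypeR R)) x)%E.
rewrite -ge0_integral_pushforward//.
by apply: eq_measure_integral => //= A mA AS; exact: lebesgue_measure_shift.
Qed.

Lemma integral_shift (a : R) (f : R -> \bar R) : measurable_fun setT f ->
  (\int[mu]_x f (x + a)%R = \int[mu]_x f x)%E.
Proof.
move=> mf; rewrite integralE [RHS]integralE; congr (_ - _)%E.
  rewrite -(@ge0_integral_shift a (funepos f)).
  - by apply: eq_integral => x _; rewrite !funeposE.
  - exact: measurable_funepos.
  - by move=> x; exact: funepos_ge0.
rewrite -(@ge0_integral_shift a (funeneg f)).
- by apply: eq_integral => x _; rewrite !funenegE.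
- exact: measurable_funeneg.
- by move=> x; exact: funeneg_ge0.
Qed.

Lemma integralC_shift (a : R) (f : R -> C) : measurableC f ->
  integralC (fun x => f (x + a)) = integralC f.
Proof.
move=> [mr mi]; rewrite /integralC /Rintegral; congr (fine _ +i* fine _)%C.
  by apply: (@integral_shift a (EFin \o (fun x => Re (f x)))); exact/measurable_EFinP.
by apply: (@integral_shift a (EFin \o (fun x => Im (f x)))); exact/measurable_EFinP.
Qed.

Lemma sqn_shift (a : R) (f : R -> C) : measurableC f ->
  sqn (fun x => f (x + a)) = sqn f.
Proof.
move=> mf; apply: (@ge0_integral_shift a (fun x => (normc (f x) ^+ 2)%:E)).
  by apply/measurable_EFinP; exact: measurable_sqr_normc.
by move=> x; rewrite lee_fin sqr_ge0.
Qed.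

Lemma measurable_translate k (f : R -> C) : measurableC f -> measurableC (translate k f).
Proof.
move=> mf; apply: (measurableC_comp _ mf).
exact: (measurable_shift (- k%:~R)).
Qed.

Lemma L2_translate k (f : R -> C) : L2 f -> L2 (translate k f).
Proof.
move=> /L2P[mf hf]; apply/L2P; split; first exact: measurable_translate.
by rewrite (sqn_shift (- k%:~R) mf).
Qed.

Lemma nrm_translate k (f : R -> C) : L2 f -> nrm (translate k f) = nrm f.
Proof.
move=> Lf; rewrite /nrm !norm2_sqn; congr (fine (sqrte _)).
exact: (sqn_shift (- k%:~R) (L2_measurable Lf)).
Qed.

Lemma inner_translate k (f g : R -> C) : L2 f -> L2 g ->
  inner (translate k f) g = inner f (translate (- k) g).
Proof.
move=> Lf Lg; rewrite /inner -(@integralC_shift k%:~R).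
  by congr integralC; apply/funext => x; rewrite /translate rmorphN opprK addrK.
apply: measurableCM; first by apply: measurable_translate; exact: L2_measurable.
by apply: measurableC_conj; exact: L2_measurable.
Qed.

End shift.

(** * Sums over the integers and periodization *)

Section periodization.
Variable R : realType.
Notation C := R[i].
Notation mu := (@lebesgue_measure R).

(** The enumeration 0, -1, 1, -2, 2, ...; it turns sums over Z into series, for which termwise
    integration and limits of measurable functions are available. *)
Definition zenum (n : nat) : int := if odd n then Negz n./2 else Posz n./2.

Lemma zenum_bij : set_bij [set: nat] [set: int] zenum.
Proof.
split=> //.
- pose rank (z : int) := match z with Posz m => m.*2 | Negz m => m.*2.+1 end.
  have rankK n : rank (zenum n) = n.
    by rewrite /zenum -[RHS](odd_double_half n); case: (odd n).
  by move=> m n _ _ e; rewrite -(rankK m) -(rankK n) e.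
- move=> [m|m] _; [exists m.*2|exists m.*2.+1] => //; rewrite /zenum/=.
    by rewrite odd_double doubleK.
  by rewrite odd_double/= uphalf_double.
Qed.

Lemma esum_zenum (a : int -> \bar R) : (forall k, (0 <= a k)%E) ->
  (\esum_(k in [set: int]) a k = \sum_(0 <= n <oo) a (zenum n))%E.
Proof.
move=> a0; rewrite (reindex_esum _ _ _ _ zenum_bij) nneseries_esumT// => n; exact: a0.
Qed.

Lemma measurable_esum_int (g : int -> R -> \bar R) :
  (forall k, measurable_fun setT (g k)) -> (forall k x, (0 <= g k x)%E) ->
  measurable_fun setT (fun x => \esum_(k in [set: int]) g k x)%E.
Proof.
move=> mg g0; under eq_fun do rewrite esum_zenum//.
apply: (@emeasurable_fun_cvg _ _ _ setT
  (fun n x => \sum_(0 <= i < n) g (zenum i) x)%E).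
  by move=> n; apply: emeasurable_sum => i; exact: mg.
by move=> x _; apply: is_cvg_nneseries => n _ _; exact: g0.
Qed.

(** The intervals of length [t] starting at [c0 + k t] partition the line, a point being located by
    the floor of (x - c0) / t; each piece is shifted back to the first one. *)
Lemma integral_periodization (c0 t : R) (h : R -> \bar R) : 0 < t ->
  measurable_fun setT h -> (forall x, (0 <= h x)%E) ->
  (\int[mu]_x h x =
   \int[mu]_(x in `[c0, (c0 + t)%R[) \esum_(k in [set: int]) h (x + k%:~R * t)%R)%E.
Proof.
move=> t0 mh h0.
pose J : set R := `[c0, c0 + t[%classic.
pose F n : set R := `[c0 + (zenum n)%:~R * t, c0 + (zenum n)%:~R * t + t[%classic.
have mI : measurable (J : set (measurableTypeR R)) by exact: measurable_itv.
have mF n : measurable (F n : set (measurableTypeR R)) by exact: measurable_itv.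
have FP (k : int) x : (c0 + k%:~R * t <= x < c0 + k%:~R * t + t) = (Num.floor ((x - c0) / t) == k).
  rewrite [RHS]floor_eq.
  rewrite ler_pdivlMr// ltr_pdivrMr// lerBrDl ltrBlDl intrD mulrDl mul1r addrA.
  by [].
have FU : \bigcup_n F n = setT.
  apply/seteqP; split=> // x _.
  have [_ _ sz] := zenum_bij.
  have [n _ nE] := sz (Num.floor ((x - c0) / t)) I.
  by exists n => //; rewrite /F /= in_itv/= FP nE.
have tF : trivIset setT F.
  move=> m n _ _ [x [/=]]; rewrite /F/= !in_itv/= !FP => /eqP e1 /eqP e2.
  have [_ iz _] := zenum_bij.
  by apply: iz; rewrite ?in_setT// -e1 -e2.
rewrite -[in LHS]FU ge0_integral_bigcup//; last by rewrite FU.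
under [RHS]eq_integral do rewrite esum_zenum//.
rewrite integral_nneseries//; last first.
  move=> n; apply: measurable_funTS; apply: (measurableT_comp mh).
  exact: measurable_shift.
apply: eq_eseriesr => n _.
rewrite integral_mkcond [RHS]integral_mkcond.
rewrite -(@ge0_integral_shift R ((zenum n)%:~R * t)).
- apply: eq_integral => x _; rewrite !patchE; congr (if _ then _ else _).
  apply/idP/idP; rewrite !inE /F/= !in_itv/=; lra.
- apply/(measurable_restrictT h); [exact: mF|exact: measurable_funTS].
- by move=> x; rewrite patchE; case: ifP.
Qed.

(** Lets pointwise statements be proved on one period with a free origin [c0]: countably many such
    periods cover the line. *)
Lemma ae_intervals (P : R -> Prop) :
  (forall c0 : R, {ae mu, forall x, c0 <= x < c0 + 1 -> P x}) ->
  {ae mu, forall x, P x}.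
Proof.
move=> h; have := @ae_foralln _ _ R mu
  (fun n x => (zenum n)%:~R <= x < (zenum n)%:~R + 1 -> P x) (fun n => h _).
apply: ae_impl => x hx.
have [_ _ sz] := zenum_bij.
have [n _ nE] := sz (Num.floor x) I.
apply: (hx n); rewrite nE.
by have := floor_itv x; rewrite intrD.
Qed.

End periodization.

(** * The Fourier integral and Plancherel for bounded support *)

Section fourier_L1.
Variable R : realType.
Notation C := R[i].
Notation mu := (@lebesgue_measure R).
Implicit Types f g : R -> C.

Lemma L1P f : Lp 1%:E f <-> integrableC f.
Proof.
rewrite /Lp /normLp /= Lnorm1.
split=> -[mf hf]; split=> //.
  apply/integrableP; split; first by apply/measurable_EFinP; exact: measurable_normc.
  exact: hf.
by have /integrableP[_] := hf.
Qed.

Lemma fourierL1E f gamma : fourierL1 f gamma = integralC (fun x => f x * ex (- gamma * x)).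
Proof.
rewrite /fourierL1; congr integralC; apply/funext => x; congr (_ * expi _); ring.
Qed.

Lemma measurable_ex_scaled (a : R) : measurableC (fun x : R => ex (a * x)).
Proof.
apply: (@measurableC_comp _ (fun t => ex t) (fun u : R => a * u)).
  exact: mulrl_measurable.
exact: measurable_ex.
Qed.

Lemma integrable_wave (a : R) f : integrableC f -> integrableC (fun x => f x * ex (a * x)).
Proof.
move=> [mf hf]; apply: (integrableC_dom _ hf).
  by apply: measurableCM => //; exact: measurable_ex_scaled.
by move=> x; rewrite normcM normc_ex mulr1.
Qed.

Lemma L2_wave (a : R) f : L2 f -> L2 (fun x => f x * ex (a * x)) /\
  nrm (fun x => f x * ex (a * x)) = nrm f.
Proof.
move=> Lf; have E x : normc (f x * ex (a * x)) = normc (f x).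
  by rewrite normcM normc_ex mulr1.
split.
  apply: (L2_dom _ (integrable_sqr Lf)); last by move=> x; rewrite E.
  by apply: measurableCM; [exact: L2_measurable|exact: measurable_ex_scaled].
rewrite /nrm !norm2_sqn; congr (fine (sqrte _)); apply: eq_integral => x _.
by rewrite E.
Qed.

(** The integral is continuous in the frequency by domination with |f|. In [bnd], [P] is the real or
    the imaginary part. *)
Lemma fourierL1_measurable f : integrableC f -> measurableC (fourierL1 f).
Proof.
move=> hf.
have bnd (P : C -> R) (hP : forall z, `|P z| <= normc z)
    (mP : forall a, measurable_fun setT (fun x => P (f x * ex (a * x))))
    (cP : forall x, continuous (fun a : R => P (f x * ex (- a * x)))) :
    measurable_fun setT (fun a : R => Rintegral mu setT (fun x => P (f x * ex (- a * x)))).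
  apply: continuous_measurable_fun => a.
  have aI : a \in (`]a - 1, a + 1[%classic : set R).
    by rewrite inE /= in_itv/=; lra.
  apply: (@continuity_under_integral R _ _ mu
    (fun b x => P (f x * ex (- b * x))) setT measurableT (a - 1) (a + 1) _ _
    (fun x => normc (f x)) _ _ a aI).
  - move=> b _; have [_ h] := integrable_wave (- b) hf.
    apply: le_integrable h => //; first by apply/measurable_EFinP; exact: mP.
    by move=> x _; rewrite /= lee_fin [leRHS]ger0_norm ?normc_ge0.
  - by apply: aeW => x _ b _; exact: cP.
  - by case: hf.
  - move=> b _; apply: aeW => x _; apply: (le_trans (hP _)).
    by rewrite normcM normc_ex mulr1.
have mw a := (integrable_wave a hf).1.
have cc (x : R) : continuous (fun a : R => cos (2 * pi * (- a * x))).
  move=> a; apply: (@continuous_comp _ _ _ (fun a : R => 2 * pi * (- a * x)) cos); last exact: continuous_cos.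
  rewrite (_ : (fun a : R => _) = (fun a : R => (- (2 * pi * x)) * a)); first exact: mulrl_continuous.
  by apply/funext => b; ring.
have cs (x : R) : continuous (fun a : R => sin (2 * pi * (- a * x))).
  move=> a; apply: (@continuous_comp _ _ _ (fun a : R => 2 * pi * (- a * x)) sin); last exact: continuous_sin.
  rewrite (_ : (fun a : R => _) = (fun a : R => (- (2 * pi * x)) * a)); first exact: mulrl_continuous.
  by apply/funext => b; ring.
rewrite (_ : fourierL1 f = fun a => integralC (fun x => f x * ex (- a * x))); last first.
  by apply/funext => a; rewrite fourierL1E.
split.
  apply: (bnd (@Re R)).
  - exact: abs_Re_le.
  - by move=> a; case: (mw a).
  - move=> x a; under eq_fun do rewrite ReM/=.
    by apply: cvgB; apply: cvgM; by [exact: cvg_cst|exact: cc|exact: cs].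
apply: (bnd (@Im R)).
- exact: abs_Im_le.
- by move=> a; case: (mw a).
- move=> x a; under eq_fun do rewrite ImM/=.
  by apply: cvgD; apply: cvgM; by [exact: cvg_cst|exact: cc|exact: cs].
Qed.

Lemma fourierL1_lin (z : C) f g : integrableC f -> integrableC g ->
  fourierL1 (f + z *: g) = fourierL1 f + z *: fourierL1 g.
Proof.
move=> hf hg; apply/funext => a.
change (fourierL1 (f + z *: g) a = fourierL1 f a + z * fourierL1 g a).
rewrite !fourierL1E -integralCZ; last exact: integrable_wave.
rewrite -integralCD; [|exact: integrable_wave|exact/integrableCZ/integrable_wave].
congr integralC; apply/funext => x.
by rewrite -[(f + z *: g) x]/(f x + z * g x) mulrDl mulrA.
Qed.

Lemma fourierL1_translate k f : integrableC f ->
  fourierL1 (translate k f) = fun a => ex (- k%:~R * a) * fourierL1 f a.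
Proof.
move=> hf; apply/funext => a; rewrite !fourierL1E -integralCZ; last exact: integrable_wave.
have mt : measurableC (fun x => translate k f x * ex (- a * x)).
  apply: measurableCM; last exact: measurable_ex_scaled.
  by apply: measurable_translate; case: hf.
rewrite -(integralC_shift k%:~R mt).
congr integralC; apply/funext => x; rewrite /translate addrK mulrDr exD.
have -> : - k%:~R * a = - a * k%:~R by ring.
ring.
Qed.

(* Parseval on an interval of length [N], applied to [f(x) exp(-2 pi i gamma x)]
   for every gamma, and integrated over gamma in [0, 1/N[. *)
Lemma plancherel_compact (N c0 : R) f : 0 < N -> L2 f ->
  (forall x, ~ (c0 <= x < c0 + N) -> f x = 0) ->
  integrableC f /\ sqn (fourierL1 f) = sqn f.
Proof.
move=> N0 Lf fI.
have mf := L2_measurable Lf.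
have hf : integrableC f.
  (* On the support, which is bounded, |f| <= |f|^2 + 1. *)
  have := integrableD (@measurableT _ _) (integrable_sqr Lf) (integrable_real_ind N c0).
  move=> hi; have hi' : mu.-integrable setT
      (EFin \o (fun x => normc (f x) ^+ 2 + \1_(`[c0, (c0 + N)%R[%classic : set R) x)).
    by apply: eq_integrable hi.
  apply: (integrableC_dom mf hi') => x.
  have [xI|xI] := pselect (c0 <= x < c0 + N); last first.
    by rewrite (fI _ xI) normc0 addr_ge0// sqr_ge0.
  rewrite indicE mem_set/= ?in_itv//=.
  by have := sqr_ge0 (normc (f x) - 1); rewrite sqrrB expr1n; have := normc_ge0 (f x); lra.
split=> //.
have tN : 0 < N^-1 by rewrite invr_gt0.
have mF := fourierL1_measurable hf.
rewrite /sqn (@integral_periodization R 0 (N^-1))//; last 2 first.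
- by apply/measurable_EFinP; exact: measurable_sqr_normc.
- by move=> x; rewrite lee_fin sqr_ge0.
have LB k := fbase_L2 N c0 k.
(* The transform sampled at steps 1/N has total energy N |f|^2, whatever the starting frequency; the
   integration interval has length 1/N. *)
rewrite (eq_integral (cst ((Num.sqrt N * nrm f) ^+ 2)%:E)); last first.
  move=> a _ /=.
  have [Lw nw] := L2_wave (- a) Lf.
  set w := (fun x => f x * ex (- a * x)) in Lw nw.
  have Lg := L2Z (Num.sqrt N)%:C%C Lw.
  have gI x : ~ (c0 <= x < c0 + N) -> ((Num.sqrt N)%:C%C *: w) x = 0.
    move=> /fI fx0; rewrite -[LHS]/((Num.sqrt N)%:C%C * (f x * ex (- a * x))).
    by rewrite fx0 mul0r mulr0.
  have := on_parseval LB (@fbase_orthonormal R N c0 N0) (fbase_complete N0 Lg gI).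
  rewrite nrmZ// normc_real ger0_norm ?sqrtr_ge0// nw => <-.
  apply: eq_esum => k _; congr (EFin (normc _ ^+ 2)).
  rewrite fourierL1E; congr integralC; apply/funext => x.
  rewrite /fbase -[((Num.sqrt N)%:C%C *: w) x]/((Num.sqrt N)%:C%C * (f x * ex (- a * x))).
  rewrite !conjM conj_ex realc_conj.
  have -> : (ind N c0 x)^* = ind N c0 x by rewrite /ind realc_conj.
  have ss : (Num.sqrt N)%:C%C * ((Num.sqrt N)^-1)%:C%C = 1 :> C.
    by rewrite -realcM mulfV// gt_eqF// sqrtr_gt0.
  rewrite indE; case: ifP => xI; last first.
    have f0 : f x = 0 by apply: fI; rewrite xI.
    by rewrite f0 !(mul0r, mulr0).
  rewrite mul1r opprD mulrDl exD.
  have -> : - (k%:~R * N^-1) * x = - (k%:~R * (x / N)) by ring.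
  rewrite -[LHS]mul1r -ss; ring.
rewrite integral_cst//= -[X in _ = X]/(sqn f) sqnE//.
rewrite [X in (_ * X)%E](_ : _ = (N^-1)%:E); last first.
  by rewrite add0r lebesgue_measure_itv/= lte_fin tN oppr0 adde0.
by rewrite -EFinM exprMn sqr_sqrtr ?(ltW N0)// mulrAC mulfV ?gt_eqF// mul1r.
Qed.

End fourier_L1.

(** * Plancherel on L^2 and the extended transform *)

Section fourier_L2.
Variable R : realType.
Notation C := R[i].
Notation mu := (@lebesgue_measure R).
Implicit Types f g : R -> C.

(** Cutoff to [[-(n+1), n+1[]; the successor makes the length positive for every [n]. *)
Definition trunc (n : nat) f : R -> C :=
  fun x => ind (n.+1%:R *+ 2) (- n.+1%:R) x * f x.

Lemma truncE n f x : trunc n f x = if - n.+1%:R <= x < n.+1%:R then f x else 0.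
Proof.
rewrite /trunc indE mulr2n addKr.
by case: ifP => _; rewrite ?mul1r ?mul0r.
Qed.

Lemma trunc_measurable n f : measurableC f -> measurableC (trunc n f).
Proof. by move=> mf; apply: measurableCM => //; exact: measurable_ind. Qed.

Lemma trunc_normc n f x : normc (trunc n f x) <= normc (f x).
Proof. by rewrite truncE; case: ifP => // _; rewrite normc0 normc_ge0. Qed.

Lemma truncB_normc n f x : normc (f x - trunc n f x) <= normc (f x).
Proof. by rewrite truncE; case: ifP => _; rewrite ?subr0// subrr normc0 normc_ge0. Qed.

Lemma trunc_L2 n f : L2 f -> L2 (trunc n f).
Proof.
move=> Lf; apply: (L2_dom _ (integrable_sqr Lf)).
  by apply: trunc_measurable; exact: L2_measurable.
by move=> x; rewrite ler_pXn2r ?nnegrE ?normc_ge0//; exact: trunc_normc.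
Qed.

Lemma trunc_L1 n f : integrableC f -> integrableC (trunc n f).
Proof.
move=> [mf hf]; apply: (integrableC_dom _ hf); first exact: trunc_measurable.
exact: trunc_normc.
Qed.

Lemma trunc_support n f x :
  ~ (- n.+1%:R <= x < - n.+1%:R + n.+1%:R *+ 2) -> trunc n f x = 0.
Proof. by rewrite mulr2n addKr truncE; case: ifP. Qed.

Lemma trunc_plancherel n f : L2 f ->
  integrableC (trunc n f) /\ sqn (fourierL1 (trunc n f)) = sqn (trunc n f).
Proof.
move=> Lf; apply: plancherel_compact (trunc_L2 n Lf) (@trunc_support n f).
by rewrite mulrn_wgt0.
Qed.

(** Dominated convergence in a form that covers truncation errors both in L^1 and in L^2. *)
Lemma trunc_tail_cvg (u : R -> R) (v : nat -> R -> R) :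
  mu.-integrable setT (EFin \o u) -> (forall n, measurable_fun setT (v n)) ->
  (forall n x, 0 <= v n x <= u x) ->
  (forall n x, - n.+1%:R <= x < n.+1%:R -> v n x = 0) ->
  (fun n => Rintegral mu setT (v n)) @ \oo --> (0 : R).
Proof.
move=> iu mv hv v0.
have mv' n : measurable_fun setT (EFin \o v n) by exact/measurable_EFinP.
have [||||_ _ hc] := @dominated_convergence _ _ R mu setT measurableT
  (fun n => EFin \o v n) (cst 0%E) (EFin \o u) mv'.
- exact: measurable_cst.
- apply: aeW => x _; apply: cvg_near_cst.
  exists (Num.truncn `|x|).+1 => // n /= hn; congr EFin; apply: v0.
  have h : `|x| < n.+1%:R.
    by rewrite (lt_le_trans (truncnS_gt _))// ler_nat ltnW.
  by move: h; rewrite ltr_norml => /andP[/ltW -> ->].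
- exact: iu.
- apply: aeW => x n _; rewrite /= lee_fin; have /andP[a b] := hv n x.
  by rewrite ger0_norm.
by rewrite integral0 in hc; exact: (fine_cvg hc).
Qed.

Lemma trunc_cvg_L2 f : L2 f ->
  forall e, 0 < e -> exists N, forall n, (N <= n)%N -> nrm (f - trunc n f) <= e.
Proof.
move=> Lf e e0; have mf := L2_measurable Lf.
have h : (fun n => Rintegral mu setT (fun x => normc (f x - trunc n f x) ^+ 2)) @ \oo
    --> (0 : R).
  apply: (trunc_tail_cvg (integrable_sqr Lf)) => n.
  - by apply: measurable_sqr_normc; apply: measurableCB => //; exact: trunc_measurable.
  - move=> x; rewrite sqr_ge0/= ler_pXn2r ?nnegrE ?normc_ge0//; exact: truncB_normc.
  - by move=> x hx; rewrite truncE hx subrr normc0 expr0n.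
have /cvgrPdist_le /(_ _ (exprn_gt0 2 e0))[N _ hN] := h.
exists N => n /hN; rewrite /= sub0r normrN.
rewrite -[X in `|X|]/(fine (sqn (f - trunc n f))) sqnE; last by apply: L2B => //; exact: trunc_L2.
rewrite /= ger0_norm ?sqr_ge0// ler_pXn2r ?nnegrE ?nrm_ge0// ltW//.
Qed.

Lemma trunc_fourier_cvg f : integrableC f ->
  cvgC (fun n => fourierL1 (trunc n f)) (fourierL1 f).
Proof.
move=> hf a; have [mf af] := hf.
have h : (fun n => Rintegral mu setT (fun x => normc (f x - trunc n f x))) @ \oo
    --> (0 : R).
  apply: (trunc_tail_cvg af) => n.
  - by apply: measurable_normc; apply: measurableCB => //; exact: trunc_measurable.
  - by move=> x; rewrite normc_ge0/=; exact: truncB_normc.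
  - by move=> x hx; rewrite truncE hx subrr normc0.
have key n : normc (fourierL1 f a - fourierL1 (trunc n f) a) <=
    Rintegral mu setT (fun x => normc (f x - trunc n f x)).
  have ht := trunc_L1 n hf.
  have hd : integrableC (fun x => f x - trunc n f x).
    by apply: integrableCD => //; exact: integrableCN.
  rewrite !fourierL1E -integralCN; last exact: integrable_wave.
  rewrite -integralCD; [|exact: integrable_wave|exact/integrableCN/integrable_wave].
  rewrite (_ : (fun x => _) = (fun x => (f x - trunc n f x) * ex (- a * x))); last first.
    by apply/funext => x; rewrite mulrBl.
  apply: (le_trans (normc_integralC (integrable_wave (- a) hd))).
  rewrite le_eqVlt; apply/orP; left; apply/eqP; apply: eq_Rintegral => x _.
  by rewrite normcM normc_ex mulr1.
have small e : 0 < e -> exists N, forall n, (N <= n)%N ->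
    normc (fourierL1 f a - fourierL1 (trunc n f) a) <= e.
  move=> e0; have /cvgrPdist_le /(_ e e0)[N _ hN] := h.
  exists N => n /hN; rewrite /= sub0r normrN => hn.
  by apply: (le_trans (key n)); apply: le_trans hn; exact: ler_norm.
split; apply/cvgrPdist_le => e /small[N hN]; exists N => // n /hN hn; apply: le_trans hn.
  rewrite -[X in `|X|]/(Re (fourierL1 f a) - Re (fourierL1 (trunc n f) a)).
  by rewrite -ReN -ReD; exact: abs_Re_le.
rewrite -[X in `|X|]/(Im (fourierL1 f a) - Im (fourierL1 (trunc n f) a)).
by rewrite -ImN -ImD; exact: abs_Im_le.
Qed.

Lemma trunc_sqn_le n f : L2 f -> (sqn (trunc n f) <= sqn f)%E.
Proof.
move=> Lf; rewrite !sqnE//; last exact: trunc_L2.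
rewrite lee_fin -lee_fin -!sqnE//; last exact: trunc_L2.
apply: ge0_le_integral => //.
- by move=> x _; rewrite lee_fin sqr_ge0.
- by apply/measurable_EFinP; apply: measurable_sqr_normc; apply: trunc_measurable; exact: L2_measurable.
- by apply/measurable_EFinP; apply: measurable_sqr_normc; exact: L2_measurable.
- by move=> x _; rewrite lee_fin ler_pXn2r ?nnegrE ?normc_ge0//; exact: trunc_normc.
Qed.

(** The transforms of the truncations converge pointwise, so Fatou gives an inequality only. Applied
    to truncation errors, it then lets the isometry extend from bounded supports. *)
Lemma fourierL1_contraction f : integrableC f -> L2 f ->
  L2 (fourierL1 f) /\ nrm (fourierL1 f) <= nrm f.
Proof.
move=> hf Lf.
have h : (sqn (fourierL1 f) <= sqn f)%E.
  apply: (@fatou_sqn _ (fun n => fourierL1 (trunc n f))).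
  - by move=> n; exact/fourierL1_measurable/trunc_L1.
  - exact: trunc_fourier_cvg.
  - exists 0%N => n _; have [_ ->] := trunc_plancherel n Lf.
    exact: trunc_sqn_le.
have LF : L2 (fourierL1 f).
  apply/L2P; split; first exact: fourierL1_measurable.
  by apply: (le_lt_trans h); have /L2P[] := Lf.
split=> //; move: h; rewrite !sqnE// lee_fin.
by rewrite ler_pXn2r ?nnegrE ?nrm_ge0.
Qed.

Lemma fourierL1B f g : integrableC f -> integrableC g ->
  fourierL1 (f - g) = fourierL1 f - fourierL1 g.
Proof. by move=> hf hg; rewrite -scaleN1r fourierL1_lin// scaleN1r. Qed.

Lemma integrableCB f g : integrableC f -> integrableC g -> integrableC (f - g).
Proof. by move=> hf hg; apply: integrableCD => //; exact: integrableCN. Qed.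

Lemma plancherel_L1 f : integrableC f -> L2 f ->
  L2 (fourierL1 f) /\ nrm (fourierL1 f) = nrm f.
Proof.
move=> hf Lf; have [LF _] := fourierL1_contraction hf Lf; split=> //.
apply/eqP; rewrite -subr_eq0 -normr_le0; apply/ler_addgt0Pr => e e0; rewrite add0r.
have [N hN] := trunc_cvg_L2 Lf (divr_gt0 e0 (ltr0Sn R 1)).
have := hN N (leqnn N); set g := trunc N f => fg.
have Lg : L2 g := trunc_L2 N Lf; have hg : integrableC g := trunc_L1 N hf.
have [LG _] := fourierL1_contraction hg Lg.
have nG : nrm (fourierL1 g) = nrm g.
  by rewrite /nrm !norm2_sqn; have [_ ->] := trunc_plancherel N Lf.
have [_] := fourierL1_contraction (integrableCB hf hg) (L2B Lf Lg).
rewrite fourierL1B// => h.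
have := nrm_lipschitz LF LG; have := nrm_lipschitz Lf Lg.
rewrite !ler_norml nG => /andP[a b] /andP[c d].
by apply/andP; split; lra.
Qed.

(** The defining property of [fourier] as a relation. Unlike the chosen representative, it passes to
    linear combinations and translates. *)
Definition is_fourier f g := L2 g /\ exists u : nat -> R -> C,
  [/\ forall n, integrableC (u n) /\ L2 (u n),
      forall e, 0 < e -> exists N, forall n, (N <= n)%N -> nrm (f - u n) <= e &
      forall e, 0 < e -> exists N, forall n, (N <= n)%N -> nrm (g - fourierL1 (u n)) <= e].

Lemma cvg_norm2 (f : R -> C) (u : nat -> R -> C) : L2 f -> (forall n, L2 (u n)) ->
  ((fun n => norm2 (f - u n)) @ \oo --> 0%E) <->
  (forall e, 0 < e -> exists N, forall n, (N <= n)%N -> nrm (f - u n) <= e).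
Proof.
move=> Lf Lu.
have -> : (fun n => norm2 (f - u n)) = EFin \o (fun n => nrm (f - u n)).
  by apply/funext => n; rewrite /= norm2E//; exact: L2B.
split=> [h e e0|h].
  have h1 : (fun n => nrm (f - u n)) @ \oo --> (0 : R) by exact: (fine_cvg h).
  have /cvgrPdist_le /(_ e e0)[N _ hN] := h1; exists N => n /hN /=.
  by rewrite sub0r normrN ger0_norm ?nrm_ge0.
apply: cvg_EFin; first exact: nearW.
apply/cvgrPdist_le => e /h[N hN]; exists N => // n /hN.
by rewrite /= sub0r normrN ger0_norm ?nrm_ge0.
Qed.

Lemma is_fourier_exists f : L2 f -> exists g, is_fourier f g.
Proof.
move=> Lf; pose u n := trunc n f.
have Lu n : L2 (u n) := trunc_L2 n Lf.
have hu n : integrableC (u n) by have [] := trunc_plancherel n Lf.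
have LF n : L2 (fourierL1 (u n)) by have [] := plancherel_L1 (hu n) (Lu n).
have uc := trunc_cvg_L2 Lf.
have [||g Lg hg] := @L2_complete R (fun n => fourierL1 (u n)).
- by [].
- move=> e e0; have [N hN] := uc _ (divr_gt0 e0 (ltr0Sn R 1)).
  exists N => m n Nm Nn; rewrite -fourierL1B//.
  have [_ ->] := plancherel_L1 (integrableCB (hu m) (hu n)) (L2B (Lu m) (Lu n)).
  apply: le_trans (nrm_triangleB (Lu m) Lf (Lu n)) _.
  by rewrite nrmBC// [leRHS]splitr lerD// hN.
exists g; split=> //; exists u; split=> // e /hg[N hN].
by exists N => n /hN; rewrite nrmBC.
Qed.

Lemma fourierP f : L2 f -> is_fourier f (fourier f).
Proof.
move=> Lf.
have E g : L2 g /\ (exists u : nat -> R -> C,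
      [/\ forall n, (Lp 1%:E `&` L2) (u n),
          (fun n => norm2 (f - u n)) @ \oo --> 0%E &
          (fun n => norm2 (g - fourierL1 (u n))) @ \oo --> 0%E]) <-> is_fourier f g.
  split=> -[Lg [u [hu fu gu]]]; split=> //; exists u.
    have Lu n : L2 (u n) by case: (hu n).
    have iu n : integrableC (u n) by apply/L1P; case: (hu n).
    have LF n : L2 (fourierL1 (u n)) by have [] := plancherel_L1 (iu n) (Lu n).
    by split=> //; exact/cvg_norm2.
  have Lu n : L2 (u n) by case: (hu n).
  have iu n : integrableC (u n) by case: (hu n).
  have LF n : L2 (fourierL1 (u n)) by have [] := plancherel_L1 (iu n) (Lu n).
  by split; [move=> n; split=> //; exact/L1P|exact/cvg_norm2..].
have [g /E hg] := is_fourier_exists Lf.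
have ex_g : [set g | L2 g /\ (exists u : nat -> R -> C,
      [/\ forall n, (Lp 1%:E `&` L2) (u n),
          (fun n => norm2 (f - u n)) @ \oo --> 0%E &
          (fun n => norm2 (g - fourierL1 (u n))) @ \oo --> 0%E])] !=set0 by exists g.
by have /E := @xgetPex _ (fun=> 0) _ ex_g.
Qed.

Lemma is_fourier_isometry f g : L2 f -> is_fourier f g -> nrm g = nrm f.
Proof.
move=> Lf [Lg [u [hu fu gu]]].
apply/eqP; rewrite -subr_eq0 -normr_le0; apply/ler_addgt0Pr => e e0; rewrite add0r.
have e20 := divr_gt0 e0 (ltr0Sn R 1).
have [N hN] := fu _ e20; have [M hM] := gu _ e20.
pose n := maxn N M; have [iu Lu] := hu n.
have [LF nF] := plancherel_L1 iu Lu.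
have := hN n (leq_maxl _ _); have := hM n (leq_maxr _ _).
have := nrm_lipschitz Lg LF; have := nrm_lipschitz Lf Lu.
rewrite !ler_norml nF => /andP[a b] /andP[c d] p q.
by apply/andP; split; lra.
Qed.

Lemma is_fourier_lin (z : C) f f' g g' : L2 f -> L2 f' -> is_fourier f g -> is_fourier f' g' ->
  is_fourier (f + z *: f') (g + z *: g').
Proof.
move=> Lf Lf' [Lg [u [hu fu gu]]] [Lg' [u' [hu' fu' gu']]].
split; first by apply: L2D => //; exact: L2Z.
exists (fun n => u n + z *: u' n).
have Lu n : L2 (u n) by case: (hu n).
have iu n : integrableC (u n) by case: (hu n).
have Lu' n : L2 (u' n) by case: (hu' n).
have iu' n : integrableC (u' n) by case: (hu' n).
have LF n : L2 (fourierL1 (u n)) by have [] := plancherel_L1 (iu n) (Lu n).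
have LF' n : L2 (fourierL1 (u' n)) by have [] := plancherel_L1 (iu' n) (Lu' n).
(* One estimate serves both the approximants and their transforms. *)
have gen (a b : R -> C) (v w : nat -> R -> C) : L2 a -> L2 b ->
    (forall n, L2 (v n)) -> (forall n, L2 (w n)) ->
    (forall e, 0 < e -> exists N, forall n, (N <= n)%N -> nrm (a - v n) <= e) ->
    (forall e, 0 < e -> exists N, forall n, (N <= n)%N -> nrm (b - w n) <= e) ->
    (forall e, 0 < e -> exists N, forall n, (N <= n)%N ->
      nrm (a + z *: b - (v n + z *: w n)) <= e).
  move=> La Lb Lv Lw hv hw e e0; have e20 := divr_gt0 e0 (ltr0Sn R 1).
  have z0 : 0 < normc z + 1 by have := normc_ge0 z; lra.
  have [N hN] := hv _ e20; have [M hM] := hw _ (divr_gt0 e20 z0).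
  exists (maxn N M) => n; rewrite geq_max => /andP[Nn Mn].
  rewrite opprD addrACA -scalerBr.
  apply: le_trans (nrm_triangle _ _) _; [exact: L2B|by apply: L2Z; exact: L2B|].
  rewrite [leRHS]splitr; apply: lerD; first exact: hN.
  rewrite nrmZ; last exact: L2B.
  have := hM n Mn; rewrite ler_pdivlMr//.
  have := nrm_ge0 (b - w n); have := normc_ge0 z; nra.
split.
- move=> n; split; last by apply: L2D => //; exact: L2Z.
  by apply: integrableCD => //; exact: integrableCZ.
- exact: gen.
- move=> e e0; have [N hN] := gen _ _ _ _ Lg Lg' LF LF' gu gu' e e0.
  by exists N => n Nn; rewrite fourierL1_lin//; exact: hN.
Qed.

Lemma is_fourier_translate k f g : L2 f -> is_fourier f g ->
  is_fourier (translate k f) (fun a => g a * ex (- k%:~R * a)).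
Proof.
move=> Lf [Lg [u [hu fu gu]]]; split; first by have [] := L2_wave (- k%:~R) Lg.
exists (fun n => translate k (u n)).
have Lu n : L2 (u n) by case: (hu n).
have iu n : integrableC (u n) by case: (hu n).
have LF n : L2 (fourierL1 (u n)) by have [] := plancherel_L1 (iu n) (Lu n).
have it n : integrableC (translate k (u n)).
  have [mu_ hun] := iu n; apply/L1P; split; first exact: measurable_translate.
  have /L1P[_] := iu n; congr (_ < _)%E; rewrite /normLp !Lnorm1; apply/esym.
  apply: (@integral_shift R (- k%:~R) (fun x => `|(normc (u n x))%:E|)%E).
  apply: measurableT_comp => //; apply/measurable_EFinP; exact: measurable_normc.
split.
- by move=> n; split=> //; exact: L2_translate.
- move=> e /fu[N hN]; exists N => n /hN.
  rewrite -[X in _ -> nrm X <= _]/(translate k (f - u n)) nrm_translate//.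
  exact: L2B.
- move=> e /gu[N hN]; exists N => n /hN.
  rewrite fourierL1_translate//.
  have [_ <-] := L2_wave (- k%:~R) (L2B Lg (LF n)).
  rewrite (_ : (fun x => _) = (fun a => g a * ex (- k%:~R * a)) -
    (fun a => ex (- k%:~R * a) * fourierL1 (u n) a))//.
  apply/funext => a.
  change ((g a - fourierL1 (u n) a) * ex (- k%:~R * a) =
    g a * ex (- k%:~R * a) - ex (- k%:~R * a) * fourierL1 (u n) a).
  ring.
Qed.

End fourier_L2.

(** * Brackets and Fourier multipliers *)

Section brackets.
Variable R : realType.
Notation C := R[i].
Notation mu := (@lebesgue_measure R).
Implicit Types (f g : R -> C) (z : int -> C) (l : C).

(** Unconditional convergence with a real tolerance: the norm of [R[i]] takes its values in [R[i]]
    itself. *)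
Definition totsum z l := forall e : R, 0 < e -> exists A : {fset int},
  forall B : {fset int}, (A `<=` B)%fset -> normc (l - \sum_(k <- B) z k) <= e.

Lemma totsum_sum z l : totsum z l -> summability.sum (z : int -> C^o) = l.
Proof.
move=> h; apply: cvg_lim; [exact: norm_hausdorff|exact: totally_filter|].
apply/(@cvgrPdist_le R[i] R[i]^o {fset int} totally totally_filter) => -[e e'] e0.
move: e0; rewrite ltcE/= => /andP[/eqP -> e0].
have [A hA] := h _ e0; exists A => // B /hA hB.
rewrite /= /partial_sum -(big_seq_fsetE _ _ xpredT z)/=.
by rewrite lecE/= eqxx.
Qed.

Lemma totsum_unique z l l' : totsum z l -> totsum z l' -> l = l'.
Proof. by move=> /totsum_sum <- /totsum_sum <-. Qed.

Lemma totsumZ (c : C) z l : totsum z l -> totsum (fun k => c * z k) (c * l).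
Proof.
move=> h e e0; have c0 : 0 < normc c + 1 by have := normc_ge0 c; lra.
have [A hA] := h _ (divr_gt0 e0 c0); exists A => B /hA.
rewrite -mulr_sumr -mulrBr normcM ler_pdivlMr//.
have := normc_ge0 (l - \sum_(k <- B) z k); have := normc_ge0 c; nra.
Qed.

Lemma totsumD z z' l l' : totsum z l -> totsum z' l' ->
  totsum (fun k => z k + z' k) (l + l').
Proof.
move=> h h' e e0; have e20 := divr_gt0 e0 (ltr0Sn R 1).
have [A hA] := h _ e20; have [A' hA'] := h' _ e20.
exists (A `|` A')%fset => B; rewrite fsubUset => /andP[/hA p /hA' p'].
rewrite big_split/= opprD addrACA (le_trans (normc_triangle _ _))//.
by rewrite [leRHS]splitr lerD.
Qed.

Lemma totsum_esum (u : int -> R) : (forall k, 0 <= u k) ->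
  (\esum_(k in [set: int]) (u k)%:E < +oo)%E ->
  totsum (fun k => (u k)%:C%C) (fine (\esum_(k in [set: int]) (u k)%:E))%:C%C.
Proof.
move=> u0; set S := (\esum_(k in _) _)%E => Sf e e0.
have S0 : (0 <= S)%E by apply: esum_ge0 => k _; rewrite lee_fin.
have fS : S \is a fin_num by rewrite ge0_fin_numE.
have le_S (B : {fset int}) : \sum_(k <- B) u k <= fine S.
  rewrite -lee_fin fineK// -sumEFin.
  by apply: (@fset_le_esum _ _ (fun k => (u k)%:E)) => k; rewrite lee_fin.
have [A hA] : exists A : {fset int}, fine S - e <= \sum_(k <- A) u k.
  apply: contrapT => /forallNP h.
  have : (S <= (fine S - e)%:E)%E.
    apply: esum_le_fset => A; rewrite sumEFin lee_fin.
    by have /negP := h A; rewrite -ltNge => /ltW.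
  rewrite -[X in (X <= _)%E](fineK fS) lee_fin; lra.
exists A => B AB; rewrite -(raddf_sum (real_complex R)) -realcN -realcD normc_real.
rewrite ger0_norm ?subr_ge0//.
have : \sum_(k <- A) u k <= \sum_(k <- B) u k.
  rewrite [leRHS](big_fsetID _ (mem A))/= [X in _ <= X + _](_ : _ = \sum_(k <- A) u k).
    by rewrite lerDl; apply: sumr_ge0.
  apply: eq_fbigl => k; rewrite !inE/= andbC.
  by case: (boolP (k \in A)) => //= kA; rewrite (fsubsetP AB).
lra.
Qed.

Lemma periodization_measurable f : measurableC f -> measurable_fun setT (periodization f).
Proof.
move=> mf; apply: measurable_esum_int => [k|k x]; last by rewrite lee_fin sqr_ge0.
apply/measurable_EFinP; apply: (@measurable_sqr_normc _ (fun x => f (x + k%:~R))).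
by apply: measurableC_comp => //; exact: measurable_shift.
Qed.

Lemma periodization_ge0 f x : (0 <= periodization f x)%E.
Proof. by apply: esum_ge0 => k _; rewrite lee_fin sqr_ge0. Qed.

Lemma integral_periodization_sqn (c0 : R) f : measurableC f ->
  (\int[mu]_(x in `[c0, (c0 + 1)%R[) periodization f x = sqn f)%E.
Proof.
move=> mf; rewrite /sqn (@integral_periodization R c0 1)//.
- by apply: eq_integral => x _; apply: eq_esum => k _; rewrite mulr1.
- by apply/measurable_EFinP; exact: measurable_sqr_normc.
- by move=> x; rewrite lee_fin sqr_ge0.
Qed.

Lemma periodization_finite f : L2 f -> {ae mu, forall x, (periodization f x < +oo)%E}.
Proof.
move=> Lf; apply: ae_intervals => c0.
have mf := L2_measurable Lf.
have mI : measurable (`[c0, c0 + 1[%classic : set (measurableTypeR R)).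
  exact: measurable_itv.
have iP : mu.-integrable `[c0, (c0 + 1)%R[ (periodization f).
  apply/integrableP; split; first by apply: measurable_funTS; exact: periodization_measurable.
  under eq_integral do rewrite gee0_abs ?periodization_ge0//.
  by rewrite integral_periodization_sqn//; have /L2P[] := Lf.
have := integrable_ae mI iP; apply: ae_impl => x hx xI.
by rewrite -ge0_fin_numE ?periodization_ge0//; apply: hx; rewrite /= in_itv.
Qed.

(* 0 where the sum diverges. *)
Definition per f (x : R) : R := fine (periodization f x).

Lemma per_ge0 f x : 0 <= per f x.
Proof. by rewrite fine_ge0// periodization_ge0. Qed.

Lemma per_measurable f : measurableC f -> measurable_fun setT (per f).
Proof.
by move=> mf; apply: measurableT_comp => //; exact: periodization_measurable.
Qed.

Lemma indM_integrable (c0 : R) f : L2 f ->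
  mu.-integrable setT (EFin \o (fun x => \1_(`[c0, (c0 + 1)%R[%classic : set R) x * per f x)) /\
  Rintegral mu setT (fun x => \1_(`[c0, (c0 + 1)%R[%classic : set R) x * per f x) = nrm f ^+ 2.
Proof.
move=> Lf; have mf := L2_measurable Lf.
have mI : measurable (`[c0, c0 + 1[%classic : set (measurableTypeR R)).
  exact: measurable_itv.
have E : (\int[mu]_x (\1_(`[c0, (c0 + 1)%R[%classic : set R) x * per f x)%:E =
    sqn f)%E.
  rewrite -(integral_periodization_sqn c0 mf) [RHS]integral_mkcond.
  apply: ae_eq_integral => //.
  - apply/measurable_EFinP; apply: measurable_funM; last exact: per_measurable.
    exact: measurable_indic.
  - apply/(measurable_restrictT (periodization f)); first exact: mI.
    by apply: measurable_funTS; exact: periodization_measurable.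
  - have := periodization_finite Lf; apply: ae_impl => x fx _.
    rewrite patchE indicE; case: ifP => _; last by rewrite mul0r.
    by rewrite mul1r fineK// ge0_fin_numE// periodization_ge0.
split; last by rewrite /Rintegral E sqnE.
apply/integrableP; split.
  apply/measurable_EFinP; apply: measurable_funM; last exact: per_measurable.
  exact: measurable_indic.
under eq_integral do rewrite gee0_abs ?lee_fin ?mulr_ge0 ?per_ge0//.
by rewrite E; have /L2P[] := Lf.
Qed.

(* The bracket, obtained by polarization from [per]. *)
Definition brk f g (x : R) : C :=
  (((per (f + g) x - per f x - per g x) / 2) +i*
   ((per (f + 'i%C *: g) x - per f x - per g x) / 2))%C.

Lemma brk_measurable f g : measurableC f -> measurableC g -> measurableC (brk f g).
Proof.
move=> mf mg.
have mig : measurableC ('i%C *: g).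
  by apply: measurableCM => //; exact: measurableC_cst.
have gen h : measurableC h ->
    measurable_fun setT (fun x => (per h x - per f x - per g x) / 2).
  move=> mh.
  have m1 := measurable_funB (per_measurable mh) (per_measurable mf).
  have m2 := measurable_funB m1 (per_measurable mg).
  exact: (measurable_funM m2 (measurable_cst _)).
have m1 := gen (f + g) (measurableCD mf mg).
have m2 := gen (f + 'i%C *: g) (measurableCD mf mig).
by split.
Qed.

Lemma sqr_normcD_le (a b : C) : normc (a + b) ^+ 2 <= 2 * normc a ^+ 2 + 2 * normc b ^+ 2.
Proof.
rewrite !normc_sqr ReD ImD.
have := sqr_ge0 (Re a - Re b).
have := sqr_ge0 (Im a - Im b).
rewrite !sqrrB !sqrrD; lra.
Qed.

Lemma periodizationD_le f g x : (periodization (f + g)%R x <=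
  2%:E * periodization f x + 2%:E * periodization g x)%E.
Proof.
have E h : (2%:E * periodization h x =
    \esum_(k in [set: int]) (normc (h (x + k%:~R)%R) ^+ 2 + normc (h (x + k%:~R)%R) ^+ 2)%:E)%E.
  rewrite mule_natl mule2n -esumD//.
  - by move=> k _; rewrite lee_fin sqr_ge0.
  - by move=> k _; rewrite lee_fin sqr_ge0.
rewrite !E -esumD.
- apply: le_esum => k _; rewrite -EFinD lee_fin.
  by have := sqr_normcD_le (f (x + k%:~R)) (g (x + k%:~R)); lra.
- by move=> k _; rewrite lee_fin addr_ge0 ?sqr_ge0.
- by move=> k _; rewrite lee_fin addr_ge0 ?sqr_ge0.
Qed.

Lemma periodizationZ (c : C) f x :
  normc c = 1 -> periodization (c *: f) x = periodization f x.
Proof.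
move=> c1; apply: eq_esum => k _; congr (EFin (_ ^+ 2)).
by rewrite -[(c *: f) _]/(c * f (x + k%:~R)) normcM c1 mul1r.
Qed.

Section finite_point.
Variables (f g : R -> C) (x : R).
Hypothesis ff : (periodization f x < +oo)%E.
Hypothesis gf : (periodization g x < +oo)%E.

Let pD h : (periodization h x < +oo)%E -> (periodization (f + h)%R x < +oo)%E.
Proof.
move=> hh; apply: (le_lt_trans (periodizationD_le f h x)).
by apply: lte_add_pinfty; apply: lte_mul_pinfty.
Qed.

Let normi : normc 'i%C = 1 :> R.
Proof.
by apply/eqP; rewrite -(@eqrXn2 _ 2) ?normc_ge0// normc_sqr/= expr0n add0r.
Qed.

Let pigf : (periodization ('i%C *: g)%R x < +oo)%E.
Proof. by rewrite periodizationZ. Qed.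

Let per_totsum h : (periodization h x < +oo)%E ->
  totsum (fun k => (normc (h (x + k%:~R)) ^+ 2)%:C%C) (per h x)%:C%C.
Proof. by move=> hh; apply: totsum_esum => // k; exact: sqr_ge0. Qed.

(** Polarization holds term by term, so the bracket series inherits unconditional convergence from
    four series with nonnegative terms. *)
Lemma brk_totsum : totsum (fun k => f (x + k%:~R) * (g (x + k%:~R))^*) (brk f g x).
Proof.
have key (h : R -> C) := @per_totsum h.
have := totsumD (totsumZ (2^-1)%:C%C (key _ (pD gf)))
  (totsumD (totsumZ (- 2^-1)%:C%C (key _ ff)) (totsumZ (- 2^-1)%:C%C (key _ gf))).
move=> hr.
have := totsumD (totsumZ (2^-1)%:C%C (key _ (pD pigf)))
  (totsumD (totsumZ (- 2^-1)%:C%C (key _ ff)) (totsumZ (- 2^-1)%:C%C (key _ gf))).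
move=> /(totsumZ 'i%C) hi.
have := totsumD hr hi; congr totsum.
  apply/funext => k.
  rewrite -[(f + g) _]/(f (x + k%:~R) + g (x + k%:~R)).
  rewrite -[(f + 'i%C *: g) _]/(f (x + k%:~R) + 'i%C * g (x + k%:~R)).
  set u := f _; set v := g _.
  apply: complex_eq; rewrite !(ReD, ImD, ReM, ImM, Re_conj, Im_conj)/= !normc_sqr !(ReD, ImD, ReM, ImM)/=.
    by field.
  by field.
rewrite /brk; apply: complex_eq; rewrite !(ReD, ImD, ReM, ImM)/=.
  by field.
by field.
Qed.

Lemma bracketE : bracket f g x = brk f g x.
Proof. exact: totsum_sum brk_totsum. Qed.

(** The constant is crude; the bound serves only to truncate the bracket. *)
Lemma brk_bound : normc (brk f g x) <= 3 * (per f x + per g x).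
Proof.
have fin h : (periodization h x < +oo)%E -> (per h x)%:E = periodization h x.
  by move=> hh; rewrite fineK// ge0_fin_numE// periodization_ge0.
have D h : (periodization h x < +oo)%E -> per (f + h) x <= 2 * per f x + 2 * per h x.
  move=> hh; rewrite -lee_fin EFinD !EFinM !fin//; last exact: pD.
  exact: periodizationD_le.
have := D _ gf; have := D _ pigf.
have -> : per ('i%C *: g) x = per g x by rewrite /per periodizationZ.
have := per_ge0 f x; have := per_ge0 g x.
have := per_ge0 (f + g) x; have := per_ge0 (f + 'i%C *: g) x.
move=> h1 h2 h3 h4 h5 h6; apply: le_trans (normc_le _) _.
rewrite /brk/= (_ : 3 * _ = 3 / 2 * (per f x + per g x) + 3 / 2 * (per f x + per g x)); last by field.
by apply: lerD; rewrite ler_norml; apply/andP; split; lra.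
Qed.

End finite_point.

Lemma bracket_ae f g : L2 f -> L2 g -> {ae mu, forall x, bracket f g x = brk f g x}.
Proof.
move=> Lf Lg; apply: ae_impl (ae_and (periodization_finite Lf) (periodization_finite Lg)).
by move=> x [fx gx]; exact: bracketE.
Qed.

(** Both sides are polarizations, so the identity reduces to the one between |f|^2 and the integral
    of [per f] over a period. *)
Lemma inner_brk (c0 : R) f g : L2 f -> L2 g ->
  integrableC (fun x => ind 1 c0 x * brk f g x) /\
  inner f g = integralC (fun x => ind 1 c0 x * brk f g x).
Proof.
move=> Lf Lg; have Lig := L2Z 'i%C Lg.
have [i1 e1] := indM_integrable c0 Lf.
have [i2 e2] := indM_integrable c0 Lg.
have [i3 e3] := indM_integrable c0 (L2D Lf Lg).
have [i4 e4] := indM_integrable c0 (L2D Lf Lig).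
set I := (`[c0, (c0 + 1)[%classic : set R) in i1 e1 i2 e2 i3 e3 i4 e4.
have iB (u v : R -> R) : mu.-integrable setT (EFin \o u) -> mu.-integrable setT (EFin \o v) ->
    mu.-integrable setT (EFin \o (fun x => u x - v x)).
  by move=> iu iv; have := integrableB (@measurableT _ _) iu iv; apply: eq_integrable.
have pol h : mu.-integrable setT (EFin \o (fun x => \1_I x * per h x)) ->
    Rintegral mu setT (fun x => \1_I x * per h x) = nrm h ^+ 2 ->
    mu.-integrable setT (EFin \o (fun x => 2^-1 * (\1_I x * per h x - \1_I x * per f x - \1_I x * per g x))) /\
    Rintegral mu setT (fun x => 2^-1 * (\1_I x * per h x - \1_I x * per f x - \1_I x * per g x)) =
    2^-1 * (nrm h ^+ 2 - nrm f ^+ 2 - nrm g ^+ 2).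
  move=> ih eh; have i5 := iB _ _ (iB _ _ ih i1) i2; split; first exact: integrableZR.
  rewrite RintegralZl// RintegralB//; last exact: iB.
  by rewrite RintegralB// eh e1 e2.
have [ir er] := pol _ i3 e3; have [ii ei] := pol _ i4 e4.
have indM x : ind 1 c0 x * brk f g x =
   ((2^-1 * (\1_I x * per (f + g) x - \1_I x * per f x - \1_I x * per g x)) +i*
    (2^-1 * (\1_I x * per (f + 'i%C *: g) x - \1_I x * per f x - \1_I x * per g x)))%C.
  by rewrite /ind /brk; apply: complex_eq; rewrite !(ReM, ImM)/=; ring.
split.
  have mI : measurable (I : set (measurableTypeR R)) by exact: measurable_itv.
  have mB : measurableC (fun x => ind 1 c0 x * brk f g x).
    apply: measurableCM; first exact: measurable_ind.
    by apply: brk_measurable; exact: L2_measurable.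
  have := integrableD (@measurableT _ _) (integrable_norm ir) (integrable_norm ii).
  move=> hi; apply: (integrableC_dom mB (g := fun x =>
    `|2^-1 * (\1_I x * per (f + g) x - \1_I x * per f x - \1_I x * per g x)| +
    `|2^-1 * (\1_I x * per (f + 'i%C *: g) x - \1_I x * per f x - \1_I x * per g x)|)).
    by apply: eq_integrable hi.
  by move=> x; apply: (le_trans (normc_le _)); rewrite indM.
have nig : nrm ('i%C *: g) = nrm g.
  rewrite nrmZ// (_ : normc _ = 1) ?mul1r//.
  by apply/eqP; rewrite -(@eqrXn2 _ 2) ?normc_ge0// normc_sqr/= expr0n add0r.
under [in RHS]eq_fun do rewrite indM.
apply: complex_eq.
  rewrite -[RHS]/(Rintegral mu setT (fun x => 2^-1 * (\1_I x * per (f + g) x - \1_I x * per f x - \1_I x * per g x))).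
  rewrite er nrm_sqrD//.
  set z := Re _; by field.
rewrite -[RHS]/(Rintegral mu setT (fun x => 2^-1 * (\1_I x * per (f + 'i%C *: g) x - \1_I x * per f x - \1_I x * per g x))).
rewrite ei nrm_sqrD// nig innerZr// ReM Re_conj Im_conj.
rewrite -[Re 'i%C]/(0 : R) -[Im 'i%C]/(1 : R).
set z := Im _; set w := Re _; by field.
Qed.

End brackets.

(** * Periodic multipliers and the weight sqrt(Phi) *)

Section multipliers.
Variable R : realType.
Notation C := R[i].
Notation mu := (@lebesgue_measure R).
Implicit Types (f g : R -> C) (c d : int -> C) (A : {fset int}).

Lemma integralC_ae f g : measurableC f -> measurableC g ->
  {ae mu, forall x, f x = g x} -> integralC f = integralC g.
Proof.
move=> [mf mf'] [mg mg'] fg; rewrite /integralC /Rintegral; congr (fine _ +i* fine _)%C.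
  apply: ae_eq_integral => //; [exact/measurable_EFinP|exact/measurable_EFinP|].
  by apply: ae_impl fg => x -> _.
apply: ae_eq_integral => //; [exact/measurable_EFinP|exact/measurable_EFinP|].
by apply: ae_impl fg => x -> _.
Qed.

(** Polarization of the isometry: scaling the second argument by 1 and by the imaginary unit
    recovers the two parts of the inner product. *)
Lemma is_fourier_inner f f' g g' : L2 f -> L2 f' -> is_fourier f g -> is_fourier f' g' ->
  inner g g' = inner f f'.
Proof.
move=> Lf Lf' hf hf'; have [Lg _] := hf; have [Lg' _] := hf'.
have n1 := is_fourier_isometry Lf hf; have n2 := is_fourier_isometry Lf' hf'.
have re (z : C) : Re (inner g (z *: g')) = Re (inner f (z *: f')).
  have Lzf := L2Z z Lf'; have Lzg := L2Z z Lg'.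
  have h := is_fourier_isometry (L2D Lf Lzf) (is_fourier_lin z Lf Lf' hf hf').
  have := nrm_sqrD Lg Lzg; have := nrm_sqrD Lf Lzf.
  rewrite h nrmZ// (nrmZ z Lg') n1 n2 => -> e.
  by move: e => /addrI; lra.
apply: complex_eq; first by have := re 1; rewrite !scale1r.
have := re 'i%C; rewrite !innerZr// !ReM !Re_conj !Im_conj.
rewrite -[Re 'i%C]/(0 : R) -[Im 'i%C]/(1 : R) !mul0r !sub0r !mulN1r !opprK.
by [].
Qed.

Definition mult c A (x : R) : C := \sum_(k <- A) c k * ex (- k%:~R * x).

Lemma mult_measurable c A : measurableC (mult c A).
Proof.
apply: measurableC_sum => k; apply: measurableCM; first exact: measurableC_cst.
exact: measurable_ex_scaled.
Qed.

Lemma mult_bounded c A : exists M, forall x, normc (mult c A x) <= M.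
Proof.
exists (\sum_(k <- A) normc (c k)) => x; rewrite (le_trans (normc_sum _ _ _))//.
by apply: ler_sum => k _; rewrite normcM normc_ex mulr1.
Qed.

Lemma ex_periodic (k m : int) (x : R) : ex (k%:~R * (x + m%:~R)) = ex (k%:~R * x).
Proof. by rewrite mulrDr exD -intrM ex_int mulr1. Qed.

Lemma mult_periodic c A x (m : int) : mult c A (x + m%:~R) = mult c A x.
Proof. by apply: eq_bigr => k _; rewrite -rmorphN ex_periodic. Qed.

(* Conjugation turns the exponentials [ex (- k x)] of the translates into the
   basis [ex (k x)] without reindexing. *)
Lemma mult_conj c A x : mult (fun k => (c k)^*) A x = (comb (@chr R) c A x)^*.
Proof.
rewrite combE rmorph_sum; apply: eq_bigr => k _.
by rewrite -[RHS]/((c k * ex (k%:~R * x))^*) conjM conj_ex mulNr.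
Qed.

Lemma is_fourier_mult f g c A : L2 f -> is_fourier f g ->
  is_fourier (comb (translates f) c A) (fun x => mult c A x * g x).
Proof.
move=> Lf hf; have LT k : L2 (translates f k) by exact: L2_translate.
rewrite /comb /mult; elim: (A : seq int) => [|k s ih].
  rewrite big_nil (_ : (fun x => _) = 0); last first.
    by apply/funext => x; rewrite big_nil mul0r.
  (* For the empty combination, 0 is obtained as [f - f]. *)
  have := is_fourier_lin (-1) Lf Lf hf hf.
  by rewrite !scaleN1r !subrr.
rewrite big_cons addrC.
rewrite (_ : (fun x => _) = (fun x => (\sum_(j <- s) c j * ex (- j%:~R * x)) * g x) +
    c k *: (fun x => g x * ex (- k%:~R * x))); last first.
  apply/funext => x; rewrite big_cons.
  change ((c k * ex (- k%:~R * x) + \sum_(j <- s) c j * ex (- j%:~R * x)) * g x =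
   (\sum_(j <- s) c j * ex (- j%:~R * x)) * g x + c k * (g x * ex (- k%:~R * x))).
  by rewrite mulrDl addrC; congr (_ + _); rewrite -mulrA; congr (_ * _); rewrite mulrC.
apply: is_fourier_lin => //.
  by apply: L2_sum => j _; exact: L2Z.
exact: is_fourier_translate.
Qed.

Section periodic.
Variable q : R -> C.
Hypothesis mq : measurableC q.
Hypothesis bq : exists M, forall x, normc (q x) <= M.
Hypothesis pq : forall x (m : int), q (x + m%:~R) = q x.

Lemma L2_mul f : L2 f -> L2 (fun x => q x * f x).
Proof.
move=> Lf; have [M hM] := bq.
have M0 : 0 <= M by apply: le_trans (normc_ge0 (q 0)) (hM 0).
apply: (L2_dom _ (integrableZR (M ^+ 2) (integrable_sqr Lf))).
  by apply: measurableCM => //; exact: L2_measurable.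
move=> x; rewrite normcM exprMn ler_wpM2r ?sqr_ge0//.
by rewrite ler_pXn2r ?nnegrE ?normc_ge0.
Qed.

Lemma per_mul f : L2 f ->
  {ae mu, forall x, per (fun y => q y * f y) x = normc (q x) ^+ 2 * per f x}.
Proof.
move=> Lf; have Lq := L2_mul Lf.
apply: ae_impl (ae_and (periodization_finite Lf) (periodization_finite Lq)) => x [hf hq].
apply: (@complexI R); rewrite realcM.
have := totsumZ (normc (q x) ^+ 2)%:C%C (totsum_esum (fun k => sqr_ge0 (normc (f (x + k%:~R)))) hf).
apply: totsum_unique.
have := totsum_esum (fun k => sqr_ge0 (normc (q (x + k%:~R) * f (x + k%:~R)))) hq.
congr totsum; apply/funext => k.
by rewrite pq normcM exprMn realcM.
Qed.

Lemma brk_mul f g : L2 f -> L2 g ->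
  {ae mu, forall x, brk (fun y => q y * f y) g x = q x * brk f g x}.
Proof.
move=> Lf Lg; have Lq := L2_mul Lf.
apply: ae_impl (ae_and (periodization_finite Lg)
  (ae_and (periodization_finite Lf) (periodization_finite Lq))) => x [hg [hf hq]].
have := totsumZ (q x) (brk_totsum hf hg); apply: totsum_unique.
have := brk_totsum hq hg; congr totsum; apply/funext => k.
by rewrite pq mulrA.
Qed.

End periodic.

Section weight.
Variables (f : R -> C) (beta c0 : R).
Hypothesis Lf : L2 f.
Hypothesis beta_gt0 : 0 < beta.

Let I : set R := `[c0, (c0 + 1)[%classic.

Let mI : measurable (I : set (measurableTypeR R)).
Proof. exact: measurable_itv. Qed.

(* [per f] is at most [beta] only almost everywhere. *)
Definition wgt (x : R) : R := Num.sqrt (Num.min beta (per f x)).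

Lemma wgt_sqr x : wgt x ^+ 2 = Num.min beta (per f x).
Proof. by rewrite sqr_sqrtr// le_min (ltW beta_gt0) per_ge0. Qed.

Lemma wgt_le x : wgt x ^+ 2 <= beta.
Proof. by rewrite wgt_sqr ge_min lexx. Qed.

Lemma wgt_measurable : measurable_fun setT wgt.
Proof.
apply: (@measurableT_comp _ _ _ _ _ _ (Num.sqrt : R -> R)).
  by apply: continuous_measurable_fun; exact: sqrt_continuous.
by apply: measurable_minr => //; apply: per_measurable; exact: L2_measurable.
Qed.

Lemma L2_ind_bounded (q : R -> C) : measurableC q -> (exists M, forall x, normc (q x) <= M) ->
  L2 (fun x => ind 1 c0 x * q x).
Proof.
move=> mq [M hM]; apply: (L2_dom _ (integrableZR (M ^+ 2) (integrable_real_ind 1 c0))).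
  by apply: measurableCM => //; exact: measurable_ind.
move=> x; rewrite normcM exprMn mulrC normc_real.
have M0 : 0 <= M by apply: le_trans (normc_ge0 (q 0)) (hM 0).
apply: ler_pM; rewrite ?sqr_ge0//.
  by rewrite ler_pXn2r ?nnegrE ?normc_ge0.
by rewrite indicE; case: (_ \in _); rewrite ?normr1 ?normr0 ?expr1n// expr0n.
Qed.

Lemma L2_wgt (q : R -> C) : measurableC q -> (exists M, forall x, normc (q x) <= M) ->
  L2 (fun x => ind 1 c0 x * (q x * (wgt x)%:C%C)).
Proof.
move=> mq [M hM]; apply: L2_ind_bounded.
  by apply: measurableCM => //; apply: measurableC_real; exact: wgt_measurable.
have M0 : 0 <= M by apply: le_trans (normc_ge0 (q 0)) (hM 0).
exists (M * Num.sqrt beta) => x.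
rewrite normcM normc_real ger0_norm ?sqrtr_ge0//; apply: ler_pM; rewrite ?normc_ge0 ?sqrtr_ge0//.
by apply: ler_wsqrtr; rewrite ge_min lexx.
Qed.

(** The truncation in [wgt] makes this hold for every [q]: approximation in L^2 of a period survives
    the weight at the cost of a factor sqrt(beta). *)
Lemma nrm_wgt_le (q : R -> C) : measurableC q -> (exists M, forall x, normc (q x) <= M) ->
  nrm (fun x => ind 1 c0 x * (q x * (wgt x)%:C%C)) ^+ 2 <=
  beta * nrm (fun x => ind 1 c0 x * q x) ^+ 2.
Proof.
move=> mq hq; have L1 := L2_wgt mq hq; have L2' := L2_ind_bounded mq hq.
rewrite -lee_fin -sqnE// EFinM -sqnE// /sqn -ge0_integralZl//; last 3 first.
- by apply/measurable_EFinP; apply: measurable_sqr_normc; exact: L2_measurable.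
- by move=> x _; rewrite lee_fin sqr_ge0.
- by rewrite lee_fin ltW.
apply: ge0_le_integral => //.
- by move=> x _; rewrite lee_fin sqr_ge0.
- by apply/measurable_EFinP; apply: measurable_sqr_normc; exact: L2_measurable.
- apply: emeasurable_funM => //; apply/measurable_EFinP; apply: measurable_sqr_normc; exact: L2_measurable.
move=> x _; rewrite -EFinM lee_fin mulrA !normcM !exprMn (normc_real (wgt x)).
by rewrite real_normK ?num_real// [leRHS]mulrC ler_wpM2l ?wgt_le// mulr_ge0// sqr_ge0.
Qed.

Lemma nrm_wgt (q : R -> C) : {ae mu, forall x, per f x <= beta} ->
  measurableC q -> (exists M, forall x, normc (q x) <= M) ->
  (forall x (m : int), q (x + m%:~R) = q x) ->
  nrm (fun x => ind 1 c0 x * (q x * (wgt x)%:C%C)) = nrm (fun x => q x * f x).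
Proof.
move=> hb mq bq pq; have L1 := L2_wgt mq bq; have L2' := L2_mul mq bq Lf.
apply/eqP; rewrite -(@eqrXn2 _ 2) ?nrm_ge0//; apply/eqP.
have [_ <-] := indM_integrable c0 L2'.
rewrite -[LHS]/(fine (nrm (fun x => ind 1 c0 x * (q x * (wgt x)%:C%C)) ^+ 2)%:E).
rewrite -sqnE// /sqn /Rintegral; congr fine; apply: ae_eq_integral => //.
- by apply/measurable_EFinP; apply: measurable_sqr_normc; exact: L2_measurable.
- apply/measurable_EFinP; apply: measurable_funM.
    exact: measurable_indic.
  by apply: per_measurable; exact: L2_measurable.
apply: ae_impl (ae_and hb (per_mul mq bq pq Lf)) => x [h1 h2] _.
congr EFin; rewrite h2 !normcM !exprMn !normc_real !real_normK ?num_real//.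
rewrite wgt_sqr min_r//; congr (_ * _).
by rewrite indicE; case: (_ \in _); rewrite ?expr1n ?expr0n.
Qed.

End weight.

Section fourier_side.
Variables (phi : R -> C) (beta : R).
Hypothesis Lphi : L2 phi.
Hypothesis beta_gt0 : 0 < beta.
Hypothesis synth : forall c A,
  nrm (comb (translates phi) c A) ^+ 2 <= beta * \sum_(k <- A) normc (c k) ^+ 2.

Let a := fourier phi.
Let hphi : is_fourier phi a := fourierP Lphi.
Let La : L2 a. Proof. by case: hphi. Qed.
Let LT k : L2 (translates phi k). Proof. exact: L2_translate. Qed.

Lemma nrm_comb_mult c A : nrm (comb (translates phi) c A) = nrm (fun x => mult c A x * a x).
Proof. by rewrite (is_fourier_isometry (L2_comb LT c A) (is_fourier_mult c A Lphi hphi)). Qed.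

Lemma comb_fbase (c0 : R) c A x :
  comb (fbase 1 c0) c A x = ind 1 c0 x * comb (@chr R) c A x.
Proof.
rewrite !combE mulr_sumr; apply: eq_bigr => k _.
by rewrite /fbase /chr sqrtr1 invr1 mul1r mulr1 mulrCA.
Qed.

(** On the Fourier side, the synthesis bound says that the integral of |q|^2 (beta - Phi) over a
    period is nonnegative for every trigonometric polynomial q, so the positivity test applies. *)
Lemma per_le_beta : {ae mu, forall x, per a x <= beta}.
Proof.
apply: ae_intervals => c0.
pose I : set R := `[c0, (c0 + 1)[%classic.
have mI : measurable (I : set (measurableTypeR R)) by exact: measurable_itv.
have [ia _] := indM_integrable c0 La; rewrite -/I in ia.
have i1 := integrable_real_ind 1 c0; rewrite -/I in i1.
pose h x := \1_I x * (beta - per a x).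
have ih : mu.-integrable setT (EFin \o h).
  have := integrableB (@measurableT _ _) (integrableZR beta i1) ia.
  by apply: eq_integrable => // x _; rewrite /= -EFinB; congr EFin; rewrite /h; ring.
have hI x : ~ (c0 <= x < c0 + 1) -> h x = 0.
  by move=> xI; rewrite /h indicE memNset ?mul0r//= in_itv/=.
have : {ae mu, forall x, 0 <= h x}.
  apply: (positive_of_trig_test ltr01 ih hI) => _ /lspanP[c [A ->]].
  pose c' k := (c k)^*.
  have mm := mult_measurable c' A; have bm := mult_bounded c' A.
  have nE x : normc (mult c' A x) = normc (comb (@chr R) c A x).
    by rewrite mult_conj normc_conj.
  have Lm := L2_mul mm bm La.
  have [im em] := indM_integrable c0 Lm; rewrite -/I in im em.
  have := synth c' A; rewrite nrm_comb_mult -em.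
  rewrite (eq_bigr (fun k => normc (c k) ^+ 2)); last by move=> k _; rewrite normc_conj.
  have LB k := fbase_L2 1 c0 k.
  rewrite -(on_sqr_comb LB (@fbase_orthonormal R 1 c0 ltr01)).
  have LC := L2_comb LB c A.
  rewrite -subr_ge0.
  have iC : mu.-integrable setT (EFin \o (fun x => \1_I x * normc (comb (@chr R) c A x) ^+ 2)).
    apply: eq_integrable (integrable_sqr LC) => // x _.
    congr EFin; rewrite comb_fbase normcM exprMn normc_real real_normK ?num_real//.
    by rewrite indicE; case: (_ \in _); rewrite ?expr1n ?expr0n.
  have -> : nrm (comb (fbase 1 c0) c A) ^+ 2 =
      Rintegral mu setT (fun x => \1_I x * normc (comb (@chr R) c A x) ^+ 2).
    rewrite -[LHS]/(fine (nrm (comb (fbase 1 c0) c A) ^+ 2)%:E) -sqnE//.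
    congr fine; apply: eq_integral => x _; congr EFin.
    rewrite comb_fbase normcM exprMn normc_real real_normK ?num_real//.
    by rewrite indicE; case: (_ \in _); rewrite ?expr1n ?expr0n.
  rewrite -RintegralZl// -RintegralB//; last exact: integrableZR.
  move=> /le_trans; apply; rewrite le_eqVlt; apply/orP; left; apply/eqP.
  congr fine; apply: ae_eq_integral => //.
  - have := integrableB (@measurableT _ _) (integrableZR beta iC) im.
    by move=> /integrableP[].
  - apply/measurable_EFinP; apply: measurable_funM.
      under eq_fun do rewrite divr1 -nE.
      exact: (measurable_sqr_normc mm).
    apply: measurable_funM; first exact: measurable_indic.
    by apply: measurable_funB => //; apply: per_measurable; exact: L2_measurable.
  apply: ae_impl (per_mul mm bm (mult_periodic c' A) La) => x hx _.
  by congr EFin; rewrite hx nE divr1 /h; ring.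
apply: ae_impl => x + xI; rewrite /h indicE mem_set//= ?in_itv//= mul1r.
by rewrite subr_ge0.
Qed.

End fourier_side.
End multipliers.

(** * The frame operator on the Fourier side *)

Section frame_operator_multiplier.
Variable R : realType.
Notation C := R[i].
Notation mu := (@lebesgue_measure R).
Variables (phi phit : R -> C) (beta beta' : R).
Hypotheses (Lphi : L2 phi) (Lphit : L2 phit).
Hypotheses (beta_gt0 : 0 < beta) (beta'_gt0 : 0 < beta').
Hypothesis bphi : bessel_bound (translates phi) beta.
Hypothesis bphit : bessel_bound (translates phit) beta'.

Let a := fourier phi.
Let b := fourier phit.
Let hphi : is_fourier phi a := fourierP Lphi.
Let hphit : is_fourier phit b := fourierP Lphit.
Let La : L2 a. Proof. by case: hphi. Qed.
Let Lb : L2 b. Proof. by case: hphit. Qed.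
Let LT k : L2 (translates phi k). Proof. exact: L2_translate. Qed.
Let LT' k : L2 (translates phit k). Proof. exact: L2_translate. Qed.
Let pera : {ae mu, forall x, per a x <= beta}.
Proof. exact: per_le_beta Lphi (bessel_synthesis LT beta_gt0 bphi). Qed.
Let perb : {ae mu, forall x, per b x <= beta'}.
Proof. exact: per_le_beta Lphit (bessel_synthesis LT' beta'_gt0 bphit). Qed.

Let M := 3 * (beta + beta').

(* [brk a b] is bounded by [M] only almost everywhere. *)
Definition tbr (x : R) : C := if normc (brk a b x) <= M then brk a b x else 0.

Lemma tbr_measurable : measurableC tbr.
Proof.
have [mr mi] := brk_measurable (L2_measurable La) (L2_measurable Lb).
have mn := measurable_normc (brk_measurable (L2_measurable La) (L2_measurable Lb)).
have ml : measurable_fun setT (fun x => normc (brk a b x) <= M).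
  exact: measurable_fun_ler.
split.
  rewrite (_ : (fun x => _) = (fun x => if normc (brk a b x) <= M then
      Re (brk a b x) else 0)); last first.
    by apply/funext => x; rewrite /tbr; case: ifP.
  exact: measurable_fun_ifT.
rewrite (_ : (fun x => _) = (fun x => if normc (brk a b x) <= M then
    Im (brk a b x) else 0)); last first.
  by apply/funext => x; rewrite /tbr; case: ifP.
exact: measurable_fun_ifT.
Qed.

Lemma tbr_bounded x : normc (tbr x) <= M.
Proof.
rewrite /tbr; case: ifP => // _; rewrite normc0 /M mulr_ge0// addr_ge0//; exact: ltW.
Qed.

Lemma tbr_brk : {ae mu, forall x, tbr x = brk a b x}.
Proof.
apply: ae_impl (ae_and (ae_and pera perb)
  (ae_and (periodization_finite La) (periodization_finite Lb))) => x [[h1 h2] [h3 h4]].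
rewrite /tbr ifT// (le_trans (brk_bound h3 h4))// ler_wpM2l//.
exact: lerD.
Qed.

Lemma tbr_bracket : {ae mu, forall x, tbr x = bracket a b x}.
Proof. by apply: ae_impl (ae_and tbr_brk (bracket_ae La Lb)) => x [-> ->]. Qed.

Lemma nrm_normc_eq (f g : R -> C) : (forall x, normc (f x) = normc (g x)) -> nrm f = nrm g.
Proof.
move=> e; rewrite /nrm /normLp; congr (fine (Lnorm _ _ _)).
by apply/funext => x; rewrite e.
Qed.

Section combination.
Variables (c0 : R) (d : int -> C) (D : {fset int}).

Let q := mult d D.
Let mq : measurableC q := mult_measurable d D.
Let bq : exists M, forall x, normc (q x) <= M := mult_bounded d D.
Let f := comb (translates phi) d D.
Let Lf : L2 f. Proof. exact: L2_comb. Qed.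
Let c k := inner f (translate k phit).

Let mqt : measurableC (fun x => q x * tbr x).
Proof. by apply: measurableCM => //; exact: tbr_measurable. Qed.

Let bqt : exists M, forall x, normc (q x * tbr x) <= M.
Proof.
have [M1 h1] := bq; exists (M1 * M) => x.
by rewrite normcM ler_pM ?normc_ge0 ?tbr_bounded.
Qed.

(** After Plancherel, the phase of the translate is absorbed into the periodic multiplier [Q]; the
    inner product then becomes the integral of a bracket over one period, from which [Q] factors
    out. *)
Lemma coeff_mult k : c k =
  integralC (fun x => ind 1 c0 x * (q x * tbr x * ex (k%:~R * x))).
Proof.
pose Q x := q x * ex (k%:~R * x).
have mQ : measurableC Q.
  by apply: measurableCM => //; exact: measurable_ex_scaled.
have bQ : exists M, forall x, normc (Q x) <= M.
  by have [M1 h1] := bq; exists M1 => x; rewrite normcM normc_ex mulr1.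
have pQ x (m : int) : Q (x + m%:~R) = Q x.
  by rewrite /Q ex_periodic /q mult_periodic.
have := is_fourier_inner Lf (L2_translate k Lphit) (is_fourier_mult d D Lphi hphi)
  (is_fourier_translate k Lphit hphit).
rewrite -/(c k) => <-.
have -> : inner (fun x => mult d D x * a x) (fun x => b x * ex (- k%:~R * x)) =
    inner (fun x => Q x * a x) b.
  congr integralC; apply/funext => x.
  rewrite conjM conj_ex /Q -/q mulNr opprK mulrA -!mulrA; congr (_ * _).
  by rewrite [RHS]mulrC -!mulrA.
have LQ := L2_mul mQ bQ La.
have [_ ->] := inner_brk c0 LQ Lb.
apply: integralC_ae.
- apply: measurableCM; first exact: measurable_ind.
  by apply: brk_measurable; exact: L2_measurable.
- apply: measurableCM; first exact: measurable_ind.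
  by apply: measurableCM => //; exact: measurable_ex_scaled.
apply: ae_impl (ae_and tbr_brk (brk_mul mQ bQ pQ La Lb)) => x [-> ->].
by rewrite /Q; congr (_ * _); rewrite -!mulrA; congr (_ * _); rewrite mulrC.
Qed.

(* The [c k] are the Fourier coefficients of [q * tbr] on a period; conjugation
   turns them into coefficients in the basis [fbase]. *)
Lemma mult_approx (e : R) : 0 < e -> exists A : {fset int}, forall B : {fset int},
  (A `<=` B)%fset ->
  nrm (fun x => ind 1 c0 x * (q x * tbr x - mult c B x)) <= e.
Proof.
move=> e0; pose C' x := (ind 1 c0 x * (q x * tbr x))^*.
have mi : measurableC (@ind R 1 c0) by exact: measurable_ind.
have LC : L2 C'.
  have L0 := L2_ind_bounded c0 mqt bqt.
  apply: (L2_dom _ (integrable_sqr L0)); last by move=> x; rewrite normc_conj.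
  by apply: measurableC_conj; exact: L2_measurable.
have LB k := fbase_L2 1 c0 k.
have sup x : ~ (c0 <= x < c0 + 1) -> C' x = 0.
  by move=> h; rewrite /C' indE; case: ifP => // _; rewrite mul0r rmorph0.
have cE k : inner C' (fbase 1 c0 k) = (c k)^*.
  rewrite (coeff_mult k) -integralC_conj; last first.
    have L0 := L2_ind_bounded c0 mqt bqt.
    have := integrable_inner L0 (LB (- k)).
    have -> // : (fun x => ind 1 c0 x * (q x * tbr x) * (fbase 1 c0 (- k) x)^*) =
       (fun x => ind 1 c0 x * (q x * tbr x * ex (k%:~R * x))).
    apply/funext => x; rewrite /fbase sqrtr1 invr1 mul1r mulr1 indE.
    by case: ifP => _; rewrite ?(mul0r, rmorph0)// !mul1r conj_ex -mulNr -rmorphN opprK.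
  congr integralC; apply/funext => x; rewrite /C' /fbase sqrtr1 invr1 mul1r mulr1 indE.
  by case: ifP => _; rewrite ?(mul0r, rmorph0)// !mul1r -conjM.
have := on_expansion LB (@fbase_orthonormal R 1 c0 ltr01) (fbase_complete ltr01 LC sup).
move=> /(has_L2sumP LB)[_ /(_ e e0)[A hA]]; exists A => B AB.
apply: le_trans (hA B AB); rewrite le_eqVlt; apply/orP; left; apply/eqP.
apply: nrm_normc_eq => x; rewrite -[RHS]normc_conj; congr normc.
change (ind 1 c0 x * (q x * tbr x - mult c B x) =
  (C' x - comb (fbase 1 c0) (fun k => inner C' (fbase 1 c0 k)) B x)^*).
have -> : ind 1 c0 x * (q x * tbr x - mult c B x) =
    (C' x)^* - ind 1 c0 x * mult c B x by rewrite mulrBr /C' conjCK.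
rewrite comb_fbase rmorphB; congr (_ - _); apply/esym.
rewrite -[LHS]/((ind 1 c0 x * comb (@chr R) (fun k => inner C' (fbase 1 c0 k)) B x)^*).
rewrite conjM realc_conj -mult_conj; congr (_ * _).
by apply: eq_bigr => k _; rewrite cE conjCK.
Qed.

(** For a partial sum [g] of [s], |f - g| is exactly a weighted norm of the difference of two
    multipliers. Along growing index sets it tends to the left side by convergence of the sum, and
    to the right side because the multipliers tend to [q * tbr]. *)
Lemma nrm_residual s : has_L2sum (fun k x => c k * translates phi k x) s ->
  nrm (f - s) = nrm (fun x => ind 1 c0 x * (q x * (1 - tbr x) * (wgt a beta x)%:C%C)).
Proof.
move=> hs; have [Ls cs] := (has_L2sumP LT c s).1 hs.
apply/eqP; rewrite -subr_eq0 -normr_le0; apply/ler_addgt0Pl => e e0; rewrite addr0.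
have sb : 0 < Num.sqrt beta by rewrite sqrtr_gt0.
have e2 : 0 < e / 2 by rewrite divr_gt0.
have [A1 h1] := cs _ e2.
(* The division by sqrt(beta) compensates the bound on the weight. *)
have [A2 h2] := mult_approx (divr_gt0 e2 sb).
pose B := (A1 `|` A2)%fset.
have {}h1 := h1 B (fsubsetUl _ _); have {}h2 := h2 B (fsubsetUr _ _).
pose g := comb (translates phi) c B.
have Lg : L2 g by exact: L2_comb.
have mr : measurableC (fun x => q x - mult c B x).
  by apply: measurableCB => //; exact: mult_measurable.
have br : exists M, forall x, normc (q x - mult c B x) <= M.
  have [M1 k1] := bq; have [M2 k2] := mult_bounded c B.
  exists (M1 + M2) => x; rewrite (le_trans (normc_triangle _ _))//.
  by rewrite normcNE lerD.
have pr x (m : int) : q (x + m%:~R) - mult c B (x + m%:~R) = q x - mult c B x.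
  by rewrite /q !mult_periodic.
have fg : nrm (f - g) =
    nrm (fun x => ind 1 c0 x * ((q x - mult c B x) * (wgt a beta x)%:C%C)).
  rewrite (nrm_wgt c0 La beta_gt0 pera mr br pr).
  have hf := is_fourier_lin (-1) Lf Lg (is_fourier_mult d D Lphi hphi)
    (is_fourier_mult c B Lphi hphi).
  have := is_fourier_isometry (L2D Lf (L2Z (-1) Lg)) hf.
  rewrite !scaleN1r => <-; apply: nrm_normc_eq => x; congr normc.
  by rewrite mulrBl.
have m1 : measurableC (fun x => q x * (1 - tbr x)).
  apply: measurableCM => //; apply: measurableCB; first exact: measurableC_cst.
  exact: tbr_measurable.
have b1 : exists M, forall x, normc (q x * (1 - tbr x)) <= M.
  have [M1 k1] := bq; exists (M1 * (normc 1 + M)) => x.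
  rewrite normcM ler_pM ?normc_ge0// (le_trans (normc_triangle _ _))//.
  by rewrite normcNE lerD// tbr_bounded.
have m2 : measurableC (fun x => q x * tbr x - mult c B x).
  by apply: measurableCB => //; exact: mult_measurable.
have b2 : exists M, forall x, normc (q x * tbr x - mult c B x) <= M.
  have [M1 k1] := bqt; have [M2 k2] := mult_bounded c B.
  exists (M1 + M2) => x; rewrite (le_trans (normc_triangle _ _))//.
  by rewrite normcNE lerD.
pose r := fun x => ind 1 c0 x * (q x * (1 - tbr x) * (wgt a beta x)%:C%C).
pose t := fun x => ind 1 c0 x * ((q x - mult c B x) * (wgt a beta x)%:C%C).
have Lr : L2 r by exact: L2_wgt.
have Lt : L2 t by exact: L2_wgt.
rewrite -/r.
have k1 : `|nrm (f - s) - nrm (f - g)| <= e / 2.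
  rewrite (le_trans (nrm_lipschitz (L2B Lf Ls) (L2B Lf Lg)))//.
  have -> : f - s - (f - g) = g - s by rewrite opprB addrC addrA subrK.
  by rewrite (nrmBC Lg Ls).
have k2 : `|nrm t - nrm r| <= e / 2.
  rewrite (le_trans (nrm_lipschitz Lt Lr))//.
  have -> : nrm (t - r) =
      nrm (fun x => ind 1 c0 x * ((q x * tbr x - mult c B x) * (wgt a beta x)%:C%C)).
    apply: nrm_normc_eq => x; congr normc.
    rewrite -[LHS]/(t x - r x) /t /r; ring.
  rewrite -(@ler_pXn2r _ 2) ?nnegrE ?nrm_ge0 ?(ltW e2)//.
  rewrite (le_trans (nrm_wgt_le c0 La beta_gt0 m2 b2))//.
  have -> : (e / 2) ^+ 2 = beta * (e / 2 / Num.sqrt beta) ^+ 2.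
    by rewrite [in RHS]exprMn exprVn sqr_sqrtr ?(ltW beta_gt0)// mulrCA mulfV ?mulr1// gt_eqF.
  by rewrite ler_wpM2l ?(ltW beta_gt0)// ler_pXn2r// nnegrE ?nrm_ge0// divr_ge0 ?(ltW e2) ?(ltW sb).
rewrite (splitr e); apply: le_trans (lerD k1 k2); rewrite -/t in fg; rewrite fg.
exact: ler_distD.
Qed.

Lemma nrm_comb_wgt : nrm f = nrm (fun x => ind 1 c0 x * (q x * (wgt a beta x)%:C%C)).
Proof.
rewrite (nrm_wgt c0 La beta_gt0 pera mq bq) ?nrm_comb_mult//.
by move=> x m; exact: mult_periodic.
Qed.

End combination.
End frame_operator_multiplier.

(** * Frame operators and approximate duals *)

Section frame_operator.
Variable R : realType.
Notation C := R[i].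
Notation mu := (@lebesgue_measure R).
Variables (F G : int -> R -> C) (beta beta' : R).
Hypotheses (LF : forall k, L2 (F k)) (LG : forall k, L2 (G k)).
Hypotheses (beta_gt0 : 0 < beta) (beta'_gt0 : 0 < beta').
Hypothesis bF : bessel_bound F beta.
Hypothesis bG : bessel_bound G beta'.

Definition frame_op f : R -> C := L2sum (fun k x => inner f (G k) * F k x).

Lemma frame_opP f : L2 f -> has_L2sum (fun k x => inner f (G k) * F k x) (frame_op f).
Proof.
move=> Lf; apply: L2sumP.
by apply: (bessel_has_L2sum LF beta_gt0 bF (E := beta' * nrm f ^+ 2)) => A; exact: bG.
Qed.

Lemma frame_op_L2 f : L2 f -> L2 (frame_op f).
Proof. by move=> /frame_opP[]. Qed.

(** The chosen sums are not linear on the nose, but [S f - S g] is again a sum with the coefficients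
    of [f - g]; the bounds of [G] and of [F] then give the two factors. *)
Lemma frame_op_diff f g : L2 f -> L2 g ->
  nrm (frame_op f - frame_op g) <= Num.sqrt (beta * beta') * nrm (f - g).
Proof.
move=> Lf Lg; have Lfg := L2B Lf Lg.
have := has_L2sum_lin LF (-1) (frame_opP Lf) (frame_opP Lg).
have -> : (fun (k : int) x => (inner f (G k) + -1 * inner g (G k)) * F k x) =
    (fun (k : int) x => inner (f - g) (G k) * F k x).
  by apply/funext => k; apply/funext => x; rewrite innerBl// mulN1r.
rewrite scaleN1r => hs.
have := has_L2sum_bound LF beta_gt0 bF (fun A => bG A Lfg) hs.
rewrite mulrA => h; rewrite -(@ler_pXn2r _ 2)// ?nnegrE ?mulr_ge0 ?nrm_ge0 ?sqrtr_ge0//.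
by rewrite exprMn sqr_sqrtr// mulr_ge0// ltW.
Qed.

Lemma frame_op_dense (eps : R) H : (forall k, L2 (H k)) -> 0 <= eps ->
  (forall f, lspan H f -> nrm (f - frame_op f) <= eps * nrm f) ->
  forall f, closed_span H f -> nrm (f - frame_op f) <= eps * nrm f.
Proof.
move=> LH eps0 h f Wf; have [Lf hf] := (closed_spanP LH f).1 Wf.
pose K := Num.sqrt (beta * beta'); have K0 : 0 <= K by exact: sqrtr_ge0.
(* The total factor of |f - g| in |f - g| + |g - S g| + |S g - S f|, where |g| <= |f| + |f - g|. *)
have K1 : 0 < 1 + eps + K by rewrite -addrA ltr_pwDl// addr_ge0.
apply/ler_addgt0Pl => e e0; have [g lg fg] := hf _ (divr_gt0 e0 K1).
have Lg := lspan_L2 LH lg.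
have Sf := frame_op_L2 Lf; have Sg := frame_op_L2 Lg.
have t1 := nrm_triangle (L2B Lf Lg) (L2D (L2B Lg Sg) (L2B Sg Sf)).
have t2 := nrm_triangle (L2B Lg Sg) (L2B Sg Sf).
have e1 : f - g + (g - frame_op g + (frame_op g - frame_op f)) = f - frame_op f.
  by rewrite !subrKA.
rewrite e1 in t1.
have d := frame_op_diff Lg Lf; rewrite (nrmBC Lg Lf) -/K in d.
have hg := h g lg.
have ng : nrm g <= nrm f + nrm (f - g).
  by have := nrm_triangle Lf (L2B Lg Lf); rewrite addrC subrK (nrmBC Lg Lf).
have eg : eps * nrm g <= eps * nrm f + eps * nrm (f - g).
  by rewrite -mulrDr ler_wpM2l.
have : (1 + eps + K) * nrm (f - g) <= e.
  by rewrite mulrC -ler_pdivlMr// ltW.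
rewrite !mulrDl mul1r => he; apply: (le_trans t1).
apply: (@le_trans _ _ (nrm (f - g) + (eps * nrm f + eps * nrm (f - g) + K * nrm (f - g)))).
  by rewrite lerD2l (le_trans t2)// lerD// (le_trans hg).
by rewrite -[eps * _ + _ + _]addrA [nrm (f - g) + _]addrCA [nrm (f - g) + _]addrA addrC lerD2r.
Qed.

End frame_operator.

(** * The pointwise bracket criterion *)

Section bracket_criterion.
Variable R : realType.
Notation C := R[i].
Notation mu := (@lebesgue_measure R).
Variables (phi phit : R -> C) (beta beta' eps : R).
Hypotheses (Lphi : L2 phi) (Lphit : L2 phit) (eps_ge0 : 0 <= eps).
Hypotheses (beta_gt0 : 0 < beta) (beta'_gt0 : 0 < beta').
Hypothesis bphi : bessel_bound (translates phi) beta.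
Hypothesis bphit : bessel_bound (translates phit) beta'.

Let a := fourier phi.
Let b := fourier phit.
Let La : L2 a. Proof. by case: (fourierP Lphi). Qed.
Let LT k : L2 (translates phi k). Proof. exact: L2_translate. Qed.
Let LT' k : L2 (translates phit k). Proof. exact: L2_translate. Qed.
Let B := tbr phi phit beta beta'.
Let mB : measurableC B. Proof. exact: tbr_measurable. Qed.
Let w := wgt a beta.
Let S := frame_op (translates phi) (translates phit).

Lemma nrm_sqr_Rintegral (f : R -> C) : L2 f ->
  nrm f ^+ 2 = Rintegral mu setT (fun x => normc (f x) ^+ 2).
Proof. by move=> Lf; rewrite -[LHS]/(fine (nrm f ^+ 2)%:E) -sqnE. Qed.

Lemma nrm_le_ae (f g : R -> C) : L2 f -> L2 g ->
  {ae mu, forall x, normc (f x) <= normc (g x)} -> nrm f <= nrm g.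
Proof.
move=> Lf Lg h; rewrite -(@ler_pXn2r _ 2)// ?nnegrE ?nrm_ge0//.
rewrite -lee_fin -!sqnE//; apply: ae_ge0_le_integral => //.
- by move=> x _; rewrite lee_fin sqr_ge0.
- by apply/measurable_EFinP; apply: measurable_sqr_normc; exact: L2_measurable.
- by move=> x _; rewrite lee_fin sqr_ge0.
- by apply/measurable_EFinP; apply: measurable_sqr_normc; exact: L2_measurable.
apply: ae_impl h => x h _; rewrite lee_fin ler_pXn2r// nnegrE; exact: normc_ge0.
Qed.

Lemma mult_residual_bounded (q : R -> C) : (exists M, forall x, normc (q x) <= M) ->
  exists M, forall x, normc (q x * (1 - B x)) <= M.
Proof.
move=> [M1 k1]; exists (M1 * (normc 1 + 3 * (beta + beta'))) => x.
rewrite normcM ler_pM ?normc_ge0// (le_trans (normc_triangle _ _))//.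
by rewrite normcNE lerD// tbr_bounded.
Qed.

Lemma bracket_sufficient :
  {ae mu, forall x, (~` zero_set (periodization a)) x -> normc (bracket a b x - 1) <= eps} ->
  forall f, closed_span (translates phi) f -> nrm (f - S f) <= eps * nrm f.
Proof.
move=> h; apply: (frame_op_dense LT LT' beta_gt0 beta'_gt0 bphi bphit LT eps_ge0).
move=> _ /lspanP[d [D ->]].
have Lf := L2_comb LT d D.
have hs := frame_opP LT beta_gt0 bphi bphit Lf.
rewrite (nrm_residual Lphi Lphit beta_gt0 beta'_gt0 bphi bphit 0 hs).
rewrite (nrm_comb_wgt Lphi beta_gt0 bphi 0).
have mq := mult_measurable d D; have bq := mult_bounded d D.
have L1 := L2_wgt beta 0 La mq bq.
have mr : measurableC (fun x => mult d D x * (1 - B x)).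
  by apply: measurableCM => //; apply: measurableCB => //; exact: measurableC_cst.
have L2' := L2_wgt beta 0 La mr (mult_residual_bounded bq).
rewrite -[eps](ger0_norm eps_ge0) -normc_real -nrmZ//.
apply: nrm_le_ae => //; first exact: L2Z.
apply: ae_impl (ae_and h (tbr_bracket Lphi Lphit beta_gt0 beta'_gt0 bphi bphit)) => x [hx bx].
rewrite -[X in _ <= normc X]/(eps%:C%C * (ind 1 0 x * (mult d D x * (wgt a beta x)%:C%C))).
rewrite !normcM !normc_real (ger0_norm eps_ge0) [leRHS]mulrCA.
apply: ler_wpM2l; first exact: normr_ge0.
rewrite -mulrA [leRHS]mulrCA; apply: ler_wpM2l; first exact: normc_ge0.
(* Where Phi vanishes the hypothesis is silent, but so does the weight. *)
have [z|nz] := pselect (zero_set (periodization a) x).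
  have -> : wgt a beta x = 0.
    rewrite /wgt; have -> : per a x = 0 by rewrite /per z.
    by rewrite min_r ?sqrtr0// ltW.
  by rewrite normr0 !mulr0.
apply: ler_wpM2r; first exact: normr_ge0.
by rewrite bx normcBC; exact: hx.
Qed.

Lemma bracket_necessary :
  (forall f, closed_span (translates phi) f -> nrm (f - S f) <= eps * nrm f) ->
  {ae mu, forall x, (~` zero_set (periodization a)) x -> normc (bracket a b x - 1) <= eps}.
Proof.
move=> hS; apply: ae_intervals => c0.
pose I : set R := `[c0, (c0 + 1)[%classic.
have mI : measurable (I : set (measurableTypeR R)) by exact: measurable_itv.
(* The multiplier 1, which gives [g] and [r] the shape of the weighted functions treated before. *)
pose o : C := 1.
pose g x : C := ind 1 c0 x * (o * (w x)%:C%C).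
pose r x : C := ind 1 c0 x * (o * (1 - B x) * (w x)%:C%C).
have n1 : normc o = 1 by rewrite (_ : o = 1%:C%C)// normc_real normr1.
have b1 : exists M, forall x : R, normc o <= M by exists (normc o).
have m1 : measurableC (fun=> o) by exact: measurableC_cst.
have mr : measurableC (fun x => o * (1 - B x)).
  by apply: measurableCM => //; apply: measurableCB.
have Lg : L2 g := L2_wgt beta c0 La m1 b1.
have Lr : L2 r := L2_wgt beta c0 La mr (mult_residual_bounded b1).
(* On the period this is [(eps ^+ 2 - |1 - B|^2) * w ^+ 2]. Multiplying it by |q|^2 yields the
   integrand of eps^2 |f|^2 - |f - S f|^2 for the combination [f] with multiplier [q]. *)
pose h x := eps ^+ 2 * normc (g x) ^+ 2 - normc (r x) ^+ 2.
have ih : mu.-integrable setT (EFin \o h).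
  by apply: (integrableB (@measurableT _ _) (integrableZR (eps ^+ 2) (integrable_sqr Lg))
    (integrable_sqr Lr)).
have hI x : ~ (c0 <= x < c0 + 1) -> h x = 0.
  move=> xI; rewrite /h /g /r indE; case: ifP => // _.
  by rewrite !mul0r normc0 expr0n mulr0 subr0.
have : {ae mu, forall x, 0 <= h x}.
  apply: (positive_of_trig_test ltr01 ih hI) => _ /lspanP[c [A ->]].
  pose d k := (c k)^*; pose q := mult d A.
  have mq := mult_measurable d A; have bq := mult_bounded d A.
  have nE x : normc (comb (@chr R) c A x) = normc (q x).
    by rewrite /q mult_conj normc_conj.
  have Lf := L2_comb LT d A.
  have hs := frame_opP LT beta_gt0 bphi bphit Lf.
  have := hS _ (lspan_sub LT ((lspanP _ _).2 (ex_intro _ d (ex_intro _ A erefl)))).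
  rewrite (nrm_residual Lphi Lphit beta_gt0 beta'_gt0 bphi bphit c0 hs).
  rewrite (nrm_comb_wgt Lphi beta_gt0 bphi c0) -/q.
  have mqr : measurableC (fun x => q x * (1 - B x)).
    by apply: measurableCM => //; apply: measurableCB.
  have L1 := L2_wgt beta c0 La mq bq.
  have L2' := L2_wgt beta c0 La mqr (mult_residual_bounded bq).
  rewrite -(@ler_pXn2r _ 2)// ?nnegrE ?mulr_ge0 ?nrm_ge0// exprMn.
  rewrite (nrm_sqr_Rintegral L1) (nrm_sqr_Rintegral L2') -subr_ge0.
  rewrite -RintegralZl//; last exact: integrable_sqr.
  rewrite -RintegralB//; last exact: integrable_sqr; last first.
    by apply: integrableZR; exact: integrable_sqr.
  move=> /le_trans; apply; rewrite le_eqVlt; apply/orP; left; apply/eqP.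
  apply: eq_Rintegral => x _; rewrite divr1 nE /h /g /r !normcM -/B -/w n1 -/q.
  ring.
move=> hpos; apply: ae_impl (ae_and (ae_and hpos (periodization_finite La))
  (tbr_bracket Lphi Lphit beta_gt0 beta'_gt0 bphi bphit)) => x [[hx fx] bx] xI nz.
(* Being off the zero set is not enough, since [per] is 0 also where the periodization is infinite;
   [fx] rules this out. *)
have p0 : 0 < per a x.
  rewrite lt_neqAle per_ge0 andbT eq_sym; apply/eqP => z; apply: nz.
  rewrite /zero_set /=; have := z; rewrite /per => /eqP.
  rewrite fine_eq0 ?ge0_fin_numE ?periodization_ge0// => /eqP //.
have w0 : 0 < w x ^+ 2 by rewrite wgt_sqr// lt_min beta_gt0.
move: hx; rewrite /h /g /r indE xI !mul1r !normcM normc_real.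
rewrite !exprMn real_normK ?num_real// -mulrBl pmulr_lge0// subr_ge0.
rewrite ler_pXn2r ?nnegrE ?normc_ge0// => hx.
by rewrite -bx normcBC.
Qed.

End bracket_criterion.

(** * Frame bounds and approximate dual frames *)

Section approximate_duals.
Variable R : realType.
Notation C := R[i].
Variables (F G : int -> R -> C) (beta beta' eps : R).
Hypotheses (LF : forall k, L2 (F k)) (WG : forall k, closed_span F (G k)).
Hypotheses (beta_gt0 : 0 < beta) (beta'_gt0 : 0 < beta').
Hypotheses (eps_ge0 : 0 <= eps) (eps_lt1 : eps < 1).
Hypothesis bF : bessel_bound F beta.
Hypothesis bG : bessel_bound G beta'.

Let LG k : L2 (G k). Proof. exact: closed_span_L2 (WG k). Qed.
Notation W := (closed_span F).
Notation S := (frame_op F G).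
Let SP f (Lf : L2 f) := frame_opP LF beta_gt0 bF bG Lf.
Let LS f (Lf : L2 f) := frame_op_L2 LF beta_gt0 bF bG Lf.

Lemma coeff_energy_le (H : int -> R -> C) (gamma : R) f :
  bessel_bound H gamma ->
  L2 f -> (coeff_energy H f <= (gamma * nrm f ^+ 2)%:E)%E.
Proof.
by move=> bH Lf; apply: esum_le_fset => A; rewrite energyE lee_fin; exact: bH.
Qed.

(** Allows a real upper bound [E] of the partial energies to be assumed; an infinite energy is
    harmless. *)
Lemma coeff_energy_ge (H : int -> R -> C) f (t : R) :
  (forall E, (forall A : {fset int}, \sum_(k <- A) normc (inner f (H k)) ^+ 2 <= E) -> t <= E) ->
  (t%:E <= coeff_energy H f)%E.
Proof.
move=> h; have e A : ((\sum_(k <- A : {fset int}) normc (inner f (H k)) ^+ 2)%:E <=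
    coeff_energy H f)%E.
  rewrite -energyE; apply: fset_le_esum => k; rewrite lee_fin; exact: sqr_ge0.
case E : (coeff_energy H f) => [r||]; rewrite ?leey//.
  by rewrite lee_fin; apply: h => A; rewrite -lee_fin -E.
by have := e fset0; rewrite E leeNy_eq.
Qed.

(** Writing [z] as 1 + (z - 1) matches the shape of [has_L2sum_lin]; two sums of the same family
    agree up to norm 0. *)
Lemma frame_op_scale (z : C) f : L2 f -> nrm (S (z *: f) - z *: S f) = 0.
Proof.
move=> Lf; have := has_L2sum_lin LF (z - 1) (SP Lf) (SP Lf).
have -> : (fun (k : int) x => (inner f (G k) + (z - 1) * inner f (G k)) * F k x) =
    (fun (k : int) x => inner (z *: f) (G k) * F k x).
  by apply/funext => k; apply/funext => x; rewrite innerZl//; congr (_ * _); ring.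
have e : z *: S f = S f + (z - 1) *: S f.
  by rewrite -[X in X + _]scale1r -scalerDl addrC subrK.
by rewrite e; exact: (has_L2sum_unique LF (SP (L2Z z Lf))).
Qed.

Lemma frame_op_lower f : L2 f -> nrm (f - S f) <= eps * nrm f ->
  (((1 - eps) ^+ 2 / beta * nrm f ^+ 2)%:E <= coeff_energy G f)%E.
Proof.
move=> Lf h; apply: coeff_energy_ge => E hE.
have h1 := has_L2sum_bound LF beta_gt0 bF hE (SP Lf).
have h2 : (1 - eps) * nrm f <= nrm (S f).
  have := nrm_lipschitz Lf (LS Lf); rewrite ler_norml => /andP[_]; lra.
rewrite mulrAC ler_pdivrMr// [E * _]mulrC (le_trans _ h1)// -exprMn.
by rewrite ler_pXn2r ?nnegrE ?nrm_ge0// mulr_ge0 ?nrm_ge0 ?subr_ge0 ?ltW.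
Qed.

(* [S f] is close to [f], so [(1 - eps) |f|^2 <= |<S f, f>|]; the inner product
   is the sum of the [<f, G k> <F k, f>], and AM-GM weighted by
   [(1 - eps) / beta'] absorbs the energy of the [<f, G k>]. *)
Lemma frame_op_lower_dual f : L2 f -> nrm (f - S f) <= eps * nrm f ->
  (((1 - eps) ^+ 2 / beta' * nrm f ^+ 2)%:E <= coeff_energy F f)%E.
Proof.
move=> Lf h; apply: coeff_energy_ge => E hE.
have e1 : 0 < 1 - eps by rewrite subr_gt0.
have h2 : (1 - eps) * nrm f ^+ 2 <= normc (inner (S f) f).
  have cs := cauchy_schwarz (L2B Lf (LS Lf)) Lf.
  have cs2 : normc (inner (f - S f) f) <= eps * nrm f ^+ 2.
    by rewrite (le_trans cs)// expr2 mulrA ler_wpM2r// nrm_ge0.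
  have e : inner f f = inner (f - S f) f + inner (S f) f.
    by rewrite innerBl ?subrK//; exact: LS.
  have := normc_triangle (inner (f - S f) f) (inner (S f) f).
  rewrite -e inner_self// normc_real ger0_norm ?sqr_ge0//; lra.
apply/ler_addgt0Pl => e e0.
have d0 : 0 < beta' / (1 - eps) / 2 * e by rewrite mulr_gt0// !divr_gt0.
have [A hA] := has_L2sum_inner LF Lf (SP Lf) d0.
set T := \sum_(k <- A) _ in hA.
have hT : normc T <= (1 - eps) / 2 * nrm f ^+ 2 + beta' / (1 - eps) / 2 * E.
  rewrite (le_trans (normc_sum _ _ _))//.
  pose u k := normc (inner f (G k)); pose v k := normc (inner f (F k)).
  pose d := (1 - eps) / beta'; have dp : 0 < d by rewrite divr_gt0.
  have am k : normc (inner f (G k) * inner (F k) f) <= d / 2 * u k ^+ 2 + d^-1 / 2 * v k ^+ 2.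
    rewrite normcM -(normc_conj (inner (F k) f)) inner_conj// -/(u k) -/(v k) -subr_ge0.
    have -> : d / 2 * u k ^+ 2 + d^-1 / 2 * v k ^+ 2 - u k * v k =
        (d * u k - v k) ^+ 2 / d / 2 by field; rewrite gt_eqF.
    by rewrite !divr_ge0 ?sqr_ge0// ltW.
  apply: (@le_trans _ _ (\sum_(k <- A) (d / 2 * u k ^+ 2 + d^-1 / 2 * v k ^+ 2))).
    by apply: ler_sum => k _; exact: am.
  rewrite big_split/= -!mulr_sumr; apply: lerD.
    have -> : (1 - eps) / 2 * nrm f ^+ 2 = d / 2 * (beta' * nrm f ^+ 2).
      by rewrite /d; field; rewrite gt_eqF.
    by rewrite ler_wpM2l ?bG// divr_ge0// ltW.
  by rewrite /d invf_div ler_wpM2l ?hE// !divr_ge0// ltW.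
have h3 : normc (inner (S f) f) <= normc T + beta' / (1 - eps) / 2 * e.
  have := normc_triangle (inner (S f) f - T) T; rewrite subrK => /le_trans; apply.
  by rewrite addrC lerD2l.
have h4 : (1 - eps) * nrm f ^+ 2 <=
    (1 - eps) / 2 * nrm f ^+ 2 + beta' / (1 - eps) / 2 * (E + e).
  by rewrite mulrDr addrA (le_trans h2)// (le_trans h3)// lerD2r.
have -> : (1 - eps) ^+ 2 / beta' * nrm f ^+ 2 =
    ((1 - eps) * nrm f ^+ 2 - (1 - eps) / 2 * nrm f ^+ 2) / (beta' / (1 - eps) / 2).
  by field; rewrite !gt_eqF.
by rewrite ler_pdivrMr ?divr_gt0// lerBlDl [e + E]addrC [(E + e) * _]mulrC.
Qed.

(** The operator norm ranges over the unit ball of L^2. The projection is a contraction, which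
    reduces that ball to vectors of [W]; conversely a vector of [W] is normalized. *)
Lemma approx_dual_framesP :
  (forall f, W f -> nrm (f - S f) <= eps * nrm f) <-> approx_dual_frames eps W F G.
Proof.
have WF k : W (F k) by apply: lspan_sub => //; exact: lspan_mem.
have besF : is_bessel W F.
  split=> //; exists beta => f /closed_span_L2 Lf.
  by rewrite norm2E// -EFin_expe -EFinM; exact: coeff_energy_le.
have besG : is_bessel W G.
  split=> //; exists beta' => f /closed_span_L2 Lf.
  by rewrite norm2E// -EFin_expe -EFinM; exact: coeff_energy_le.
split=> [h|[_ _ h]].
  split.
  - split=> //; exists ((1 - eps) ^+ 2 / beta').
      by rewrite divr_gt0// exprn_gt0// subr_gt0.
    move=> f Wf; have Lf := closed_span_L2 Wf.
    by rewrite norm2E// -EFin_expe -EFinM; apply: frame_op_lower_dual => //; exact: h.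
  - split=> //; exists ((1 - eps) ^+ 2 / beta).
      by rewrite divr_gt0// exprn_gt0// subr_gt0.
    move=> f Wf; have Lf := closed_span_L2 Wf.
    by rewrite norm2E// -EFin_expe -EFinM; apply: frame_op_lower => //; exact: h.
  apply: ub_ereal_sup => _ [f [Lf nf] <-].
  have [WP _] := orthoprojP LF Lf; have LP := closed_span_L2 WP.
  (* The [G k] lie in [W], so [f] and its projection have the same coefficients. *)
  have -> : synthesis F (analysis G f) = S (orthoproj W f).
    congr L2sum; apply/funext => k; apply/funext => x.
    by rewrite /analysis inner_orthoproj.
  rewrite norm2E ?lee_fin; last by apply: L2B => //; exact: LS.
  rewrite (le_trans (h _ WP))// -[leRHS]mulr1 ler_wpM2l//.
  rewrite (le_trans (nrm_orthoproj LF Lf))//.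
  by move: nf; rewrite norm2E// lee_fin.
move=> f Wf; have Lf := closed_span_L2 Wf; have Sf := LS Lf.
(* A vector of norm 0 cannot be normalized; the Bessel bounds make [S f] of norm 0 too. *)
have [n0|n0] := eqVneq (nrm f) 0.
  have := has_L2sum_bound LF beta_gt0 bF (fun A => bG A Lf) (SP Lf).
  rewrite n0 expr0n !mulr0 => s0.
  have {}s0 : nrm (S f) = 0.
    by apply/eqP; rewrite -sqrf_eq0 eq_le s0 sqr_ge0.
  have := nrm_triangleB Lf (L20 _) Sf.
  by rewrite subr0 n0 sub0r nrmN// s0 addr0.
pose n := nrm f; have np : 0 < n by rewrite lt_neqAle eq_sym n0 nrm_ge0.
pose g := (n^-1)%:C%C *: f.
have Wg : W g by exact: closed_spanZ.
have Lg := closed_span_L2 Wg; have Sg := LS Lg.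
have fE : f = n%:C%C *: g.
  by rewrite scalerA -realcM mulfV ?scale1r// gt_eqF.
have ng : nrm g = 1.
  by rewrite nrmZ// normc_real gtr0_norm ?invr_gt0// mulVf// gt_eqF.
have Pg := orthoproj_L2 LF Lg.
have hg : nrm (g - S g) <= eps.
  have -> : nrm (g - S g) = nrm (orthoproj W g - S g).
    apply: nrm_congr; [exact: L2B|exact: L2B|].
    by rewrite opprB addrA subrK; exact: orthoproj_id.
  rewrite -lee_fin -norm2E; last exact: L2B.
  apply: le_trans h; apply: ereal_sup_ubound; exists g => //.
  by split=> //; rewrite norm2E// ng.
have -> : nrm (f - S f) = nrm (n%:C%C *: (g - S g)).
  apply: nrm_congr; [exact: L2B|by apply: L2Z; exact: L2B|].
  have -> : f - S f - n%:C%C *: (g - S g) = n%:C%C *: S g - S f.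
    by rewrite scalerBr -fE opprB addrC addrA subrK.
  have := frame_op_scale n%:C%C Lg; rewrite -fE => <-.
  by rewrite nrmBC//; exact: L2Z.
rewrite nrmZ ?normc_real ?gtr0_norm//; last exact: L2B.
by rewrite mulrC ler_wpM2r// ltW.
Qed.

End approximate_duals.

(** * Translation invariance of the closed span *)

Section translation.
Variable R : realType.
Notation C := R[i].
Variables (phi phit : R -> C).
Hypotheses (Lphi : L2 phi) (Lphit : L2 phit).
Notation W := (closed_span (translates phi)).

Let LT k : L2 (translates phi k). Proof. exact: L2_translate. Qed.

Lemma translate_translate m k (f : R -> C) : translate m (translate k f) = translate (m + k) f.
Proof. by apply/funext => x; rewrite /translate intrD opprD addrA. Qed.

Lemma closed_span_translate m (f : R -> C) : W f -> W (translate m f).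
Proof.
move=> /(closed_spanP LT)[Lf hf]; apply/(closed_spanP LT).
split=> [|e e0]; first exact: L2_translate.
have [g lg fg] := hf e e0; exists (translate m g); last first.
  rewrite (_ : translate m f - translate m g = translate m (f - g))//.
  by rewrite nrm_translate//; apply: L2B => //; exact: (lspan_L2 LT lg).
move: lg => /lspanP[c [A ->]] {fg}; rewrite /comb.
elim: (A : seq int) => [|k s ih].
  by rewrite big_nil; exact: lspan0.
rewrite big_cons.
set t := \sum_(j <- s) _ in ih *.
have -> : translate m (c k *: translates phi k + t) =
    c k *: translates phi (m + k) + translate m t.
  by rewrite {2}/translates -translate_translate.
by apply: lspanD ih; apply: lspanZ; exact: lspan_mem.
Qed.

(** The translation moves onto [f], which stays in [W], and there the projection is invisible. *)
Lemma inner_translate_orthoproj f k : W f ->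
  inner f (translate k (orthoproj W phit)) = inner f (translate k phit).
Proof.
move=> Wf; have Lf := closed_span_L2 Wf; have LP := orthoproj_L2 LT Lphit.
rewrite -(inner_conj (L2_translate k LP) Lf) -(inner_conj (L2_translate k Lphit) Lf).
congr (_^*); rewrite !inner_translate//.
by rewrite (inner_orthoproj LT Lphit)//; exact: closed_span_translate.
Qed.

End translation.

Lemma is_bessel_sum (R : realType) (F : int -> R -> R[i]) : is_bessel L2 F ->
  exists2 beta : R, 0 < beta & bessel_bound F beta.
Proof.
(* A Bessel constant may be zero or negative, whereas later estimates divide by it. *)
move=> [_ [beta h]]; exists (Num.max beta 1); first by rewrite lt_max ltr01 orbT.
move=> f A Lf; apply: (@le_trans _ _ (beta * nrm f ^+ 2)); last first.
  by rewrite ler_wpM2r ?sqr_ge0// le_max lexx.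
rewrite -lee_fin -energyE; apply: (@le_trans _ _ (coeff_energy F f)).
  by apply: fset_le_esum => k; rewrite lee_fin; exact: sqr_ge0.
by have := h f Lf; rewrite norm2E// -EFin_expe -EFinM.
Qed.

Theorem theorem7p2 (R : realType) (phi phit : R -> R[i]) (eps : R)
    (hphi : L2 phi) (hphit : L2 phit)
    (bphi : is_bessel L2 (translates phi))
    (bphit : is_bessel L2 (translates phit))
    (heps : 0 <= eps) :
  let W := closed_span (translates phi) in
  let stmt_i := forall f, W f ->
    (norm2 (f - L2sum (fun k x => inner f (translate k phit) * translate k phi x))%R
      <= eps%:E * norm2 f)%E in
  let stmt_ii := forall f, W f ->
    (norm2 (f - L2sum (fun k x =>
                   inner f (translate k (orthoproj W phit)) * translate k phi x))%R
      <= eps%:E * norm2 f)%E in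
  let stmt_iii := {ae (@lebesgue_measure R), forall gamma,
    (~` zero_set (periodization (fourier phi))) gamma ->
    normc (bracket (fourier phi) (fourier phit) gamma - 1) <= eps} in
  let stmt_iv := approx_dual_frames eps W
    (translates phi) (translates (orthoproj W phit)) in
  ((stmt_i <-> stmt_ii) /\ (stmt_ii <-> stmt_iii)) /\
  (eps < 1 -> [/\ stmt_i <-> stmt_iv, stmt_ii <-> stmt_iv & stmt_iii <-> stmt_iv]).
Proof.
move=> W stmt_i stmt_ii stmt_iii stmt_iv.
have [beta beta0 bF] := is_bessel_sum bphi.
have [beta' beta'0 bG'] := is_bessel_sum bphit.
pose P := orthoproj W phit.
have LF k : L2 (translates phi k) by exact: L2_translate.
have LG' k : L2 (translates phit k) by exact: L2_translate.
have [WP _] := orthoprojP LF hphit.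
have WG k : W (translates P k) by exact: closed_span_translate.
have LG k : L2 (translates P k) := closed_span_L2 (WG k).
(* For every [f] in L^2, <f, T_k P phit> = <P f, T_k phit>, where [P] projects onto [W] and does not
   increase norms; so [beta'] is still a bound. *)
have bG (f : R -> R[i]) (A : {fset int}) : L2 f ->
    \sum_(k <- A) normc (inner f (translates P k)) ^+ 2 <= beta' * nrm f ^+ 2.
  move=> Lf; have [Wf _] := orthoprojP LF Lf; have Lf' := closed_span_L2 Wf.
  have e k : inner f (translates P k) =
      inner (orthoproj W f) (translates phit k).
    by rewrite -(inner_orthoproj LF Lf (WG k)) /translates inner_translate_orthoproj.
  under eq_bigr do rewrite e.
  rewrite (le_trans (bG' _ A Lf'))// ler_wpM2l ?(ltW beta'0)//.
  by rewrite ler_pXn2r ?nnegrE ?nrm_ge0//; exact: nrm_orthoproj.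
have norm2_nrm F G : (forall f, L2 f -> L2 (frame_op F G f)) ->
    (forall f, W f -> (norm2 (f - frame_op F G f)%R <= eps%:E * norm2 f)%E) <->
    (forall f, W f -> nrm (f - frame_op F G f) <= eps * nrm f).
  move=> LS; have e f : W f -> ((norm2 (f - frame_op F G f)%R <= eps%:E * norm2 f)%E =
      (nrm (f - frame_op F G f) <= eps * nrm f)).
    by move=> /closed_span_L2 Lf; rewrite !norm2E//; apply: L2B => //; exact: LS.
  by split=> h f Wf; have := h f Wf; rewrite e.
have i_nrm := norm2_nrm _ _ (fun f => @frame_op_L2 _ _ _ _ _ LF beta0 bF bG' f).
have ii_nrm := norm2_nrm _ _ (fun f => @frame_op_L2 _ _ _ _ _ LF beta0 bF bG f).
have i_ii : stmt_i <-> stmt_ii.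
  have e f : W f -> (fun (k : int) x => inner f (translate k P) * translate k phi x) =
      (fun (k : int) x => inner f (translate k phit) * translate k phi x).
    by move=> Wf; apply/funext => k; apply/funext => x; rewrite inner_translate_orthoproj.
  by split=> h f Wf; have := h f Wf; rewrite -/P e.
have i_iii : stmt_i <-> stmt_iii.
  split=> [/i_nrm h|h].
    exact: (bracket_necessary hphi hphit heps beta0 beta'0 bF bG' h).
  apply/i_nrm; exact: (bracket_sufficient hphi hphit heps beta0 beta'0 bF bG' h).
have ii_iii : stmt_ii <-> stmt_iii by rewrite -i_ii.
split=> // eps1.
have ii_iv : stmt_ii <-> stmt_iv.
  exact: (iff_trans ii_nrm (approx_dual_framesP LF WG beta0 beta'0 heps eps1 bF bG)).
by split; [exact: (iff_trans i_ii ii_iv)|exact: ii_iv|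
  exact: (iff_trans (iff_sym ii_iii) ii_iv)].
Qed.
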